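(* Let $(H,X,V,\mathcal L,A,B,P,Q)$ be an admissible tuple (defined in the context) and suppose $\nu=\dim H^0>0$. Then there exist $\epsilon>0$, a (unique) Lipschitz continuous map $h:B_{H^0}(\theta,\epsilon)=B_H(\theta,\epsilon)\cap H^0\to X^\pm$ satisfying $h(\theta)=\theta$ and $$(I-P^0)A(z+h(z))=\theta\qquad\forall z\in B_{H^0}(\theta,\epsilon),$$ an open neighborhood $W$ of $\theta$ in $H$, and an origin-preserving homeomorphism $$\Phi:B_{H^0}(\theta,\epsilon)\times\bigl(B_{H^+}(\theta,\epsilon)+B_{H^-}(\theta,\epsilon)\bigr)\to W$$ of the form $\Phi(z,u^++u^-)=z+h(z)+\phi_z(u^++u^-)$ with $\phi_z(u^++u^-)\in H^\pm$, such that $$\mathcal L\circ\Phi(z,u^++u^-)=\|u^+\|^2-\|u^-\|^2+\mathcal L(z+h(z))$$ for all $(z,u^++u^-)\in B_{H^0}(\theta,\epsilon)\times(B_{H^+}(\theta,\epsilon)+B_{H^-}(\theta,\epsilon))$, and $$\Phi\bigl(B_{H^0}(\theta,\epsilon)\times(B_{H^+}(\theta,\epsilon)\cap X+B_{H^-}(\theta,\epsilon))\bigr)\subset X.$$ Moreover $\Phi$ has the following properties: (a) for each $z\in B_{H^0}(\theta,\epsilon)$, $\Phi(z,\theta)=z+h(z)$, and $\phi_z(u^++u^-)\in H^-$ if and only if $u^+=\theta$; (b) the restriction of $\Phi$ to $B_{H^0}(\theta,\epsilon)\times B_{H^-}(\theta,\epsilon)$ is a homeomorphism from $B_{H^0}(\theta,\epsilon)\times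 B_{H^-}(\theta,\epsilon)\subset X\times X$ onto $\Phi(B_{H^0}(\theta,\epsilon)\times B_{H^-}(\theta,\epsilon))\subset X$ even if these two sets are given the topologies induced by $X$. The map $h$ and the function $\mathcal L^\circ:B_{H^0}(\theta,\epsilon)\to\mathbb R$, $\mathcal L^\circ(z)=\mathcal L(z+h(z))$, also satisfy: (i) $h$ is strictly Fréchet differentiable at $\theta\in H^0$ and $h'(\theta)z=-[(I-P^0)A'(\theta)|_{X^\pm}]^{-1}(I-P^0)A'(\theta)z$ for all $z\in H^0$; (ii) $\mathcal L^\circ$ is $C^{2-0}$, $d\mathcal L^\circ(z_0)(z)=(A(z_0+h(z_0)),z)_H$ for all $z_0\in B_{H^0}(\theta,\epsilon)$, $z\in H^0$, and $d\mathcal L^\circ$ is strictly Fréchet differentiable at $\theta\in H^0$ with $d^2\mathcal L^\circ(\theta)=0$; (iii) if $\theta$ is an isolated critical point of $\mathcal L|_{V^X}$, then $\theta$ is also an isolated critical point of $\mathcal L^\circ$.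
   Context: Conventions. All vector spaces are real; $\theta$ denotes the origin of any of them. $B_E(\theta,r)$, $\bar B_E(\theta,r)$ are the open and closed balls of a normed space $E$; subspaces of $H$ carry the norm of $H$ unless stated otherwise. $L(E_1,E_2)$ is the space of bounded linear operators and $L_s(H)\subset L(H)$ that of bounded self-adjoint operators. A map $T:U\to E_2$ on an open subset $U$ of a normed space $E_1$ is continuously directional differentiable on $U$ if $DT(x,u)=\lim_{t\to0}(T(x+tu)-T(x))/t$ exists for all $x\in U$, $u\in E_1$ and $(x,u)\mapsto DT(x,u)$ is continuous on $U\times E_1$ (then $u\mapsto DT(x,u)$ is bounded linear; it is written $DT(x)$ or $T'(x)$). $T$ is strictly Fréchet differentiable at $x_0$ if there is $T'(x_0)\in L(E_1,E_2)$ with $\|T(x)-T(y)-T'(x_0)(x-y)\|=o(\|x-y\|)$ as $x\to x_0$, $y\to x_0$. $C^{k-0}$ means $C^{k-1}$ with locally Lipschitz $(k-1)$-st derivative. A critical point is a point where the (Gâteaux) derivative vanishes. Admissible tuple. $(H,X,V,\mathcal L,A,B,P,Q)$ is admissible if: (S) $H$ is a Hilbert space with inner product $(\cdot,\cdot)_H$ and norm $\|\cdot\|$; $X$ is a Banach space with norm $\|\cdot\|_X$; $X\subset H$ is a dense linear subspace and $\|x\|\le\|x\|_X$ for $x\in X$. $V$ is an open neighborhood of $\theta$ in $H$; $V^X:=V\cap X$ regarded as an open subset of $X$. (F1) $\mathcal L:V\to\mathbb R$ is continuously directional differentiable on $V$. (F2) $A:V^X\to X$ is continuously directional differentiable, strictly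 Fréchet differentiable at $\theta$, and $D\mathcal L(x)(u)=(A(x),u)_H$ for all $x\in V^X$, $u\in X$. (F3) $B:V^X\to L_s(H)$ is a map with $(DA(x)(u),v)_H=(B(x)u,v)_H$ for all $x\in V^X$, $u,v\in X$. (C1) $\theta$ is a critical point of $\mathcal L|_{V^X}$ (and thus of $\mathcal L$), and $0$ is either not in the spectrum $\sigma(B(\theta))$ or is an isolated point of it. (C2) If $u\in H$ and $B(\theta)u\in X$, then $u\in X$. (D) $B(x)=P(x)+Q(x)$ for all $x\in V^X$, where $P(x):H\to H$ is a positive definite linear operator and $Q(x):H\to H$ is a compact linear operator, with: (D1) all eigenvectors of $B(\theta)$ belonging to negative eigenvalues lie in $X$; (D2) for any sequence $\{x_k\}\subset V\cap X$ with $\|x_k\|\to0$, $\|P(x_k)u-P(\theta)u\|\to0$ for every $u\in H$; (D3) $Q:V\cap X\to L(H)$ is continuous at $\theta$ with respect to the topology on $V\cap X$ induced from $H$; (D4) for any sequence $\{x_n\}\subset V\cap X$ with $\|x_n\|\to0$ there exist $C_0>0$ and $n_0\in\mathbb N$ with $(P(x_n)u,u)_H\ge C_0\|u\|^2$ for all $u\in H$, $n\ge n_0$. Notation. $H^0=\mathrm{Ker}(B(\theta))$, $H^\pm=(H^0)^\perp$ (the range of $B(\theta)$), and $H=H^0\oplus H^+\oplus H^-$ is the orthogonal decomposition with $H^+$, $H^-$ invariant under $B(\theta)$, $B(\theta)|_{H^+}$ positive definite and $B(\theta)|_{H^-}$ negative definite. $H^0$ and $H^-$ are finite dimensional and contained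 in $X$. $\nu=\dim H^0$ (nullity), $\mu=\dim H^-$ (Morse index). $P^0,P^+,P^-$ are the orthogonal projections onto $H^0,H^+,H^-$; $X^\pm=X\cap H^\pm$. *)

(* Defs.v *)
From HB Require Import structures.
From mathcomp Require Import all_boot all_order all_algebra.
From mathcomp Require Import sesquilinear.
From mathcomp Require Import all_classical all_reals all_analysis.

Set Implicit Arguments.
Unset Strict Implicit.
Unset Printing Implicit Defensive.
Import Order.TTheory GRing.Theory Num.Theory.
Import numFieldNormedType.Exports.

Local Open Scope classical_set_scope.
Local Open Scope ring_scope.

(* A linear subspace of a normed space [E] is a set [S : set E]; a map defined
   on a subset of a space is a total function of which only the values on that
   subset matter. *)

Section Calculus.
Context {R : realType} {E F : normedModType R}.
Implicit Types (S U D : set E) (T f : E -> F).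

(* The operator norm of T restricted to S is at most k. *)
Definition opnorm_le S T (k : R) : Prop :=
  forall u, S u -> `|T u| <= k * `|u|.

Definition bounded_linear_on S T : Prop :=
  (forall (a : R) u v, S u -> S v -> T (a *: u + v) = a *: T u + T v) /\
  exists k, opnorm_le S T k.

Definition cont_dir_differentiable U T : Prop :=
  (forall x u, U x -> derivable T x u) /\
  {within U `*` setT, continuous (fun p : E * E => 'D_(p.2) T p.1)}.

(* [dfx] is the Frechet derivative at x of f restricted to the subspace S. *)
Definition frechet_derivative S f (x : E) (dfx : E -> F) : Prop :=
  bounded_linear_on S dfx /\
  forall e : R, 0 < e -> exists2 d : R, 0 < d &
    forall u, S u -> `|u| < d -> `|f (x + u) - f x - dfx u| <= e * `|u|.

(* Same as above, with f strictly differentiable. *)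
Definition strict_derivative S f (x0 : E) (dfx : E -> F) : Prop :=
  bounded_linear_on S dfx /\
  forall e : R, 0 < e -> exists2 d : R, 0 < d &
    forall x y, S x -> S y -> `|x - x0| < d -> `|y - x0| < d ->
      `|f x - f y - dfx (x - y)| <= e * `|x - y|.

(* Strict differentiability of a map G from S into the normed space of bounded
   linear operators on S. *)
Definition strict_derivative_op S (G : E -> E -> F) (x0 : E)
    (dG : E -> E -> F) : Prop :=
  ((forall (a : R) x y, S x -> S y -> forall u, S u ->
      dG (a *: x + y) u = a *: dG x u + dG y u) /\
   (forall x, S x -> bounded_linear_on S (dG x)) /\
   exists k : R, forall x, S x -> opnorm_le S (dG x) (k * `|x|)) /\
  forall e : R, 0 < e -> exists2 d : R, 0 < d &
    forall x y, S x -> S y -> `|x - x0| < d -> `|y - x0| < d ->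
      opnorm_le S (fun u => G x u - G y u - dG (x - y) u) (e * `|x - y|).

(* f, on the relatively open subset D of the subspace S, is C^1 with locally
   Lipschitz derivative df. *)
Definition is_C2m0 S D f (df : E -> E -> F) : Prop :=
  [/\ forall x, D x -> frechet_derivative S f x (df x),
      forall x, D x -> forall e : R, 0 < e -> exists2 d : R, 0 < d &
        forall y, D y -> `|y - x| < d ->
          opnorm_le S (fun u => df y u - df x u) e
    & forall x, D x -> exists (d k : R), 0 < d /\
        forall y z, D y -> D z -> `|y - x| < d -> `|z - x| < d ->
          opnorm_le S (fun u => df y u - df z u) (k * `|y - z|)].

(* The critical points in U of f, as a function on the subspace S. *)
Definition critical_points S U f : set E :=
  [set x | U x /\ forall u, S u -> derivable f x u /\ 'D_u f x = 0].

Definition bounded_operator T : Prop := bounded_linear_on setT T.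

Definition compact_operator T : Prop := precompact (T @` [set u | `|u| <= 1]).

End Calculus.

Definition homeomorphism_on (S T : topologicalType) (D : set S) (W : set T)
    (f : S -> T) : Prop :=
  exists g : T -> S,
    [/\ f @` D = W, forall x, D x -> g (f x) = x,
        {within D, continuous f} & {within W, continuous g}].

(* [T'] is the inverse, in L(S, S), of the restriction of T to S. *)
Definition inverse_on (R : realType) (E : normedModType R) (S : set E)
    (T T' : E -> E) : Prop :=
  [/\ T @` S `<=` S, T' @` S `<=` S, bounded_linear_on S T',
      forall u, S u -> T' (T u) = u & forall u, S u -> T (T' u) = u].

(* Real spectrum; for a bounded self-adjoint operator on a real Hilbert space
   this is also the spectrum of the complexification. *)
Definition spectrum (R : realType) (H : normedModType R) (T : H -> H) : set R :=
  [set l | ~ exists T' : H -> H,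
     inverse_on setT (fun u => T u - l *: u) T'].

Section Hilbert.
Context {R : realType} {H : normedModType R}.
Variable ip : {dot H for idfun}.
Implicit Types (S : set H) (T : H -> H).

Definition selfadjoint T : Prop := forall u v, ip (T u) v = ip u (T v).

Definition posdef_on S T : Prop := forall u, S u -> u != 0 -> 0 < ip (T u) u.

Definition negdef_on S T : Prop := forall u, S u -> u != 0 -> ip (T u) u < 0.

Definition op_kernel T : set H := [set u | T u = 0].

Definition orthogonal_complement S : set H :=
  [set u | forall v, S v -> ip u v = 0].

(* The orthogonal projection onto S; S must be a complete subspace. *)
Definition orthogonal_projection S (x : H) : H :=
  xget 0 [set y | S y /\ orthogonal_complement S (x - y)].

Definition linear_subspace S : Prop :=
  S 0 /\ forall (a : R) u v, S u -> S v -> S (a *: u + v).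

(* H = ker T (+) Hp (+) Hm is the orthogonal decomposition into T-invariant
   subspaces with T positive definite on Hp and negative definite on Hm. *)
Definition spectral_decomposition T (Hp Hm : set H) : Prop :=
  [/\ linear_subspace Hp /\ linear_subspace Hm,
      [/\ forall u v, op_kernel T u -> Hp v -> ip u v = 0,
          forall u v, op_kernel T u -> Hm v -> ip u v = 0
        & forall u v, Hp u -> Hm v -> ip u v = 0],
      forall x, exists u up um, [/\ op_kernel T u, Hp up, Hm um & x = u + up + um],
      T @` Hp `<=` Hp /\ T @` Hm `<=` Hm
    & posdef_on Hp T /\ negdef_on Hm T].

End Hilbert.

(* X is a dense linear subspace of H with its own norm: it is a type with an
   injection [j : X -> H], and V^X is [j @^-1` V], an open neighborhood of 0 in
   X. As strict differentiability of A at 0 only involves points near 0, it is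
   stated for A as a map on X. *)
Record admissible (R : realType) (H X : completeNormedModType R)
    (ip : {dot H for idfun}) (j : {linear X -> H}) (V : set H)
    (L : H -> R) (A : X -> X) (B P Q : X -> {linear H -> H}) : Prop := {
  adm_hilbert_norm : forall x : H, `|x| ^+ 2 = ip x x;
  adm_incl_inj : injective j;
  adm_incl_dense : dense (range j);
  adm_incl_norm : forall x : X, `|j x| <= `|x|;
  adm_V_open : open V;
  adm_V_origin : V 0;
  adm_F1 : cont_dir_differentiable V L;
  adm_F2_dir : cont_dir_differentiable (j @^-1` V) A;
  adm_F2_strict : exists A0 : X -> X, strict_derivative setT A 0 A0;
  adm_F2_gradient : forall x u : X, V (j x) ->
    'D_(j u) L (j x) = ip (j (A x)) (j u);
  adm_F3_Ls : forall x : X, V (j x) ->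
    bounded_operator (B x) /\ selfadjoint ip (B x);
  adm_F3_hessian : forall x u v : X, V (j x) ->
    ip (j ('D_u A x)) (j v) = ip (B x (j u)) (j v);
  adm_C1_critical : critical_points setT (j @^-1` V) (L \o j) 0;
  adm_C1_spectrum : ~ spectrum (B 0) 0 \/ isolated (spectrum (B 0)) 0;
  adm_C2 : forall u : H, range j (B 0 u) -> range j u;
  adm_D_sum : forall (x : X) (u : H), V (j x) -> B x u = P x u + Q x u;
  adm_D_posdef : forall x : X, V (j x) -> posdef_on ip setT (P x);
  adm_D_compact : forall x : X, V (j x) -> compact_operator (Q x);
  adm_D1 : forall (l : R) (u : H), l < 0 -> u != 0 -> B 0 u = l *: u -> range j u;
  adm_D2 : forall x_ : nat -> X, (forall k, V (j (x_ k))) ->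
    `|j (x_ k)| @[k --> \oo] --> (0 : R) ->
    forall u : H, `|P (x_ k) u - P 0 u| @[k --> \oo] --> (0 : R);
  adm_D3 : forall e : R, 0 < e -> exists2 d : R, 0 < d &
    forall x : X, V (j x) -> `|j x| < d ->
      opnorm_le setT (fun u => Q x u - Q 0 u) e;
  adm_D4 : forall x_ : nat -> X, (forall k, V (j (x_ k))) ->
    `|j (x_ k)| @[k --> \oo] --> (0 : R) ->
    exists (C0 : R) (n0 : nat), 0 < C0 /\
      forall n u, (n0 <= n)%N -> C0 * `|u| ^+ 2 <= ip (P (x_ n) u) u
}.

(* The element of X with image u under j; junk value 0 when u is not in X. *)
Definition incl_inv (R : realType) (H X : normedModType R) (j : X -> H) (u : H) : X :=
  xget 0 [set x | j x = u].

(* The ball of radius r about the origin of the subspace S. *)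
Definition sball (R : realType) (H : normedModType R) (S : set H) (r : R) :
    set H :=
  S `&` [set u | `|u| < r].

(* h is a Lipschitz map from the ball of radius e of H^0 into X^+- (with the
   norm of X) with h 0 = 0 and (I - P^0) A(z + h(z)) = 0. *)
Definition reduction_map (R : realType) (H X : completeNormedModType R)
    (ip : {dot H for idfun}) (j : {linear X -> H}) (V : set H)
    (A : X -> X) (H0 : set H) (e : R) (h : H -> X) : Prop :=
  [/\ forall z, sball H0 e z ->
        orthogonal_complement ip H0 (j (h z)) /\ V (z + j (h z)),
      [lipschitz h z | z in sball H0 e],
      h 0 = 0
    & forall z, sball H0 e z ->
        let a := j (A (incl_inv j z + h z)) in
        a - orthogonal_projection ip H0 a = 0].

(* Main.v *)
(* Lyapunov-Schmidt reduction followed by a fiberwise Morse lemma that uses only first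
   derivatives of L on H. On X the derivative of A at 0 is the restriction of B(0); by
   (C2) and the bounded inverse theorem it is invertible on the range part of X, so a
   contraction solves the range equation by a Lipschitz map h with h'(0) = 0. Positive
   definiteness of P and compactness of Q keep B(x) uniformly positive on H^+ and
   negative on H^- for x near 0 in the norm of H, and the corresponding monotonicity of
   DL extends from X to H by density. Hence, for fixed z and x in H^+, the function y
   |-> L(z + h(z) + x + y) on H^- is strongly concave with a unique maximum y = v(z,
   x). The increment of L(z + h(z) + x + v(z, x)) in x, and the decrement of L in y -
   v(z, x), grow at least quadratically along rays, so rescaling x and y - v(z, x)
   along their rays turns the two increments into |u^+|^2 and -|u^-|^2; Phi is the
   inverse of this change of variables. *)
Require Import Defs.
From HB Require Import structures.
From mathcomp Require Import all_boot all_order all_algebra.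
From mathcomp Require Import sesquilinear.
From mathcomp Require Import all_classical all_reals all_analysis.
From mathcomp Require Import ring lra.

Set Implicit Arguments.
Unset Strict Implicit.
Unset Printing Implicit Defensive.
Import Order.TTheory GRing.Theory Num.Theory.
Import numFieldNormedType.Exports.

Local Open Scope classical_set_scope.
Local Open Scope ring_scope.

(** The obstacle is that second derivatives of [L] are available only through [A] and [B] on [X],
    while the fibers are balls of [H]; moreover [P] is assumed to converge only strongly, and only
    at the origin. An implicit function theorem on [H] is therefore out of reach. Two inequalities
    with constants valid on a whole ball of [H] replace it: monotonicity of the derivative of [L]
    tested against x - y, where the cross terms cancel by symmetry of [B], and a Lipschitz bound for
    derivatives in the directions of [Hm], where strong convergence is uniform because [Hm] is
    finite dimensional. The maximum point v(z, x) is only known to be Lipschitz, so growth along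
    rays of x comes from comparing values with a fixed competitor y, never from differentiating v.
    To get a homeomorphism in infinite dimension, the inverse is written down explicitly and the
    image is described by strict inequalities. Away from the origin [h] too is only Lipschitz; the
    smoothness of the reduced functional comes from A(z + h(z)) lying in the kernel. *)

Section NormedSpaces.
Context {R : realType}.

(** * Completeness: series, contractions and the bounded inverse theorem *)

Lemma geometric_series_bounded (V : completeNormedModType R) (u : nat -> V)
    (M q : R) : 0 <= q < 1 -> (forall k, `|u k| <= M * q ^+ k) ->
  exists2 s, series u @ \oo --> s & `|s| <= M / (1 - q).
Proof.
move=> /andP[q0 q1] uM.
have q1' : `|q| < 1 by rewrite ger0_norm.
have M0 : 0 <= M by have := uM 0; rewrite expr0 mulr1; apply: le_trans.
have cg := is_cvg_geometric_series (a := M) q1'.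
have cn : cvgn [normed series u].
  by apply: (series_le_cvg _ _ uM cg) => n //; rewrite mulr_ge0// exprn_ge0.
exists (limn (series u)); first exact: (normed_cvg cn).
apply: (le_trans (lim_series_norm cn)).
rewrite -(cvg_lim _ (cvg_geometric_series q1'))//.
exact: lim_series_le.
Qed.

Lemma contraction_fixed_point (V : completeNormedModType R) (U : set V)
    (f : V -> V) (q : R) :
  closed U -> U !=set0 -> (forall x, U x -> U (f x)) -> 0 <= q < 1 ->
  (forall x y, U x -> U y -> `|f x - f y| <= q * `|x - y|) ->
  exists2 p, U p & f p = p.
Proof.
move=> Uc U0 fU /andP[q0 q1] fq.
have fun_f : set_fun U U f by [].
pose g : {fun U >-> U} := HB.pack f (@isFun.Build _ _ U U f fun_f).
have ctr : is_contraction g.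
  exists (NngNum q0); split => //= -[x y] [/= Ux Uy]; exact: fq.
have [p Up pE] := banach_fixed_point ctr Uc U0.
by exists p.
Qed.

Lemma lipschitz_at_continuous (E F : normedModType R) (f : E -> F) (M : R) x :
  (forall y, `|f y - f x| <= M * `|y - x|) -> {for x, continuous f}.
Proof.
move=> fM; apply/cvgrPdist_lt => e e0.
have M1 : 0 < `|M| + 1 by rewrite ltr_wpDl.
near=> y; rewrite distrC (le_lt_trans (fM y))//.
rewrite (@le_lt_trans _ _ ((`|M| + 1) * `|y - x|))//.
  by rewrite ler_wpM2r// (le_trans (ler_norm M))// lerDl.
rewrite -ltr_pdivlMl// distrC; near: y; apply: cvgr_dist_lt => //.
by rewrite mulr_gt0// invr_gt0.
Unshelve. all: by end_near. Qed.

Lemma linear_opnorm_continuous (E F : normedModType R) (T : {linear E -> F})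
    (M : R) : (forall x, `|T x| <= M * `|x|) -> continuous T.
Proof.
by move=> TM x; apply: (@lipschitz_at_continuous _ _ _ M) => y; rewrite -linearB.
Qed.

(* By Baire, some ball has a dense image in a neighborhood, so that each y is
   approximated within |y|/2; iterating gives an exact preimage. *)
Lemma bounded_inverse (E F : completeNormedModType R) (T : {linear E -> F})
    (M : R) : (forall x, `|T x| <= M * `|x|) -> bijective T ->
  exists2 c, 0 < c & forall x, `|x| <= c * `|T x|.
Proof.
move=> TM [T' TK KT].
have Tc := linear_opnorm_continuous TM.
pose C n : set F := closure (T @` [set x | `|x| <= n%:R]).
have [n /denseNE[U [[y0 [Uo Uy0]] UC]]] : exists n, ~ dense (~` C n).
  apply/existsNP => CD.
  have oC n : open (~` C n) by apply: closed_openC; exact: closed_closure.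
  have /(_ setT) [] := Baire (fun n => conj (oC n) (CD n)).
  - by exists 0.
  - exact: openT.
  move=> y [_] /(_ (Num.truncn `|T' y|).+1 I); apply.
  apply: subset_closure; exists (T' y) => //=.
  by rewrite ltW// truncnS_gt.
have UCn y : U y -> C n y.
  move=> Uy; apply: contrapT => Cy.
  by have : (U `&` ~` C n) y by []; rewrite UC.
have /nbhs_ballP[r /= r0 ballU] : nbhs y0 U by exact: open_nbhs_nbhs.
(* A vector of norm less than r is a difference of two points of the ball around [y0]; both are
   approximable from the ball of radius n, whence the bound 2n. *)
have approx0 y : `|y| < r -> forall e, 0 < e ->
    exists2 x, `|x| <= (2 * n)%:R & `|y - T x| < e.
  move=> yr e e0.
  have e2 : 0 < e / 2 by rewrite divr_gt0.
  have /(_ _ (nbhsx_ballx _ _ e2))[_ [[x1 /= x1n <-]]] : C n (y0 + y).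
    by apply/UCn/ballU; rewrite -ball_normE /ball_/= opprD addrA subrr sub0r normrN.
  rewrite -ball_normE /ball_/= => d1.
  have /(_ _ (nbhsx_ballx _ _ e2))[_ [[x2 /= x2n <-]]] : C n y0.
    by apply/UCn/ballU; exact: ballxx.
  rewrite -ball_normE /ball_/= => d2.
  exists (x1 - x2).
    by rewrite (le_trans (ler_normB _ _))// mul2n -addnn natrD lerD.
  rewrite linearB/= (_ : _ - _ = (y0 + y - T x1) - (y0 - T x2)); last first.
    by rewrite !opprB [RHS](AC (3*2) (1*5*(2*3*4)))/= subrr add0r addrA addrAC.
  by rewrite (le_lt_trans (ler_normB _ _))// [e]splitr ltrD.
have [c c0 approx] : exists2 c, 0 < c & forall y, exists2 x,
    `|x| <= c * `|y| & `|y - T x| <= 2^-1 * `|y|.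
  exists ((2 * n)%:R * (2 / r) + 1).
    by rewrite ltr_wpDl// mulr_ge0 ?ler0n// divr_ge0 ?ltW.
  move=> y; have [->|yN0] := eqVneq y 0.
    exists 0; first by rewrite !normr0 mulr0.
    by rewrite linear0 subr0 !normr0 mulr0.
  have y0' : 0 < `|y| by rewrite normr_gt0.
  pose t := r / 2 / `|y|.
  have t0 : 0 < t by rewrite !divr_gt0.
  have ty : `|t *: y| < r.
    by rewrite normrZ gtr0_norm// divfK ?gt_eqF// ltr_pdivrMr// ltr_pMr// ltr1n.
  (* Undoing the scaling by t = r / (2|y|) turns the precision r / 4 into |y| / 2. *)
  have [x xn xy] := approx0 _ ty (r / 4) (divr_gt0 r0 (ltr0Sn _ _)).
  exists (t^-1 *: x).
    rewrite normrZ gtr0_norm ?invr_gt0// -ler_pdivlMl ?invr_gt0// invrK.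
    apply: (le_trans xn); rewrite (_ : t * _ = (2 * n)%:R + r / 2); last first.
      by rewrite /t; field; rewrite !gt_eqF.
    by rewrite lerDl divr_ge0 ?ltW.
  have -> : y - T (t^-1 *: x) = t^-1 *: (t *: y - T x).
    by rewrite linearZ scalerBr scalerA mulVf ?lt0r_neq0// scale1r.
  rewrite normrZ gtr0_norm ?invr_gt0// ler_pdivrMl//; apply: (le_trans (ltW xy)).
  by rewrite le_eqVlt; apply/orP; left; apply/eqP; rewrite /t; field; rewrite !gt_eqF.
have /choice[g gP] : forall y, exists x,
    `|x| <= c * `|y| /\ `|y - T x| <= 2^-1 * `|y|.
  by move=> y; have [x] := approx y; exists x.
exists (c * 2); first by rewrite mulr_gt0.
move=> x; pose y := T x.
pose y_ k := iter k (fun y => y - T (g y)) y.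
have y_le k : `|y_ k| <= `|y| * 2^-1 ^+ k.
  elim: k => [|k IH]; first by rewrite expr0 mulr1.
  apply: (le_trans (gP _).2); rewrite exprS mulrCA ler_wpM2l//.
have gy_le k : `|g (y_ k)| <= (c * `|y|) * 2^-1 ^+ k.
  by apply: (le_trans (gP _).1); rewrite -mulrA ler_wpM2l// ltW.
have q01 : 0 <= (2^-1 : R) < 1 by rewrite invr_ge0 ler0n invf_lt1// ltr1n.
have [s cs sle] := geometric_series_bounded q01 gy_le.
suff xs : x = s.
  rewrite -/y [in leLHS]xs; apply: (le_trans sle); rewrite (_ : 1 - 2^-1 = 2^-1); last by field.
  by rewrite invrK mulrAC.
apply: (can_inj TK); rewrite -/y.
have Ts : T (series (fun k => g (y_ k)) k) @[k --> \oo] --> T s.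
  by apply: continuous_cvg => //; exact: Tc.
have yS k : T (series (fun k => g (y_ k)) k) = y - y_ k.
  elim: k => [|k IH]; first by rewrite seriesEnat/= big_nil linear0 subrr.
  rewrite seriesSr linearD IH /y_ iterS -/(y_ k) opprB addrA.
    by rewrite [RHS]addrAC.
have y_0 : y_ k @[k --> \oo] --> (0 : F).
  apply/cvgr0Pnorm_le => e e0.
  have q1' : `|2^-1 : R| < 1 by case/andP: q01 => ? ?; rewrite ger0_norm.
  have /cvgr0Pnorm_le/(_ e e0) := cvg_geometric `|y| q1'.
  apply: filterS => k; apply: le_trans.
  by apply: (le_trans (y_le k)); rewrite /geometric/= ler_norm.
have yy : y - y_ k @[k --> \oo] --> y.
  by rewrite -[X in _ --> X]subr0; apply: cvgB => //; exact: cvg_cst.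
rewrite -(cvg_lim (@norm_hausdorff _ F) Ts) (_ : (fun k => T _) = (fun k => y - y_ k)).
  by rewrite (cvg_lim (@norm_hausdorff _ F) yy).
by apply/funext => k; exact: yS.
Qed.

End NormedSpaces.

(** First-order condition at a minimum, shared by the Riesz theorem and the Rayleigh quotient. The
    test point -b / (c + 1), rather than -b / c, stays meaningful when c = 0. *)
Lemma quadratic_ge0_linear_eq0 (R : realFieldType) (b c : R) :
  (forall t, 0 <= 2 * t * b + t ^+ 2 * c) -> b = 0.
Proof.
move=> H; have c0 : 0 <= c by have := H 1; have := H (-1); lra.
have c1 : 0 < c + 1 by lra.
apply/eqP; apply: contraT => b0.
have b2 : 0 < b ^+ 2 by rewrite exprn_even_gt0.
have := H (- b / (c + 1)).
have -> : 2 * (- b / (c + 1)) * b + (- b / (c + 1)) ^+ 2 * c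
   = - (b ^+ 2 * (c + 2)) / (c + 1) ^+ 2 by field; rewrite gt_eqF.
by rewrite mulNr oppr_ge0 leNgt divr_gt0 ?exprn_gt0// mulr_gt0//; lra.
Qed.

(** * Inner products and the Riesz representation *)

Section Hilbert.
Context {R : realType} {H : completeNormedModType R} (ip : {dot H for idfun}).
Hypothesis ipE : forall x : H, `|x| ^+ 2 = ip x x.
Implicit Types (u v w : H) (S : set H).

Lemma ipC u v : ip u v = ip v u.
Proof. by rewrite hermC expr0 mul1r. Qed.

Lemma ipDl u v w : ip (u + v) w = ip u w + ip v w.
Proof. by rewrite linearDl. Qed.

Lemma ipBl u v w : ip (u - v) w = ip u w - ip v w.
Proof. by rewrite linearBl. Qed.

Lemma ipZl (a : R) u w : ip (a *: u) w = a * ip u w.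
Proof. by rewrite linearZl_LR. Qed.

Lemma ipNl u w : ip (- u) w = - ip u w.
Proof. by rewrite linearNl. Qed.

Lemma ip0l w : ip 0 w = 0.
Proof. by rewrite linear0l. Qed.

Lemma ipDr w u v : ip w (u + v) = ip w u + ip w v.
Proof. by rewrite linearDr. Qed.

Lemma ipBr w u v : ip w (u - v) = ip w u - ip w v.
Proof. by rewrite linearBr. Qed.

Lemma ipZr w (a : R) u : ip w (a *: u) = a * ip w u.
Proof. by rewrite linearZr_LR. Qed.

Lemma ipNr w u : ip w (- u) = - ip w u.
Proof. by rewrite linearNr. Qed.

Lemma ip0r w : ip w 0 = 0.
Proof. by rewrite linear0r. Qed.

Definition ip_lin := (ipDl, ipBl, ipZl, ipNl, ip0l, ipDr, ipBr, ipZr, ipNr, ip0r).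

Lemma normD_sq u v : `|u + v| ^+ 2 = `|u| ^+ 2 + 2 * ip u v + `|v| ^+ 2.
Proof. by rewrite !ipE !ip_lin [ip v u]ipC; ring. Qed.

Lemma normB_sq u v : `|u - v| ^+ 2 = `|u| ^+ 2 - 2 * ip u v + `|v| ^+ 2.
Proof. by rewrite !ipE !ip_lin [ip v u]ipC; ring. Qed.

Lemma cauchy_schwarz u v : `|ip u v| <= `|u| * `|v|.
Proof.
have [->|v0] := eqVneq v 0; first by rewrite ip0r normr0 mulr_ge0.
have v0' : 0 < `|v| ^+ 2 by rewrite exprn_gt0// normr_gt0.
rewrite -(@ler_pXn2r _ 2) ?nnegrE ?mulr_ge0// exprMn real_normK ?num_real//.
have : 0 <= `|u - (ip u v / `|v| ^+ 2) *: v| ^+ 2 by rewrite sqr_ge0.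
rewrite normB_sq ipZr normrZ exprMn real_normK ?num_real//.
have -> : `|u| ^+ 2 - 2 * (ip u v / `|v| ^+ 2 * ip u v) +
    (ip u v / `|v| ^+ 2) ^+ 2 * `|v| ^+ 2 =
    (`|u| ^+ 2 * `|v| ^+ 2 - ip u v ^+ 2) / `|v| ^+ 2.
  by field; rewrite -sqrf_eq0 gt_eqF.
by rewrite pmulr_lge0 ?invr_gt0// subr_ge0.
Qed.

Lemma ip_le u v : ip u v <= `|u| * `|v|.
Proof. exact: (le_trans (ler_norm _) (cauchy_schwarz _ _)). Qed.

Lemma pythagoras u v : ip u v = 0 -> `|u + v| ^+ 2 = `|u| ^+ 2 + `|v| ^+ 2.
Proof. by move=> uv; rewrite normD_sq uv mulr0 addr0. Qed.

Lemma normr_sqr_le (a b : R) : 0 <= b -> a ^+ 2 <= b ^+ 2 -> a <= b.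
Proof.
move=> b0 ab; have [a0|/ltW a0] := leP 0 a; last exact: le_trans b0.
by rewrite -(@ler_pXn2r _ 2).
Qed.

(** Stating joint continuity along a filter makes it usable for sequences, neighborhoods and
    ultrafilters alike. *)
Lemma ip_cvg {T : Type} (F : set_system T) {FF : Filter F} (u v : T -> H) u0 v0 :
  u @ F --> u0 -> v @ F --> v0 -> ip (u t) (v t) @[t --> F] --> ip u0 v0.
Proof.
move=> cu cv; apply/cvgrPdist_le => e e0.
have cdist (w : T -> H) w0 : w @ F --> w0 -> `|w0 - w t| @[t --> F] --> (0 : R).
  move=> cw; have : `|w0 - w t| @[t --> F] --> `|w0 - w0|.
    by apply: cvg_norm; apply: cvgB => //; exact: cvg_cst.
  by rewrite subrr normr0.
have : `|u0 - u t| * `|v t| + `|u0| * `|v0 - v t| @[t --> F] -->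
    0 * `|v0| + `|u0| * 0.
  apply: cvgD; apply: cvgM; [exact: cdist|exact: cvg_norm|exact: cvg_cst|].
  exact: cdist.
rewrite mul0r mulr0 addr0.
move=> /cvgr0Pnorm_le/(_ e e0); apply: filterS => t; apply: le_trans.
rewrite (_ : _ - _ = ip (u0 - u t) (v t) + ip u0 (v0 - v t)); last first.
  by rewrite !ip_lin; ring.
rewrite (le_trans _ (ler_norm _))// (le_trans (ler_normD _ _))//.
by rewrite lerD// cauchy_schwarz.
Qed.

Lemma orthogonal_complement_closed S : closed (orthogonal_complement ip S).
Proof.
rewrite (_ : orthogonal_complement ip S =
    \bigcap_(v in S) ((ip ^~ v) @^-1` [set 0])); last first.
  by apply/seteqP; split => u.
apply: closed_bigI => v Sv; apply: closed_comp; last exact: closed_eq.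
by move=> u _; apply: ip_cvg; [exact: cvg_id|exact: cvg_cst].
Qed.

(** The representing vector is the minimizer of |u|^2 - 2 l(u), found as the limit of a minimizing
    sequence; vanishing of the first variation there is the claim. *)
Lemma riesz_representation (l : H -> R) (M : R) :
  (forall (a : R) u v, l (a *: u + v) = a * l u + l v) ->
  (forall u, `|l u| <= M * `|u|) -> exists w, forall u, l u = ip w u.
Proof.
move=> ll lM; pose f u := `|u| ^+ 2 - 2 * l u.
have l0 : l 0 = 0 by have := lM 0; rewrite normr0 mulr0 normr_le0 => /eqP.
have lZ a u : l (a *: u) = a * l u by have := ll a u 0; rewrite l0 !addr0.
have lD u v : l (u + v) = l u + l v by have := ll 1 u v; rewrite scale1r mul1r.
have lN u : l (- u) = - l u by rewrite -scaleN1r lZ mulN1r.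
have f_ge u : - M ^+ 2 <= f u.
  have : l u <= M * `|u| := le_trans (ler_norm _) (lM u).
  by rewrite /f; have := sqr_ge0 (`|u| - M); nra.
pose I := inf (range f).
have hI : has_inf (range f).
  split; first by exists (f 0); exists 0.
  by exists (- M ^+ 2) => _ [u _ <-].
have fI u : I <= f u by apply: (ge_inf hI.2); exists u.
have /choice[u_ u_P] : forall n : nat, exists u, f u < I + n.+1%:R^-1.
  move=> n; have [_ [u _ <-]] := @inf_adherent _ (range f) n.+1%:R^-1 (harmonic_gt0 n) hI.
  by exists u.
(* Parallelogram identity: the linear parts cancel, so |u - v|^2 is twice f(u) + f(v) - 2 f((u + v)
   / 2). This makes minimizing sequences Cauchy. *)
have f_mid u v : `|u - v| ^+ 2 <= 2 * (f u + f v - 2 * I).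
  have := fI (2^-1 *: (u + v)); rewrite /f normrZ lZ lD exprMn gtr0_norm// normB_sq normD_sq; lra.
have cu : cvg (u_ @ \oo).
  apply/cauchy_cvgP/cauchy_exP => e e0.
  have e2 : 0 < e ^+ 2 / 4 by rewrite divr_gt0// exprn_gt0.
  have [N _ NP] := near_infty_natSinv_lt (PosNum e2).
  exists (u_ N); exists N => // n /= Nn.
  rewrite -ball_normE /ball_/= -(@ltr_pXn2r _ 2) ?nnegrE ?(ltW e0)//.
  apply: (le_lt_trans (f_mid _ _)).
  have := u_P N; have := u_P n; have /= := NP N (leqnn N); have /= := NP n Nn.
  by move: n.+1%:R^-1 N.+1%:R^-1 => a b; lra.
pose w := lim (u_ @ \oo); exists w.
have cw : u_ @ \oo --> w by [].
have fw : f w <= I.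
  have lw : l (u_ n) @[n --> \oo] --> l w.
    apply: continuous_cvg => //; apply: (@lipschitz_at_continuous _ _ _ _ M) => v.
    by rewrite -lN -lD.
  have fw : f (u_ n) @[n --> \oo] --> f w.
    apply: cvgB; last by apply: cvgM => //; exact: cvg_cst.
    by rewrite expr2; under eq_fun do rewrite expr2; apply: cvgM; exact: cvg_norm.
  apply: (ler_cvg_to fw (g := fun n => I + n.+1%:R^-1)); last first.
    by near=> n; exact: ltW.
  by rewrite -[X in _ --> X]addr0; apply: cvgD; [exact: cvg_cst|exact: cvg_harmonic].
move=> v; apply/eqP; rewrite eq_sym -subr_eq0; apply/eqP.
apply: (@quadratic_ge0_linear_eq0 _ _ (`|v| ^+ 2)) => t.
have := fI (w + t *: v); have := fw.
rewrite /f lD lZ normD_sq ipZr normrZ exprMn real_normK ?num_real//; lra.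
Unshelve. all: by end_near. Qed.

End Hilbert.

(** * Ultrafilters, weak limits, compact operators and Rayleigh quotients *)

Lemma cvg_ler (R : realFieldType) (T : Type) (F : set_system T)
    {FF : ProperFilter F} (f g : T -> R) a b : f @ F --> a -> g @ F --> b ->
  (\forall t \near F, f t <= g t) -> a <= b.
Proof.
move=> fa gb fg; rewrite -subr_ge0.
have gfab : g t - f t @[t --> F] --> b - a by exact: cvgB.
apply: (@closed_cvg _ _ F FF _ (fun y : R => 0 <= y) (@closed_ge R 0) _ _ gfab).
by apply: filterS fg => t; rewrite subr_ge0.
Qed.

Lemma ultra_fmap (T U : Type) (F : set_system T) (g : T -> U) :
  UltraFilter F -> UltraFilter (g @ F).
Proof.
move=> FU; apply: Build_UltraFilter => G GP FG.
apply/seteqP; split => // A GA.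
have [//|FA] := in_ultra_setVsetC (g @^-1` A) FU.
have GAC : G (~` A) by apply: FG.
have : G (A `&` ~` A) by exact: filterI.
by rewrite setICr => /filter_not_empty.
Qed.

Lemma ultra_compact_cvg (T : Type) (F : set_system T) (V : topologicalType)
    (K : set V) (g : T -> V) :
  UltraFilter F -> compact K -> F (g @^-1` K) -> exists2 p, K p & g @ F --> p.
Proof.
move=> FU; rewrite compact_ultra => Kc FK.
have [|p [Kp gp]] := Kc (g @ F) _ FK; first exact: ultra_fmap.
by exists p.
Qed.

Section HilbertCompactness.
Context {R : realType} {H : completeNormedModType R} (ip : {dot H for idfun}).
Hypothesis ipE : forall x : H, `|x| ^+ 2 = ip x x.
Implicit Types (u v w : H) (S : set H).

(** An ultrafilter replaces the extraction of a weakly convergent subsequence: each ip (u t) v stays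
    in a compact segment, hence converges, and the limit is a bounded linear functional of v,
    represented by Riesz. *)
Lemma ultra_weak_limit (T : Type) (F : set_system T) (u : T -> H) (M : R) :
  UltraFilter F -> (forall t, `|u t| <= M) ->
  exists u0, forall v, ip (u t) v @[t --> F] --> ip u0 v.
Proof.
move=> FU uM.
have /choice[l lP] : forall v, exists y : R, ip (u t) v @[t --> F] --> y.
  move=> v; have [|p _ cp] := ultra_compact_cvg (g := fun t => ip (u t) v) FU
    (@segment_compact R (- (M * `|v|)) (M * `|v|)).
    apply: filterE => t /=; rewrite in_itv/= -ler_norml.
    by rewrite (le_trans (cauchy_schwarz ipE _ _))// ler_wpM2r.
  by exists p.
have [||w wP] := @riesz_representation R H ip ipE l M.
- move=> a v w; apply: (cvg_unique (@norm_hausdorff _ R) (lP _)).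
  rewrite (_ : (fun t => _) = fun t => a * ip (u t) v + ip (u t) w); last first.
    by apply/funext => t; rewrite !ip_lin.
  by apply: cvgD; [apply: cvgM; [exact: cvg_cst|exact: lP]|exact: lP].
- move=> v; have cn : `|ip (u t) v| @[t --> F] --> `|l v| by exact: cvg_norm.
  apply: (@cvg_ler _ _ F _ _ (fun=> M * `|v|) _ _ cn); first exact: cvg_cst.
  by apply: filterE => t; rewrite (le_trans (cauchy_schwarz ipE _ _))// ler_wpM2r.
by exists w => v; rewrite -wP.
Qed.

Lemma compact_operator_bounded (K : {linear H -> H}) : compact_operator K ->
  exists2 M, 0 <= M & forall u, `|K u| <= M * `|u|.
Proof.
rewrite /compact_operator precompactE => /compact_bounded[M0 [_ M0P]].
pose M := `|M0| + 1.
have M1 : forall u, `|u| <= 1 -> `|K u| <= M.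
  move=> u u1; apply: (M0P M); first by rewrite /M (le_lt_trans (ler_norm _))// ltrDl.
  by apply: subset_closure; exists u.
exists M; first by rewrite /M addr_ge0.
move=> u; have [->|u0] := eqVneq u 0; first by rewrite linear0 !normr0 mulr0.
have u0' : 0 < `|u| by rewrite normr_gt0.
have := M1 (`|u|^-1 *: u); rewrite linearZ !normrZ normfV normr_id.
by rewrite mulVf ?gt_eqF// => /(_ (lexx _)); rewrite ler_pdivrMl// mulrC.
Qed.

Lemma ultra_compact_operator (K : {linear H -> H}) (T : Type)
    (F : set_system T) (u : T -> H) (M : R) :
  UltraFilter F -> compact_operator K -> (forall t, `|u t| <= M) ->
  cvg (K (u t) @[t --> F]).
Proof.
move=> FU Kc uM.
have M0 : 0 < `|M| + 1 by rewrite ltr_wpDl.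
have : compact (closure (K @` [set u | `|u| <= 1])) by rewrite -precompactE.
move=> /(ultra_compact_cvg (g := fun t => K ((`|M| + 1)^-1 *: u t)) FU)[|p _ cp].
  apply: filterE => t /=; apply: subset_closure; exists ((`|M| + 1)^-1 *: u t) => //=.
  rewrite normrZ gtr0_norm ?invr_gt0// ler_pdivrMl// mulr1.
  by rewrite (le_trans (uM t))// (le_trans (ler_norm _))// lerDl.
apply/cvg_ex; exists ((`|M| + 1) *: p).
rewrite (_ : (fun t => K (u t)) =
    fun t => (`|M| + 1) *: K ((`|M| + 1)^-1 *: u t)); last first.
  by apply/funext => t; rewrite linearZ scalerA divff ?gt_eqF// scale1r.
by apply: cvgZ => //; exact: cvg_cst.
Qed.

(** Compactness gives some strong limit w. To identify it, the functional ip (K u) v is represented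
    as ip u k, with k standing in for the adjoint applied to v, and weak convergence is tested
    against k. *)
Lemma compact_operator_weak_cvg (K : {linear H -> H}) (T : Type)
    (F : set_system T) (u : T -> H) (M : R) u0 :
  UltraFilter F -> compact_operator K -> (forall t, `|u t| <= M) ->
  (forall v, ip (u t) v @[t --> F] --> ip u0 v) -> K (u t) @[t --> F] --> K u0.
Proof.
move=> FU Kc uM uu0.
have [N N0 KN] := compact_operator_bounded Kc.
have /cvg_ex[w cw] := ultra_compact_operator FU Kc uM.
suff <- : w = K u0 by [].
have e v : ip w v = ip (K u0) v.
  have [||k kP] := @riesz_representation R H ip ipE (fun u => ip (K u) v) (N * `|v|).
  - by move=> a x y; rewrite linearP !ip_lin.
  - move=> x; rewrite (le_trans (cauchy_schwarz ipE _ _))//.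
    by rewrite mulrAC ler_wpM2r.
  have kP' u1 : ip (K u1) v = ip u1 k by rewrite [RHS]ipC -kP.
  have c1 : ip (K (u t)) v @[t --> F] --> ip w v.
    by apply: (ip_cvg ipE) => //; exact: cvg_cst.
  have c2 : ip (K (u t)) v @[t --> F] --> ip (K u0) v.
    rewrite kP' (_ : (fun t => ip (K (u t)) v) = fun t => ip (u t) k).
      exact: uu0.
    by apply/funext => t; exact: kP'.
  exact: (cvg_unique (@norm_hausdorff _ R) c1 c2).
apply/eqP; rewrite -subr_eq0 -normr_eq0 -sqrf_eq0 ipE ipBl.
by rewrite e subrr.
Qed.

Fixpoint orthonormal_list (s : seq H) : Prop :=
  if s is x :: s' then
    [/\ `|x| = 1, forall y, y \in s' -> ip x y = 0 & orthonormal_list s']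
  else True.

Lemma orthonormal_list_norm (s : seq H) x :
  orthonormal_list s -> x \in s -> `|x| = 1.
Proof.
elim: s => // e s IH [e1 _ os]; rewrite inE => /orP[/eqP->//|]; exact: IH.
Qed.

Lemma ip_orthonormal_sum (s : seq H) u x : orthonormal_list s -> x \in s ->
  ip (\sum_(e <- s) ip u e *: e) x = ip u x.
Proof.
elim: s => // e s IH [e1 es os]; rewrite inE big_cons ipDl ipZl => /orP[/eqP->|xs].
  rewrite -ipE e1 expr1n mulr1 (_ : ip (\sum_(_ <- _) _) _ = 0) ?addr0//.
  elim: (s) es => [|y t IHt] et; first by rewrite big_nil ip0l.
  rewrite big_cons ipDl ipZl [ip y e]ipC et ?mem_head// mulr0 add0r IHt// => z zt.
  by rewrite et// inE zt orbT.
by rewrite es// mulr0 add0r IH.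
Qed.

Lemma sum_mem_subspace S (s : seq H) (c : H -> R) : linear_subspace S ->
  (forall x, x \in s -> S x) -> S (\sum_(e <- s) c e *: e).
Proof.
move=> [S0 SL]; elim: s => [|e s IH] sS; first by rewrite big_nil.
rewrite big_cons; apply: SL; first by apply: sS; rewrite mem_head.
by apply: IH => x xs; apply: sS; rewrite inE xs orbT.
Qed.

Lemma linear_subspaceB S u v : linear_subspace S -> S u -> S v -> S (u - v).
Proof. by move=> [_ SL] Su Sv; rewrite addrC -scaleN1r; exact: SL. Qed.

Lemma linear_subspaceD S u v : linear_subspace S -> S u -> S v -> S (u + v).
Proof. by move=> [_ SL] Su Sv; rewrite -[u]scale1r; exact: SL. Qed.

Lemma linear_subspaceZ S (a : R) u : linear_subspace S -> S u -> S (a *: u).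
Proof. by move=> [S0 SL] Su; rewrite -[_ *: _]addr0; exact: SL. Qed.

Lemma linear_subspaceN S u : linear_subspace S -> S u -> S (- u).
Proof. by rewrite -scaleN1r; exact: linear_subspaceZ. Qed.

(* Otherwise orthonormal lists extend to an infinite orthonormal sequence, which has
   no cluster point. *)
Lemma compact_orthonormal_basis (K S : set H) : linear_subspace S ->
  compact K -> S `&` [set u | `|u| <= 1] `<=` K ->
  exists s : seq H, [/\ orthonormal_list s, forall x, x \in s -> S x &
    forall u, S u -> u = \sum_(e <- s) ip u e *: e].
Proof.
move=> SL Kc SK; apply: contrapT => nobasis.
pose good (s : seq H) := orthonormal_list s /\ forall x, x \in s -> S x.
have ext (s : {s | good s}) : {s' : {s | good s} | exists y, sval s' = y :: sval s}.
  case: s => s [os sS]; apply: cid.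
  have [u Su us] : exists2 u, S u & u != \sum_(e <- s) ip u e *: e.
    apply: contrapT => nu; apply: nobasis; exists s; split => // u Su.
    by apply: contrapT => us; apply: nu; exists u => //; exact/eqP.
  pose r := u - \sum_(e <- s) ip u e *: e.
  have r0 : 0 < `|r| by rewrite normr_gt0 subr_eq0.
  have Sr : S r by apply: linear_subspaceB => //; exact: sum_mem_subspace.
  have gs : good (`|r|^-1 *: r :: s).
    split => /=.
      split => //; first by rewrite normrZ normfV normr_id mulVf ?gt_eqF.
      by move=> y ys; rewrite ipZl ipBl ip_orthonormal_sum// subrr mulr0.
    move=> x; rewrite inE => /orP[/eqP->|]; last exact: sS.
    exact: linear_subspaceZ.
  by exists (exist _ _ gs), (`|r|^-1 *: r).
(* The chain starts at the empty list, for which membership is absurd; each step puts one new unit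
   vector in front. *)
have [f [_ fS]] := dependent_choice ext (exist _ [::] (conj I (fun x => fun h => False_ind _ (Bool.diff_false_true h)))).
pose e n := head 0 (sval (f n.+1)).
have fE n : sval (f n.+1) = e n :: sval (f n).
  by rewrite /e; have [y ->] := fS n.
have eS n : S (e n).
  by apply: (svalP (f n.+1)).2; rewrite fE mem_head.
have e1 n : `|e n| = 1 by have := (svalP (f n.+1)).1; rewrite fE => -[].
have ef m n : (m < n)%N -> e m \in sval (f n).
  elim: n => // n IH; rewrite fE ltnS leq_eqVlt inE => /orP[/eqP->|/IH->].
    by rewrite eqxx.
  by rewrite orbT.
have eo m n : (m < n)%N -> ip (e n) (e m) = 0.
  move=> mn; have := (svalP (f n.+1)).1; rewrite fE => -[_ + _]; apply; exact: ef.
have [|p [Kp pc]] := Kc (e @ \oo) _.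
  by exists 0%N => // n _; apply: SK; split; [exact: eS|rewrite /= e1].
have near_p N : exists2 n, (N <= n)%N & `|p - e n| < 2^-1.
  have ran : (e @ \oo) [set e n | n in [set n | (N <= n)%N]].
    by exists N => // n Nn; exists n.
  have h0 : 0 < 2^-1 :> R by [].
  have [_ [[n Nn <-]]] := pc _ _ ran (nbhsx_ballx p _ h0).
  by rewrite -ball_normE; exists n.
have [m _ pm] := near_p 0%N; have [n mn pn] := near_p m.+1.
have d1 : `|e n - e m| < 1.
  rewrite (_ : e n - e m = (p - e m) - (p - e n)); last first.
    by rewrite opprB [RHS](AC (2*2) (3*2*(1*4)))/= subrr addr0.
  by rewrite (le_lt_trans (ler_normB _ _))// [ltRHS]splitr mul1r ltrD.
have : `|e n - e m| ^+ 2 = 2.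
  by rewrite (normB_sq ipE) eo// !e1 expr1n mulr0 subr0.
have : `|e n - e m| ^+ 2 < 1 by rewrite expr_lt1.
by move=> + eq2; rewrite eq2 ltNge ler1n.
Qed.

(* A minimizer of the Rayleigh quotient is an eigenvector. *)
Lemma compact_eigenvector (S : set H) (T : {linear H -> H}) (M : R) :
  linear_subspace S -> compact (S `&` [set u | `|u| = 1]) ->
  selfadjoint ip T -> (forall u, `|T u| <= M * `|u|) ->
  (forall u, S u -> S (T u)) -> (exists2 u, S u & u != 0) ->
  exists u (l : R), [/\ S u, u != 0 & T u = l *: u].
Proof.
move=> SL Sc Ts TM TS [u0 Su0 u00].
have Tc := linear_opnorm_continuous TM.
have u00' : 0 < `|u0| by rewrite normr_gt0.
have [||u] := @compact_EVT_min H R (fun u => ip (T u) u) _ _ Sc.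
- exists (`|u0|^-1 *: u0); split; first exact: linear_subspaceZ.
  by rewrite /= normrZ normfV normr_id mulVf ?gt_eqF.
- apply: continuous_subspaceT => u; apply: (ip_cvg ipE); last exact: cvg_id.
  exact: Tc.
rewrite inE => -[Su /= u1] umin.
pose l := ip (T u) u.
have minl v : S v -> l * `|v| ^+ 2 <= ip (T v) v.
  move=> Sv; have [->|v0] := eqVneq v 0.
    by rewrite normr0 expr0n mulr0 ip0r.
  have v0' : 0 < `|v| by rewrite normr_gt0.
  have := umin (`|v|^-1 *: v); rewrite inE [T (_ *: _)]linearZ ipZl ipZr => /(_ _) H1.
  have {H1} : l <= `|v|^-1 * (`|v|^-1 * ip (T v) v).
    apply: H1; split; first exact: linear_subspaceZ.
    by rewrite /= normrZ normfV normr_id mulVf ?gt_eqF.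
  by rewrite mulrA -invfM ler_pdivlMl ?mulr_gt0// mulrC -expr2.
exists u, l; split => //; first by rewrite -normr_eq0 u1 oner_neq0.
apply/eqP; rewrite -subr_eq0; move dE : (T u - l *: u) => d.
have Sd : S d by rewrite -dE; apply: linear_subspaceB => //; [exact: TS|exact: linear_subspaceZ].
rewrite -normr_eq0 -sqrf_eq0 ipE; apply/eqP.
apply: (@quadratic_ge0_linear_eq0 _ _ (ip (T d) d - l * `|d| ^+ 2)) => t.
(* The variation goes in the direction of the residual d = T u - l u, so that the coefficient of 2t
   is |d|^2 itself. *)
have := minl (u + t *: d) (linear_subspaceD SL Su (linear_subspaceZ _ SL Sd)).
rewrite (normD_sq ipE) u1 [T (_ + _)]linearD [T (t *: d)]linearZ normrZ exprMn real_normK ?num_real//.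
rewrite !ip_lin -/l (Ts u d) [ip (T d) u]ipC.
have -> : ip d d = ip u (T d) - l * ip u d by rewrite -{1}dE ipBl ipZl Ts.
by rewrite expr1n; lra.
Qed.

(** Lax-Milgram by contraction: u - t (T u - w) maps S to itself with Lipschitz constant sqrt(1 -
    a^2 / N^2) for t = a / N^2. Taking N = |M| + a, at least a, keeps the radicand nonnegative. *)
Lemma coercive_surjective (a M : R) (T : {linear H -> H}) S :
  linear_subspace S -> (forall u, S u -> S (T u)) -> 0 < a ->
  (forall u, `|T u| <= M * `|u|) ->
  (forall u, S u -> a * `|u| ^+ 2 <= ip (T u) u) ->
  closed S -> forall w, S w -> exists2 u, S u & T u = w.
Proof.
move=> SL TS a0 TM Ta Sc w Sw.
pose N := `|M| + a; have N0 : 0 < N by rewrite ltr_wpDl.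
have TN u : `|T u| <= N * `|u|.
  rewrite (le_trans (TM u))// ler_wpM2r// (le_trans (ler_norm _))// lerDl ltW//.
pose t := a / N ^+ 2.
have t0 : 0 < t by rewrite divr_gt0// exprn_gt0.
pose q2 := 1 - a ^+ 2 / N ^+ 2.
have aN : a ^+ 2 <= N ^+ 2.
  by rewrite ler_pXn2r ?nnegrE ?(ltW a0) ?(ltW N0)// /N lerDr.
have q20 : 0 <= q2 by rewrite subr_ge0 ler_pdivrMr ?exprn_gt0// mul1r.
have q21 : q2 < 1 by rewrite gtrBl divr_gt0// exprn_gt0.
have contr u : S u -> `|u - t *: T u| <= Num.sqrt q2 * `|u|.
  move=> Su; apply: (@normr_sqr_le R); first by rewrite mulr_ge0.
  rewrite (normB_sq ipE) exprMn sqr_sqrtr// ipZr normrZ exprMn real_normK ?num_real//.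
  have h1 : `|T u| ^+ 2 <= N ^+ 2 * `|u| ^+ 2.
    by rewrite -exprMn ler_pXn2r ?nnegrE ?mulr_ge0 ?(ltW N0).
  have h2 := Ta u Su; rewrite [ip u _]ipC.
  have h3 : t ^+ 2 * `|T u| ^+ 2 <= t ^+ 2 * (N ^+ 2 * `|u| ^+ 2).
    by rewrite ler_wpM2l// sqr_ge0.
  have h4 : t * (a * `|u| ^+ 2) <= t * ip (T u) u by rewrite ler_pM2l.
  have e1 : t ^+ 2 * (N ^+ 2 * `|u| ^+ 2) = a ^+ 2 / N ^+ 2 * `|u| ^+ 2.
    by rewrite /t; field; rewrite gt_eqF.
  have e2 : t * (a * `|u| ^+ 2) = a ^+ 2 / N ^+ 2 * `|u| ^+ 2.
    by rewrite /t; field; rewrite gt_eqF.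
  by rewrite /q2 mulrBl mul1r; lra.
have [|||||p Sp pE] := @contraction_fixed_point R H S (fun u => u - t *: (T u - w)) (Num.sqrt q2).
- exact: Sc.
- by exists 0; exact: SL.1.
- move=> u Su; apply: linear_subspaceB => //; apply: linear_subspaceZ => //.
  by apply: linear_subspaceB => //; exact: TS.
- by rewrite sqrtr_ge0/= -sqrtr1 ltr_sqrt.
- move=> u v Su Sv; have := contr (u - v) (linear_subspaceB SL Su Sv).
  rewrite linearB; congr (`|_| <= _); rewrite !scalerBr !opprB.
  by rewrite [RHS](AC ((1*2)*3) ((1*6)*(4*3)*(2*5)))/= subrr addr0.
exists p => //; move/eqP: pE; rewrite eq_sym -subr_eq0 opprB addrC subrK.
rewrite scaler_eq0 gt_eqF//= subr_eq0 => /eqP//.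
Qed.

End HilbertCompactness.

(** * Admissible tuples near the origin *)

Section AdmissibleTuple.
Context {R : realType} {H X : completeNormedModType R}
  (ip : {dot H for idfun}) (j : {linear X -> H}) (V : set H)
  (L : H -> R) (A : X -> X) (B P Q : X -> {linear H -> H}) (Hp Hm : set H).
Hypothesis adm : admissible ip j V L A B P Q.
Hypothesis sd : spectral_decomposition ip (B 0) Hp Hm.
Local Notation H0 := (op_kernel (B 0)).
Local Notation ipE := (adm_hilbert_norm adm).

Lemma incl_invK x : incl_inv j (j x) = x.
Proof.
apply: (adm_incl_inj adm); rewrite /incl_inv.
exact: (@xgetPex _ 0 [set y | j y = j x] (ex_intro _ x erefl)).
Qed.

Lemma incl_invKV u : range j u -> j (incl_inv j u) = u.
Proof. by move=> [x _ <-]; rewrite incl_invK. Qed.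

Lemma incl_invP (a : R) u v : range j u -> range j v ->
  incl_inv j (a *: u + v) = a *: incl_inv j u + incl_inv j v.
Proof.
by move=> [x _ <-] [y _ <-]; rewrite -linearP !incl_invK.
Qed.

Lemma incl_inv0 : incl_inv j 0 = 0.
Proof. by rewrite -(linear0 j) incl_invK. Qed.

Lemma incl_invB u v : range j u -> range j v ->
  incl_inv j (u - v) = incl_inv j u - incl_inv j v.
Proof. by move=> [x _ <-] [y _ <-]; rewrite -linearB !incl_invK. Qed.

Lemma j_continuous : continuous j.
Proof.
by apply: (@linear_opnorm_continuous _ _ _ _ 1) => x; rewrite mul1r (adm_incl_norm adm).
Qed.

Lemma V_ball : exists2 r : R, 0 < r & forall u : H, `|u| < r -> V u.
Proof.
have /nbhs_ballP[r /= r0 rV] : nbhs (0 : H) V.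
  by apply: open_nbhs_nbhs; split; [exact: (adm_V_open adm)|exact: (adm_V_origin adm)].
by exists r => // u ur; apply: rV; rewrite -ball_normE /= sub0r normrN.
Qed.

Lemma V0 : V (j 0).
Proof. by rewrite linear0; exact: (adm_V_origin adm). Qed.

(** (D2) and (D4) speak of sequences. This turns the failure of a statement uniform near the origin
    into a sequence to which they apply. *)
Lemma null_sequence (G : nat -> X -> Prop) :
  (forall n (d : R), 0 < d -> exists x, [/\ V (j x), `|j x| < d & G n x]) ->
  exists x_ : nat -> X, [/\ forall k, V (j (x_ k)),
    `|j (x_ k)| @[k --> \oo] --> (0 : R) & forall k, G k (x_ k)].
Proof.
move=> HG.
have /choice[x_ xP] : forall n, exists x, [/\ V (j x), `|j x| < n.+1%:R^-1 & G n x].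
  by move=> n; apply: HG; rewrite invr_gt0.
exists x_; split=> [k||k]; [by have [] := xP k| |by have [] := xP k].
apply: (@squeeze_cvgr _ _ _ _ (fun=> 0) (@harmonic R)).
- by apply: filterE => k; rewrite normr_ge0/=; have [_ /ltW] := xP k.
- exact: cvg_cst.
- exact: cvg_harmonic.
Qed.

(** In (D4) the constant depends on the sequence. If no constant and radius served all points,
    points violating the bound with constant 1 / (n + 1) would form a null sequence and contradict
    (D4). *)
Lemma P_near_coercive : exists C d : R, [/\ 0 < C, 0 < d &
  forall x u, V (j x) -> `|j x| < d -> C * `|u| ^+ 2 <= ip (P x u) u].
Proof.
apply: contrapT => nP.
have [|x_ [xV x0 xG]] := @null_sequence (fun n x =>
    exists u, ip (P x u) u < n.+1%:R^-1 * `|u| ^+ 2).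
  move=> n d d0; apply: contrapT => nx; apply: nP; exists n.+1%:R^-1, d.
  split => // x u xV xd; rewrite leNgt; apply/negP => xu; apply: nx.
  by exists x; split => //; exists u.
have [C [n0 [C0 CP]]] := adm_D4 adm xV x0.
have [N _ NP] := near_infty_natSinv_lt (PosNum C0).
pose n := maxn N n0.
have [u un] := xG n.
have := CP n u (leq_maxr _ _); apply/negP; rewrite -ltNge.
apply: (lt_le_trans un); rewrite ler_wpM2r ?sqr_ge0// ltW//.
by apply: NP; rewrite /= leq_maxl.
Qed.

Lemma P_continuous_at0 u (e : R) : 0 < e -> exists2 d : R, 0 < d &
  forall x, V (j x) -> `|j x| < d -> `|P x u - P 0 u| <= e.
Proof.
move=> e0; apply: contrapT => nP.
have [|x_ [xV x0 xG]] := @null_sequence (fun n x => e < `|P x u - P 0 u|).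
  move=> n d d0; apply: contrapT => nx; apply: nP; exists d => // x xV xd.
  by rewrite leNgt; apply/negP => xu; apply: nx; exists x.
have := adm_D2 adm xV x0 u => /cvgr0Pnorm_le/(_ e e0)[N _ /(_ N (leqnn N))] /=.
by rewrite normr_id leNgt xG.
Qed.

(** Only strong continuity can be expected, because of [P]: the radius depends on u. *)
Lemma B_continuous_at0 u (e : R) : 0 < e -> exists2 d : R, 0 < d &
  forall x, V (j x) -> `|j x| < d -> `|B x u - B 0 u| <= e.
Proof.
move=> e0; have e2 : 0 < e / 2 by rewrite divr_gt0.
have [d1 d10 d1P] := P_continuous_at0 u e2.
have eu : 0 < e / 2 / (`|u| + 1) by rewrite divr_gt0// ltr_wpDl.
have [d2 d20 d2P] := adm_D3 adm eu.
exists (Num.min d1 d2); first by rewrite lt_min d10.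
move=> x xV; rewrite lt_min => /andP[xd1 xd2].
rewrite (adm_D_sum adm u xV) (adm_D_sum adm u V0).
have -> : P x u + Q x u - (P 0 u + Q 0 u) = (P x u - P 0 u) + (Q x u - Q 0 u).
  by rewrite opprD addrACA.
rewrite (le_trans (ler_normD _ _))// [leRHS]splitr lerD ?d1P//.
rewrite (le_trans (d2P x xV xd2 u I))//.
rewrite -mulrA ger_pMr// mulrC ler_pdivrMr ?ltr_wpDl// mul1r lerDl//.
Qed.

Lemma kernel_subspace : linear_subspace H0.
Proof.
split; first by rewrite /op_kernel/= linear0.
by move=> a u v; rewrite /op_kernel/= linearP => -> ->; rewrite scaler0 addr0.
Qed.

Let Hp_sub : linear_subspace Hp. Proof. by case: sd => -[]. Qed.
Let Hm_sub : linear_subspace Hm. Proof. by case: sd => -[]. Qed.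

Lemma B0_bounded : exists2 M, 0 <= M & forall u, `|B 0 u| <= M * `|u|.
Proof.
have [[_ [M MP]] _] := adm_F3_Ls adm V0.
exists `|M| => [//|u]; apply: (le_trans (MP u I)).
by rewrite ler_wpM2r// ler_norm.
Qed.

Lemma B0_continuous : continuous (B 0).
Proof. by have [M _ MP] := B0_bounded; exact: linear_opnorm_continuous MP. Qed.

Lemma B0_selfadjoint : selfadjoint ip (B 0).
Proof. by have [] := adm_F3_Ls adm V0. Qed.

Lemma H0_closed : closed H0.
Proof.
apply: (@closed_comp _ _ (B 0) [set 0]).
  by move=> u _; exact: B0_continuous.
exact: (accessible_closed_set1 (hausdorff_accessible (@norm_hausdorff _ H))).
Qed.

(** As an orthogonal complement, [Hp] is closed, and stable under weak limits as well. *)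
Lemma Hp_orthE : Hp = orthogonal_complement ip (H0 `|` Hm).
Proof.
have [_ [w1 w2 w3] dec _ _] := sd.
apply/seteqP; split => [u up v [v0|vm]|u up].
- by rewrite ipC; exact: w1.
- exact: w3.
have [u0 [u1 [u2 [k0 k1 k2 uE]]]] := dec u.
have /eqP := up u0 (or_introl k0); rewrite uE !ip_lin (ipC _ u1) (w1 _ _ k0 k1).
rewrite (ipC _ u2) (w2 _ _ k0 k2) !addr0 -ipE sqrf_eq0 normr_eq0 => /eqP u00.
have /eqP := up u2 (or_intror k2); rewrite uE u00 !ip_lin (w3 _ _ k1 k2) !add0r.
by rewrite -ipE sqrf_eq0 normr_eq0 => /eqP ->; rewrite addr0.
Qed.

Lemma Hp_closed : closed Hp.
Proof. by rewrite Hp_orthE; exact: (orthogonal_complement_closed ipE). Qed.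

Lemma Hm_orthE : Hm = orthogonal_complement ip (H0 `|` Hp).
Proof.
have [_ [w1 w2 w3] dec _ _] := sd.
apply/seteqP; split => [u um v [v0|vp]|u um].
- by rewrite ipC; exact: w2.
- by rewrite ipC; exact: w3.
have [u0 [u1 [u2 [k0 k1 k2 uE]]]] := dec u.
have /eqP := um u0 (or_introl k0); rewrite uE !ip_lin (ipC _ u1) (w1 _ _ k0 k1).
rewrite (ipC _ u2) (w2 _ _ k0 k2) !addr0 -ipE sqrf_eq0 normr_eq0 => /eqP u00.
have /eqP := um u1 (or_intror k1); rewrite uE u00 !ip_lin (ipC _ u2 u1) (w3 _ _ k1 k2) !add0r addr0.
by rewrite -ipE sqrf_eq0 normr_eq0 => /eqP ->; rewrite !add0r.
Qed.

Lemma Hm_closed : closed Hm.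
Proof. by rewrite Hm_orthE; exact: (orthogonal_complement_closed ipE). Qed.

(* On a subspace where B(0) is nonpositive, coercivity of P(0) is controlled by
   the compact operator Q(0). *)
Lemma nonpositive_compact_ball S : linear_subspace S -> closed S ->
  (forall u, S u -> ip (B 0 u) u <= 0) -> compact (S `&` [set u | `|u| <= 1]).
Proof.
move=> SL Sc SB; have [C [d [C0 d0 CP]]] := P_near_coercive.
have Q0 u : S u -> C * `|u| <= `|Q 0 u|.
  move=> Su; have [->|u0] := eqVneq u 0; first by rewrite normr0 mulr0.
  have j0 : `|j 0| < d by rewrite linear0 normr0.
  rewrite -(@ler_pM2r _ `|u|) ?normr_gt0// -mulrA -expr2.
  rewrite (le_trans (CP 0 u V0 j0))//.
  have := adm_D_sum adm u V0; move/(congr1 (ip ^~ u)); rewrite /= ipDl => BE.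
  have := SB _ Su; have := cauchy_schwarz ipE (Q 0 u) u.
  by rewrite BE ler_norml => /andP[+ _]; lra.
rewrite compact_ultra => F FU FS.
have Qc : compact (closure (Q 0 @` [set u | `|u| <= 1])).
  by rewrite -precompactE; exact: (adm_D_compact adm V0).
have [|w _ Qw] := ultra_compact_cvg (g := Q 0) FU Qc.
  by apply: filterS FS => u [_ /= u1]; apply: subset_closure; exists u.
(* Applied to differences, the lower bound of Q(0) on S makes the ultrafilter itself Cauchy once its
   image under Q(0) converges. *)
have cF : cvg F.
  apply/cauchy_cvgP/cauchy_exP => e e0.
  have e2 : 0 < C * e / 2 by rewrite divr_gt0// mulr_gt0.
  have FQ : F [set u | S u /\ `|w - Q 0 u| < C * e / 2].
    have /cvgrPdist_lt/(_ _ e2) FQ := Qw.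
    by apply: filterS (filterI FS FQ) => u [[]].
  have [u1 [Su1 wu1]] := filter_ex FQ.
  exists u1; apply: filterS FQ => u [Su wu]; rewrite -ball_normE /ball_/=.
  rewrite -(@ltr_pM2l _ C)// (le_lt_trans (Q0 _ (linear_subspaceB SL Su1 Su)))//.
  rewrite linearB (_ : _ - _ = (w - Q 0 u) - (w - Q 0 u1)).
    by rewrite (le_lt_trans (ler_normB _ _))// [ltRHS]splitr ltrD.
  by rewrite opprB [RHS](AC (2*2) (3*2*(1*4)))/= subrr addr0.
have [p Fp] := (cvg_ex F).1 cF.
exists p; split=> //; split.
  by apply: (@closed_cvg _ _ F _ id S Sc _ _ Fp); apply: filterS FS => u [].
apply: (@closed_cvg _ _ F _ id [set u : H | `|u| <= 1] _ _ _ Fp).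
  apply: (@closed_comp _ _ (fun u : H => `|u|) [set x : R | x <= 1]); last exact: closed_le.
  by move=> u _; exact: norm_continuous.
by apply: filterS FS => u [].
Qed.

End AdmissibleTuple.

(** * The kernel and the negative space: finite dimension and inclusion in X *)

Section SpectralEstimates.
Context {R : realType} {H X : completeNormedModType R}
  (ip : {dot H for idfun}) (j : {linear X -> H}) (V : set H)
  (L : H -> R) (A : X -> X) (B P Q : X -> {linear H -> H}) (Hp Hm : set H).
Hypothesis adm : admissible ip j V L A B P Q.
Hypothesis sd : spectral_decomposition ip (B 0) Hp Hm.
Local Notation H0 := (op_kernel (B 0)).
Local Notation ipE := (adm_hilbert_norm adm).
Let Hp_sub : linear_subspace Hp. Proof. by case: sd => -[]. Qed.
Let Hm_sub : linear_subspace Hm. Proof. by case: sd => -[]. Qed.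
Let H0_sub : linear_subspace H0. Proof. exact: kernel_subspace. Qed.

Let j_range0 : range j 0.
Proof. by exists 0 => //; exact: linear0. Qed.

Let j_rangeP (a : R) u v : range j u -> range j v -> range j (a *: u + v).
Proof.
by move=> [x _ <-] [y _ <-]; exists (a *: x + y) => //; exact: linearP.
Qed.

Lemma H0_range : H0 `<=` range j.
Proof.
move=> u u0; apply: (adm_C2 adm); rewrite u0; exact: j_range0.
Qed.

Lemma H0_compact : compact (H0 `&` [set u | `|u| <= 1]).
Proof.
apply: (nonpositive_compact_ball adm H0_sub (H0_closed adm)) => u u0.
by rewrite u0 ip0l.
Qed.

Lemma Hm_nonpositive u : Hm u -> ip (B 0 u) u <= 0.
Proof.
move=> um; have [->|u0] := eqVneq u 0; first by rewrite ip0r.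
by have [_ _ _ _ [_ Bm]] := sd; exact/ltW/Bm.
Qed.

Lemma Hm_compact : compact (Hm `&` [set u | `|u| <= 1]).
Proof.
exact: (nonpositive_compact_ball adm Hm_sub (Hm_closed adm sd) Hm_nonpositive).
Qed.

(** The strict derivative is only given existentially; this identifies it with the directional
    derivative, about which (F3) speaks. *)
Lemma A_derivative0 A0 : strict_derivative setT A 0 A0 ->
  forall u, 'D_u A 0 = A0 u.
Proof.
move=> [[A0L [k A0k]] sA] u.
have A00 : A0 0 = 0.
  by have := A0k 0 I; rewrite normr0 mulr0 normr_le0 => /eqP.
have A0Z (a : R) v : A0 (a *: v) = a *: A0 v.
  by have := A0L a v 0 I I; rewrite A00 !addr0.
apply: cvg_lim; first exact: norm_hausdorff.
apply/cvgrPdist_le => e e0.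
have eu : 0 < e / (`|u| + 1) by rewrite divr_gt0// ltr_wpDl.
have [d d0 dP] := sA _ eu.
have du : 0 < d / (`|u| + 1) by rewrite divr_gt0// ltr_wpDl.
near=> t.
have t0 : t != 0 by near: t; exact: nbhs_dnbhs_neq.
have tu : `|t *: u| < d.
  rewrite normrZ (@le_lt_trans _ _ (`|t| * (`|u| + 1)))//.
    by rewrite ler_wpM2l// lerDl.
  rewrite -ltr_pdivlMr ?ltr_wpDl// -[t]subr0 distrC.
  by near: t; apply: (@cvgr_dist_lt _ _ _ _ _ id) => //; exact: nbhs_dnbhs.
have := dP (t *: u) 0 I I; rewrite !subr0 normr0 => /(_ tu d0).
rewrite A0Z => le1.
have -> : A0 u - t^-1 *: (A (t *: u + 0) - A 0) =
    - (t^-1 *: (A (t *: u) - A 0 - t *: A0 u)).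
  by rewrite addr0 [in RHS]scalerBr scalerA mulVf// scale1r opprB.
rewrite normrN normrZ normfV ler_pdivrMl ?normr_gt0//.
rewrite (le_trans le1)// normrZ mulrCA ler_wpM2l//.
by rewrite -mulrA ger_pMr// mulrC ler_pdivrMr ?ltr_wpDl// mul1r lerDl.
Unshelve. all: by end_near. Qed.

Lemma range_inner_eq0 x : (forall v, ip (j x) (j v) = 0) -> x = 0.
Proof.
move=> /(_ x)/eqP; rewrite -ipE sqrf_eq0 normr_eq0 => /eqP jx.
by apply: (adm_incl_inj adm); rewrite jx linear0.
Qed.

Lemma ip_range_eq u w : (forall v, ip u (j v) = ip w (j v)) -> u = w.
Proof.
move=> uw; apply/eqP; rewrite -subr_eq0; apply: contraT => uw0.
pose d := u - w; have d0 : 0 < `|d| by rewrite normr_gt0.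
have dB : open (ball d `|d|) by exact: ball_open.
have [x [xB [v _ vx]]] := adm_incl_dense adm (ex_intro _ d (ballxx d d0)) dB.
have dv : `|d - j v| < `|d|.
  have : ball_ Num.norm d `|d| x by rewrite ball_normE; exact: xB.
  by rewrite -vx.
have : `|d| ^+ 2 <= `|d| * `|d - j v|.
  have := ip_le ipE d (d - j v).
  by rewrite ipBr -ipE ipBl uw subrr subr0.
by rewrite expr2 ler_pM2l// leNgt dv.
Qed.

Lemma jDA x u : V (j x) -> j ('D_u A x) = B x (j u).
Proof. by move=> xV; apply: ip_range_eq => v; exact: (adm_F3_hessian adm). Qed.

(** (D1) concerns eigenvectors only. The part S of [Hm] in X is invariant under B(0), which acts on
    X as A'(0), so its complement M in [Hm] is invariant too. A nonzero M would contain an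
    eigenvector with negative eigenvalue; (D1) would place it in X, hence in S, hence orthogonal to
    itself. *)
Lemma Hm_range : Hm `<=` range j.
Proof.
pose S := Hm `&` range j.
have S_sub : linear_subspace S.
  split; first by split; [exact: Hm_sub.1|exact: j_range0].
  by move=> a u v [um ur] [vm vr]; split; [exact: Hm_sub.2|exact: j_rangeP].
have [|s [so sS sB]] := compact_orthonormal_basis ipE S_sub Hm_compact.
  by move=> u [[um _] u1].
pose M := Hm `&` orthogonal_complement ip [set x | x \in s].
have M_sub : linear_subspace M.
  split; first by split; [exact: Hm_sub.1|move=> v _; rewrite ip0l].
  move=> a u v [um us] [vm vs]; split; first exact: Hm_sub.2.
  by move=> e es; rewrite !ip_lin us// vs// mulr0 addr0.
have M_S u v : M u -> S v -> ip u v = 0.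
  move=> [_ us] /sB ->; elim: (s) us => [|e t IH] us; first by rewrite big_nil ip0r.
  rewrite big_cons !ip_lin us ?mulr0 ?add0r /= ?mem_head// IH// => y yt.
  by apply: us; rewrite /= inE yt orbT.
have M_B u : M u -> M (B 0 u).
  move=> [um us]; split.
    by have [_ _ _ [_ BHm] _] := sd; apply: BHm; exists u.
  move=> v /sS[vm [x _ xv]]; rewrite (B0_selfadjoint adm); apply: M_S => //.
  split; last by exists ('D_x A 0) => //; rewrite (jDA _ (V0 adm)) xv.
  by have [_ _ _ [_ BHm] _] := sd; apply: BHm; exists v.
have M0 : M `<=` [set 0].
  move=> u0 Mu0; apply: contrapT => /eqP u00.
  have Mc : compact (M `&` [set u | `|u| = 1]).
    apply: (@subclosed_compact _ _ (Hm `&` [set u | `|u| <= 1])).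
    - apply: closedI; first apply: closedI.
      + exact: (Hm_closed adm sd).
      + exact: (orthogonal_complement_closed ipE).
      + apply: (@closed_comp _ _ (fun u : H => `|u|) [set x : R | x = 1]).
          by move=> u _; exact: norm_continuous.
        exact: closed_eq.
    - exact: Hm_compact.
    - by move=> u [[um _] /= ->].
  have [N _ NP] := B0_bounded adm.
  have [] := compact_eigenvector ipE M_sub Mc (B0_selfadjoint adm) NP M_B.
    by exists u0.
  move=> u [l [Mu uN0 Bu]].
  have l0 : l < 0.
    have [_ _ _ _ [_ /(_ u Mu.1 uN0)]] := sd.
    by rewrite Bu ipZl -ipE pmulr_llt0// exprn_gt0// normr_gt0.
  have ur := adm_D1 adm l0 uN0 Bu.
  have := M_S u u Mu (conj Mu.1 ur); rewrite -ipE => /eqP.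
  by rewrite sqrf_eq0 normr_eq0 (negbTE uN0).
move=> u um; pose w := \sum_(e <- s) ip u e *: e.
have Sw : S w by apply: sum_mem_subspace.
have /M0 : M (u - w).
  split; first by apply: linear_subspaceB => //; exact: Sw.1.
  by move=> e es; rewrite ipBl /w (ip_orthonormal_sum ipE)// subrr.
by move=> /eqP; rewrite subr_eq0 => /eqP ->; exact: Sw.2.
Qed.

Lemma H0_basis : exists s : seq H, [/\ orthonormal_list ip s,
  forall x, x \in s -> H0 x & forall u, H0 u -> u = \sum_(e <- s) ip u e *: e].
Proof. exact: (compact_orthonormal_basis ipE H0_sub H0_compact). Qed.

Lemma Hm_basis : exists s : seq H, [/\ orthonormal_list ip s,
  forall x, x \in s -> Hm x & forall u, Hm u -> u = \sum_(e <- s) ip u e *: e].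
Proof. exact: (compact_orthonormal_basis ipE Hm_sub Hm_compact). Qed.

(** The X-norm is controlled by the H-norm on a finite-dimensional subspace of X: expand in the
    basis and bound the coefficients by Cauchy-Schwarz. This is why both topologies agree on the
    kernel and on [Hm]. *)
Lemma spanned_incl_bounded S (s : seq H) : S `<=` range j ->
  (forall x, x \in s -> S x) ->
  (forall u, S u -> u = \sum_(e <- s) ip u e *: e) ->
  exists2 C, 0 <= C & forall u, S u -> `|incl_inv j u| <= C * `|u|.
Proof.
move=> Sr sS sB.
have sr x : x \in s -> range j x by move=> /sS/Sr.
exists (\sum_(e <- s) `|e| * `|incl_inv j e|); first by apply: sumr_ge0 => e _; rewrite mulr_ge0.
move=> u /sB {1}->; rewrite mulr_suml.
suff [_ //] : range j (\sum_(e <- s) ip u e *: e) /\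
    `|incl_inv j (\sum_(e <- s) ip u e *: e)| <=
      \sum_(e <- s) `|e| * `|incl_inv j e| * `|u|.
elim: (s) sr => [_|e t IH tr].
  rewrite !big_nil (incl_inv0 adm) normr0; split => //.
rewrite !big_cons; have [|r1 r2] := IH; first by move=> x xt; apply: tr; rewrite inE xt orbT.
have re : range j e by apply: tr; rewrite mem_head.
rewrite (incl_invP adm)//; split.
  exact: j_rangeP.
rewrite (le_trans (ler_normD _ _))// lerD// normrZ mulrAC ler_wpM2r//.
by rewrite [leRHS]mulrC (cauchy_schwarz ipE).
Qed.

Lemma H0_incl_bounded : exists2 C, 0 <= C &
  forall u, H0 u -> `|incl_inv j u| <= C * `|u|.
Proof.
by have [s [_ sS sB]] := H0_basis; exact: spanned_incl_bounded H0_range sS sB.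
Qed.

Lemma Hm_incl_bounded : exists2 C, 0 <= C &
  forall u, Hm u -> `|incl_inv j u| <= C * `|u|.
Proof.
by have [s [_ sS sB]] := Hm_basis; exact: spanned_incl_bounded Hm_range sS sB.
Qed.

End SpectralEstimates.

(** * Definiteness of B(x) near the origin *)

Section NearCoercivity.
Context {R : realType} {H X : completeNormedModType R}
  (ip : {dot H for idfun}) (j : {linear X -> H}) (V : set H)
  (L : H -> R) (A : X -> X) (B P Q : X -> {linear H -> H}) (Hp Hm : set H).
Hypothesis adm : admissible ip j V L A B P Q.
Hypothesis sd : spectral_decomposition ip (B 0) Hp Hm.
Local Notation H0 := (op_kernel (B 0)).
Local Notation ipE := (adm_hilbert_norm adm).
Let Hp_sub : linear_subspace Hp. Proof. by case: sd => -[]. Qed.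
Let Hm_sub : linear_subspace Hm. Proof. by case: sd => -[]. Qed.

(** Strong continuity at finitely many vectors is uniform over combinations with bounded
    coefficients; this upgrades it to norm continuity on [Hm]. *)
Lemma B_continuous_at0_span (s : seq H) (e : R) : 0 < e ->
  exists2 d : R, 0 < d & forall x, V (j x) -> `|j x| < d ->
    forall (c : H -> R) K, 0 <= K -> (forall u, u \in s -> `|c u| <= K) ->
      `|B x (\sum_(u <- s) c u *: u) - B 0 (\sum_(u <- s) c u *: u)| <= e * K.
Proof.
elim: s e => [|v s IH] e e0.
  exists 1 => // x _ _ c K K0 _.
  by rewrite big_nil [B x 0]linear0 [B 0 0]linear0 subr0 normr0 mulr_ge0// ltW.
have e2 : 0 < e / 2 by rewrite divr_gt0.
have [d1 d10 d1P] := IH _ e2.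
have [d2 d20 d2P] := B_continuous_at0 adm v e2.
exists (Num.min d1 d2); first by rewrite lt_min d10.
move=> x xV; rewrite lt_min => /andP[xd1 xd2] c K K0 cK.
rewrite big_cons [B x (_ + _)]linearD [B 0 (_ + _)]linearD [B x (_ *: v)]linearZ.
rewrite [B 0 (_ *: v)]linearZ /= opprD addrACA -scalerBr.
rewrite (le_trans (ler_normD _ _))// [e]splitr mulrDl lerD//.
  rewrite normrZ mulrC ler_pM// ?d2P//; exact/cK/mem_head.
by apply: d1P => // u us; apply: cK; rewrite inE us orbT.
Qed.

Lemma B_near_Hm (e : R) : 0 < e -> exists2 d : R, 0 < d &
  forall x, V (j x) -> `|j x| < d -> forall v, Hm v -> `|B x v - B 0 v| <= e * `|v|.
Proof.
move=> e0; have [s [so _ sB]] := Hm_basis adm sd.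
have [d d0 dP] := B_continuous_at0_span s e0.
exists d => // x xV xd v vm.
have vs u : u \in s -> `|ip v u| <= `|v|.
  move=> us; rewrite (le_trans (cauchy_schwarz ipE _ _))//.
  by rewrite (orthonormal_list_norm so us) mulr1.
by have := dP x xV xd (ip v) _ (normr_ge0 v) vs; rewrite -(sB v vm).
Qed.

(** The quadratic form attains its maximum on the compact unit sphere of [Hm]. If [Hm] is trivial
    the sphere is empty and any constant serves. *)
Lemma Hm_negative : exists2 a : R, 0 < a &
  forall v, Hm v -> ip (B 0 v) v <= - a * `|v| ^+ 2.
Proof.
pose S := Hm `&` [set u | `|u| = 1].
have Sc : compact S.
  apply: (@subclosed_compact _ _ (Hm `&` [set u | `|u| <= 1])).
  - apply: closedI; first exact: (Hm_closed adm sd).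
    apply: (@closed_comp _ _ (fun u : H => `|u|) [set x : R | x = 1]).
      by move=> u _; exact: norm_continuous.
    exact: closed_eq.
  - exact: (Hm_compact adm sd).
  - by move=> u [um /= ->].
have [S0|/set0P S0] := eqVneq S set0.
  exists 1 => // v vm; have [->|v0] := eqVneq v 0.
    by rewrite ip0r normr0 expr0n mulr0.
  have : S (`|v|^-1 *: v).
    split; first exact: linear_subspaceZ.
    by rewrite /= normrZ normfV normr_id mulVf// normr_eq0.
  by rewrite S0.
have [|u] := @compact_EVT_max H R (fun u => ip (B 0 u) u) _ S0 Sc.
  apply: continuous_subspaceT => u; apply: (ip_cvg ipE); last exact: cvg_id.
  exact: (B0_continuous adm).
rewrite inE => -[um /= u1] umax; exists (- ip (B 0 u) u).
  have [_ _ _ _ [_ /(_ u um)]] := sd; rewrite oppr_gt0; apply.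
  by rewrite -normr_eq0 u1 oner_neq0.
move=> v vm; rewrite opprK; have [->|v0] := eqVneq v 0.
  by rewrite ip0r normr0 expr0n mulr0.
have v0' : 0 < `|v| by rewrite normr_gt0.
have := umax (`|v|^-1 *: v); rewrite inE [B 0 (_ *: _)]linearZ ipZl ipZr => /(_ _) H1.
have {H1} : `|v|^-1 * (`|v|^-1 * ip (B 0 v) v) <= ip (B 0 u) u.
  apply: H1; split; first exact: linear_subspaceZ.
  by rewrite /= normrZ normfV normr_id mulVf// gt_eqF.
by rewrite mulrA -invfM ler_pdivrMl ?mulr_gt0// mulrC -expr2.
Qed.

(* Otherwise unit vectors u_n in Hp with (B(x_n) u_n, u_n) -> 0 have a weak limit
   u0 along an ultrafilter; (B(0) u0, u0) <= 0 forces u0 = 0, and then the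
   coercivity of P and the compactness of Q give u_n -> 0. *)
Lemma Hp_near_positive : exists a d : R, [/\ 0 < a, 0 < d &
  forall x, V (j x) -> `|j x| < d -> forall u, Hp u -> a * `|u| ^+ 2 <= ip (B x u) u].
Proof.
apply: contrapT => nP.
have [|x_ [xV x0]] := @null_sequence _ H X j V (fun n x =>
    exists u, [/\ Hp u, `|u| = 1 & ip (B x u) u < n.+1%:R^-1]).
  move=> n d d0; apply: contrapT => nx; apply: nP; exists n.+1%:R^-1, d.
  split => // x xV xd u up; have [->|u0] := eqVneq u 0.
    by rewrite ip0r normr0 expr0n mulr0.
  have u0' : 0 < `|u| by rewrite normr_gt0.
  rewrite leNgt; apply/negP => xu; apply: nx.
  exists x; split => //; exists (`|u|^-1 *: u); split.
  - exact: linear_subspaceZ.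
  - by rewrite normrZ normfV normr_id mulVf// gt_eqF.
  - rewrite [B x (_ *: _)]linearZ ipZl ipZr mulrA -invfM ltr_pdivrMl ?mulr_gt0//.
    by rewrite mulrC -expr2.
move=> /choice[u_ uP].
have up n : Hp (u_ n) by have [] := uP n.
have u1 n : `|u_ n| = 1 by have [] := uP n.
have [F [FU oF]] := ultraFilterLemma (@eventually_filter).
have x0F : `|j (x_ k)| @[k --> F] --> (0 : R) by exact: cvg_trans (cvg_app _ oF) x0.
have u1' n : `|u_ n| <= 1 by rewrite u1.
have [u0 uu0] := ultra_weak_limit ipE FU u1'.
pose v n := u_ n - u0.
have v0 w : ip (v n) w @[n --> F] --> 0.
  rewrite -[X in _ --> X](subrr (ip u0 w)).
  rewrite (_ : (fun n => _) = fun n => ip (u_ n) w - ip u0 w); last first.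
    by apply/funext => n; rewrite ipBl.
  by apply: cvgB => //; exact: cvg_cst.
have vM n : `|v n| <= 1 + `|u0| by rewrite (le_trans (ler_normB _ _))// u1.
have Bu0 : B (x_ n) u0 @[n --> F] --> B 0 u0.
  apply/cvgrPdist_le => e e0; have [d d0 dP] := B_continuous_at0 adm u0 e0.
  have /cvgr0Pnorm_lt/(_ d d0) := x0F; apply: filterS => n.
  by rewrite normr_id distrC => nd; exact: dP.
have Qv0 : Q 0 (v n) @[n --> F] --> (0 : H).
  rewrite -(linear0 (Q 0)).
  apply: (@compact_operator_weak_cvg _ _ ip ipE _ _ _ v (1 + `|u0|) 0 FU _ vM).
    exact: (adm_D_compact adm (V0 adm)).
  by move=> w; rewrite ip0l; exact: v0.
(* Norm continuity of Q at the origin, by (D3), replaces Q(x_n) by Q(0), which sends the weakly null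
   [v] to a strongly null family. *)
have Qv : ip (Q (x_ n) (v n)) (v n) @[n --> F] --> 0.
  apply/cvgr0Pnorm_le => e e0.
  pose K := 1 + `|u0|; have K0 : 0 < K by rewrite /K ltr_pwDl.
  have e2 : 0 < e / 2 / K ^+ 2 by rewrite !divr_gt0// exprn_gt0.
  have e3 : 0 < e / 2 / K by rewrite !divr_gt0.
  have [d d0 dP] := adm_D3 adm e2.
  have /cvgr0Pnorm_lt/(_ d d0) := x0F; have /cvgr0Pnorm_le/(_ _ e3) := Qv0.
  apply: filterS2 => n Qn; rewrite normr_id => nd.
  have QB := dP _ (xV n) nd (v n) I.
  rewrite -[Q (x_ n) (v n)](subrK (Q 0 (v n))) ipDl.
  rewrite (le_trans (ler_normD _ _))// [leRHS]splitr lerD//.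
    rewrite (le_trans (cauchy_schwarz ipE _ _))//.
    rewrite (@le_trans _ _ (e / 2 / K ^+ 2 * K * K))//.
      by rewrite ler_pM// (le_trans QB)// ler_wpM2l// ltW.
    by rewrite (_ : _ * K * K = e / 2)//; field; rewrite gt_eqF.
  rewrite (le_trans (cauchy_schwarz ipE _ _))//.
  have -> : e / 2 = e / 2 / K * K by rewrite divfK// gt_eqF.
  by rewrite ler_pM.
have [C [d [C0 d0 CP]]] := P_near_coercive adm.
(* Expand (B(x_n) u_n, u_n) < 1 / (n + 1) at u_n = u0 + v_n and keep only the term of P(x_n) on the
   left: [r n] is the right-hand side, which bounds C |v_n|^2 and tends to -(B(0) u0, u0). *)
pose r n := n.+1%:R^-1 - ip (B (x_ n) u0) u0 - 2 * ip (B (x_ n) u0) (v n)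
  - ip (Q (x_ n) (v n)) (v n).
have Cv : \forall n \near F, C * `|v n| ^+ 2 <= r n.
  have /cvgr0Pnorm_lt/(_ d d0) := x0F; apply: filterS => n; rewrite normr_id => nd.
  apply: (le_trans (CP _ (v n) (xV n) nd)).
  have [_ _ /ltW] := uP n; have [_ Bs] := adm_F3_Ls adm (xV n).
  have -> : ip (B (x_ n) (u_ n)) (u_ n) = ip (B (x_ n) u0) u0 +
      2 * ip (B (x_ n) u0) (v n) + ip (P (x_ n) (v n)) (v n) + ip (Q (x_ n) (v n)) (v n).
    rewrite -addrA -ipDl -(adm_D_sum adm _ (xV n)).
    rewrite (_ : u_ n = u0 + v n); last by rewrite addrC subrK.
    move: (v n) => w; rewrite [B _ (_ + _)]linearD !ip_lin (Bs w u0).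
    by rewrite [ip w (B _ u0)]ipC; ring.
  by rewrite /r; move: n.+1%:R^-1 => c; lra.
have cr : r n @[n --> F] --> - ip (B 0 u0) u0.
  have h0 : (n.+1%:R^-1 : R) @[n --> F] --> 0.
    exact: cvg_trans (cvg_app _ oF) (@cvg_harmonic R).
  have b0 : ip (B (x_ n) u0) (v n) @[n --> F] --> 0.
    rewrite (_ : (fun n => _) = fun n =>
      ip (B (x_ n) u0 - B 0 u0) (v n) + ip (v n) (B 0 u0)); last first.
      by apply/funext => n; rewrite [ip (v n) _]ipC -ipDl subrK.
    rewrite -[X in _ --> X]addr0; apply: cvgD; last exact: v0.
    apply/cvgr0Pnorm_le => e e0.
    have K0 : 0 < 1 + `|u0| by rewrite ltr_pwDl.
    have e1 : 0 < e / (1 + `|u0|) by rewrite divr_gt0.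
    have /cvgrPdist_le/(_ _ e1) := Bu0; apply: filterS => n; rewrite distrC => Bn.
    rewrite (le_trans (cauchy_schwarz ipE _ _))//.
    have -> : e = e / (1 + `|u0|) * (1 + `|u0|) by rewrite divfK// gt_eqF.
    by rewrite ler_pM.
  have : r n @[n --> F] --> 0 - ip (B 0 u0) u0 - 2 * 0 - 0.
    apply: cvgB => //; apply: cvgB; first apply: cvgB => //.
    - by apply: (ip_cvg ipE) => //; exact: cvg_cst.
    - by apply: cvgM => //; exact: cvg_cst.
  by rewrite mulr0 !subr0 sub0r.
(* Orthogonality to the kernel and to [Hm] passes to the weak limit. *)
have u0p : Hp u0.
  rewrite (Hp_orthE adm sd) => w w0.
  apply: (cvg_unique (@norm_hausdorff _ R) (uu0 w)).
  rewrite (_ : (fun n => _) = fun=> 0); first exact: cvg_cst.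
  by apply/funext => n; have := up n; rewrite {1}(Hp_orthE adm sd); apply.
have B00 : ip (B 0 u0) u0 <= 0.
  rewrite -oppr_ge0; apply: (@cvg_ler _ _ F _ (fun=> 0) _ _ _ (cvg_cst _) cr).
  by apply: filterS Cv => n; apply: le_trans; rewrite mulr_ge0 ?sqr_ge0// ltW.
have u00 : u0 = 0.
  apply: contrapT => /eqP u00; have [_ _ _ _ [/(_ u0 u0p u00)]] := sd.
  by rewrite ltNge B00.
(* With u0 = 0 the vectors v_n = u_n have norm 1, so C is at most [r n], which tends to 0. *)
have : C <= 0.
  rewrite -oppr0 -[X in - X](ip0l ip u0) -(linear0 (B 0)) -[X in B 0 X]u00.
  apply: (@cvg_ler _ _ F _ (fun=> C) _ _ _ (cvg_cst _) cr).
  by apply: filterS Cv => n; rewrite /v u00 subr0 u1 expr1n mulr1.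
by rewrite leNgt C0.
Qed.

End NearCoercivity.

(** * The three orthogonal projections and the range of B(0) *)

Section Projections.
Context {R : realType} {H X : completeNormedModType R}
  (ip : {dot H for idfun}) (j : {linear X -> H}) (V : set H)
  (L : H -> R) (A : X -> X) (B P Q : X -> {linear H -> H}) (Hp Hm : set H).
Hypothesis adm : admissible ip j V L A B P Q.
Hypothesis sd : spectral_decomposition ip (B 0) Hp Hm.
Local Notation H0 := (op_kernel (B 0)).
Local Notation ipE := (adm_hilbert_norm adm).
Local Notation P0 := (orthogonal_projection ip H0).
Local Notation Pp := (orthogonal_projection ip Hp).
Local Notation Pm := (orthogonal_projection ip Hm).
Let Hp_sub : linear_subspace Hp. Proof. by case: sd => -[]. Qed.
Let Hm_sub : linear_subspace Hm. Proof. by case: sd => -[]. Qed.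
Let H0_sub : linear_subspace H0. Proof. exact: kernel_subspace. Qed.

Lemma orthogonal_projectionE S u v : linear_subspace S -> S u ->
  orthogonal_complement ip S v -> orthogonal_projection ip S (u + v) = u.
Proof.
move=> S_sub Su Sv; rewrite /orthogonal_projection.
set E := [set y | _].
have [Sy yv] : E (xget 0 E).
  by apply: (@xgetPex _ 0 E); exists u; split => //; rewrite [u + v]addrC addrK.
set y := xget 0 E in Sy yv *.
have Suy : S (u - y) by exact: linear_subspaceB.
apply/eqP; rewrite eq_sym -subr_eq0 -normr_eq0 -sqrf_eq0 ipE.
have := yv _ Suy; rewrite addrAC ipDl (Sv _ Suy) addr0 => ->//.
Qed.

Lemma projE u up um : H0 u -> Hp up -> Hm um ->
  [/\ P0 (u + up + um) = u, Pp (u + up + um) = up & Pm (u + up + um) = um].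
Proof.
have [_ [w1 w2 w3] _ _ _] := sd => ku kp km; split.
- rewrite -addrA; apply: orthogonal_projectionE => // v v0.
  by rewrite ipDl ipC w1// add0r ipC w2.
- rewrite (addrC u) -addrA; apply: orthogonal_projectionE => // v vp.
  by rewrite ipDl w1// add0r ipC w3.
- rewrite addrC; apply: orthogonal_projectionE => // v vm.
  by rewrite ipDl w2// w3// addr0.
Qed.

Lemma proj_mem x : [/\ H0 (P0 x), Hp (Pp x), Hm (Pm x) & x = P0 x + Pp x + Pm x].
Proof.
have [_ _ dec _ _] := sd.
by have [u [up [um [k0 kp km ->]]]] := dec x; have [-> -> ->] := projE k0 kp km.
Qed.

Lemma projB x y : [/\ P0 (x - y) = P0 x - P0 y, Pp (x - y) = Pp x - Pp y &
  Pm (x - y) = Pm x - Pm y].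
Proof.
have [x0 xp xm xE] := proj_mem x; have [y0 yp ym yE] := proj_mem y.
rewrite {1 3 5}xE {1 3 5}yE.
have -> : P0 x + Pp x + Pm x - (P0 y + Pp y + Pm y) =
    (P0 x - P0 y) + (Pp x - Pp y) + (Pm x - Pm y).
  by rewrite !opprD addrACA; congr (_ + _); rewrite addrACA.
by apply: projE; exact: linear_subspaceB.
Qed.

Lemma projZ (a : R) x : [/\ P0 (a *: x) = a *: P0 x, Pp (a *: x) = a *: Pp x &
  Pm (a *: x) = a *: Pm x].
Proof.
have [x0 xp xm xE] := proj_mem x; rewrite {1 3 5}xE !scalerDr.
by apply: projE; exact: linear_subspaceZ.
Qed.

Lemma proj_norm x : `|x| ^+ 2 = `|P0 x| ^+ 2 + `|Pp x| ^+ 2 + `|Pm x| ^+ 2.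
Proof.
have [_ [w1 w2 w3] _ _ _] := sd; have [x0 xp xm xE] := proj_mem x.
rewrite {1}xE (pythagoras ipE); last by rewrite ipDl w2// w3// addr0.
by rewrite (pythagoras ipE)// w1.
Qed.

Lemma proj_le x : [/\ `|P0 x| <= `|x|, `|Pp x| <= `|x| & `|Pm x| <= `|x|].
Proof.
have := proj_norm x; have := sqr_ge0 `|P0 x|; have := sqr_ge0 `|Pp x|.
by have := sqr_ge0 `|Pm x|; split; apply: normr_sqr_le => //; lra.
Qed.

Lemma H0_orthP u : orthogonal_complement ip H0 u <-> P0 u = 0.
Proof.
split=> [uo|u0].
  by rewrite -[u]add0r; apply: orthogonal_projectionE => //; exact: H0_sub.1.
have [_ [w1 w2 w3] _ _ _] := sd; have [_ up um ->] := proj_mem u.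
by move=> v v0; rewrite u0 add0r ipDl ipC w1// add0r ipC w2.
Qed.

Lemma P0_H0 u : H0 u -> P0 u = u.
Proof.
move=> u0; have [] := projE u0 Hp_sub.1 Hm_sub.1.
by rewrite !addr0.
Qed.

Lemma P0_p u : Hp u -> P0 u = 0.
Proof.
move=> up; have [] := projE H0_sub.1 up Hm_sub.1.
by rewrite addr0 add0r.
Qed.

Lemma P0_m u : Hm u -> P0 u = 0.
Proof.
move=> um; have [] := projE H0_sub.1 Hp_sub.1 um.
by rewrite !add0r.
Qed.

Lemma B0_orth u : P0 (B 0 u) = 0.
Proof.
apply/H0_orthP => v v0; rewrite (B0_selfadjoint adm) v0; exact: ip0r.
Qed.

Lemma P0D x y : P0 (x + y) = P0 x + P0 y.
Proof.
have [+ _ _] := projB x (- y); rewrite opprK => ->.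
by have [+ _ _] := projZ (-1) y; rewrite !scaleN1r => ->; rewrite opprK.
Qed.

(** B(0) is coercive on [Hp] and -B(0) is coercive on [Hm], so the two components are solved
    separately; the sign change on [Hm] explains the solution [up - um]. *)
Lemma B0_onto w : P0 w = 0 -> exists2 u, P0 u = 0 & B 0 u = w.
Proof.
move=> w0; have [_ wp wm wE] := proj_mem w; rewrite w0 add0r in wE.
have [_ _ _ [BHp BHm] _] := sd.
have [M _ MP] := B0_bounded adm.
have [a1 [d [a10 d0 aP]]] := Hp_near_positive adm sd.
have j0 : `|j 0| < d by rewrite linear0 normr0.
have BHp' u : Hp u -> Hp (B 0 u) by move=> uP; apply: BHp; exists u.
have BHm' u : Hm u -> Hm (- B 0 u).
  by move=> uP; apply: linear_subspaceN => //; apply: BHm; exists u.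
have [up upp Bup] := coercive_surjective ipE Hp_sub BHp' a10 MP
  (fun u => aP 0 (V0 adm) j0 u) (Hp_closed adm sd) wp.
have [a2 a20 a2P] := Hm_negative adm sd.
pose nB : {linear H -> H} := \- (B 0).
have nBM u : `|nB u| <= M * `|u| by rewrite normrN.
have nBa u : Hm u -> a2 * `|u| ^+ 2 <= ip (nB u) u.
  by move=> /a2P; rewrite ipNl; lra.
have [um umm Bum] := coercive_surjective ipE Hm_sub (T := nB) BHm' a20 nBM nBa
  (Hm_closed adm sd) wm.
exists (up - um); first by have [-> _ _] := projB up um; rewrite P0_p// P0_m// subrr.
rewrite linearB Bup [RHS]wE; congr (_ + _); exact: Bum.
Qed.

End Projections.

(** * The reduction map *)

Section ReductionMap.
Context {R : realType} {H X : completeNormedModType R}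
  (ip : {dot H for idfun}) (j : {linear X -> H}) (V : set H)
  (L : H -> R) (A : X -> X) (B P Q : X -> {linear H -> H}) (Hp Hm : set H).
Hypothesis adm : admissible ip j V L A B P Q.
Hypothesis sd : spectral_decomposition ip (B 0) Hp Hm.
Local Notation H0 := (op_kernel (B 0)).
Local Notation ipE := (adm_hilbert_norm adm).
Local Notation P0 := (orthogonal_projection ip H0).
Local Notation incl := (incl_inv j).
Local Notation A0 := (fun u : X => 'D_u A 0).
Local Notation p0 := (fun x : X => incl (P0 (j x))).
Let P0_mem x : H0 (P0 x). Proof. by have [] := proj_mem adm sd x. Qed.
Let P0_range x : range j (P0 x). Proof. exact: (H0_range adm (P0_mem x)). Qed.

Lemma A_strict0 : strict_derivative setT A 0 A0.
Proof.
have [A1 A1P] := adm_F2_strict adm.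
by rewrite (_ : A0 = A1)//; apply/funext => u; exact: A_derivative0 A1P u.
Qed.

Lemma jA0 u : j ('D_u A 0) = B 0 (j u).
Proof. exact: (jDA adm _ (V0 adm)). Qed.

Lemma A0P (a : R) u v : 'D_(a *: u + v) A 0 = a *: 'D_u A 0 + 'D_v A 0.
Proof. by have [[A0L _] _] := A_strict0; exact: A0L. Qed.

Lemma A_origin : A 0 = 0.
Proof.
have [_ crit] := adm_C1_critical adm.
apply: (range_inner_eq0 adm) => v.
have [_ dL] := crit v I.
rewrite -(adm_F2_gradient adm _ (V0 adm)) -dL /derive.
apply: (f_equal (fun f => lim (f @ (0 : R)^'))); apply/funext => t /=.
by rewrite [j (_ + _)]linearD [j (_ *: _)]linearZ.
Qed.

Lemma j_p0 x : j (p0 x) = P0 (j x).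
Proof. exact: (incl_invKV adm (P0_range _)). Qed.

Lemma p0P (a : R) u v : p0 (a *: u + v) = a *: p0 u + p0 v.
Proof.
rewrite /= [j _]linearP (P0D adm sd); have [-> _ _] := projZ adm sd a (j u).
by rewrite (incl_invP adm _ (P0_range _) (P0_range _)).
Qed.

Lemma p0_bounded : exists2 C, 0 <= C & forall x, `|p0 x| <= C * `|x|.
Proof.
have [C C0 CP] := H0_incl_bounded adm; exists C => // x.
rewrite (le_trans (CP _ (P0_mem _)))// ler_wpM2l//.
have [+ _ _] := proj_le adm sd (j x); move/le_trans; apply.
exact: (adm_incl_norm adm).
Qed.

Lemma j_zero x : j x = 0 -> x = 0.
Proof. by move=> jx; apply: (adm_incl_inj adm); rewrite jx linear0. Qed.

(** A'(0) on the complement is glued to the identity on the kernel: T u = A'(0)(u - p0 u) + p0 u is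
    a bounded bijection of the whole of X that preserves kernel components. The bounded inverse
    theorem then applies to X itself, and restricting the inverse of T gives the inverse on the
    complement. *)
Lemma reduced_inverse : exists (K : X -> X) (c : R), [/\ 0 < c,
  forall (a : R) u v, K (a *: u + v) = a *: K u + K v,
  forall u, `|K u| <= c * `|u|,
  forall w, P0 (j w) = 0 -> P0 (j (K w)) = 0 /\ 'D_(K w) A 0 = w &
  forall u, P0 (j u) = 0 -> K ('D_u A 0) = u].
Proof.
pose T u := 'D_(u - p0 u) A 0 + p0 u.
have T_lin (a : R) u v : T (a *: u + v) = a *: T u + T v.
  rewrite /T p0P.
  have -> : a *: u + v - (a *: p0 u + p0 v) = a *: (u - p0 u) + (v - p0 v).
    by rewrite opprD addrACA scalerBr.
  by rewrite A0P scalerDr addrACA.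
pose T' : {linear X -> X} := HB.pack T (GRing.isLinear.Build _ _ _ _ T T_lin).
have P0jT u : P0 (j (T u)) = P0 (j u).
  rewrite /T linearD jA0 (P0D adm sd) (B0_orth adm sd) add0r j_p0.
  exact: (P0_H0 adm sd).
have jT u : P0 (j u) = 0 -> T u = 'D_u A 0.
  by move=> u0; rewrite /T u0 (incl_inv0 adm) subr0 addr0.
have T_inj u : T u = 0 -> u = 0.
  move=> Tu; have u0 : P0 (j u) = 0.
    by rewrite -P0jT Tu linear0 (P0_H0 adm sd)//; exact: (kernel_subspace _).1.
  apply: j_zero; rewrite -u0; apply/esym/(P0_H0 adm sd).
  by rewrite /op_kernel/= -jA0 -jT// Tu linear0.
have T_surj w : exists u, T u = w.
  have w1 : P0 (j (w - p0 w)) = 0.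
    rewrite linearB j_p0; have [-> _ _] := projB adm sd (j w) (P0 (j w)).
    by rewrite (P0_H0 adm sd (P0_mem _)) subrr.
  have [u u0 Bu] := B0_onto adm sd w1.
  (* The equation is solved in H; (C2) puts the solution in X. *)
  have [x _ xu] : range j u.
    by apply: (adm_C2 adm); rewrite Bu; exists (w - p0 w).
  exists (x + p0 w); apply: (adm_incl_inj adm); rewrite /T.
  have p0x : p0 (x + p0 w) = p0 w.
    rewrite linearD xu j_p0 (P0D adm sd) u0 add0r.
    by rewrite (P0_H0 adm sd (P0_mem _)).
  by rewrite p0x addrK linearD jA0 xu Bu -linearD subrK.
have /choice[K TK] := T_surj.
have KT u : K (T u) = u.
  apply/eqP; rewrite -subr_eq0; apply/eqP/T_inj.
  by rewrite -[T _]/(T' _) linearB /= TK subrr.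
have [k TM] : exists k, forall u, `|T u| <= k * `|u|.
  have [[_ [k kP]] _] := A_strict0; have [C C0 CP] := p0_bounded.
  exists (`|k| * (1 + C) + C) => u; rewrite /T (le_trans (ler_normD _ _))//.
  rewrite mulrDl lerD// (le_trans (kP _ I))// -mulrA.
  rewrite (@le_trans _ _ (`|k| * `|u - p0 u|))//; first by rewrite ler_wpM2r// ler_norm.
  by rewrite ler_wpM2l// (le_trans (ler_normB _ _))// mulrDl mul1r lerD.
have [c c0 cP] := @bounded_inverse R X X T' k TM (Bijective KT TK).
exists K, c; split => //.
- by move=> a u v; apply: (can_inj KT); rewrite T_lin !TK.
- by move=> u; rewrite -[in leRHS](TK u); exact: cP.
- move=> w w0; have KW : P0 (j (K w)) = 0 by rewrite -P0jT TK.
  by split => //; rewrite -jT.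
- by move=> u u0; rewrite -jT.
Qed.

(* [z + h z] solves the range component of [A = 0] by contraction: with K the
   inverse of A'(0) on the complement of the kernel, x |-> x - K (I - P^0) A (z + x)
   has arbitrarily small Lipschitz constants near the origin, because A'(0) vanishes
   on the kernel. *)
Lemma reduction_exists : exists (e0 r k : R) (h : H -> X),
  [/\ 0 < e0, 0 < r, 0 <= k & h 0 = 0] /\
  [/\ forall z, sball H0 e0 z -> [/\ P0 (j (h z)) = 0, `|h z| <= r / 2 &
        A (incl z + h z) = p0 (A (incl z + h z))],
      forall z x, sball H0 e0 z -> P0 (j x) = 0 -> `|x| <= r ->
        A (incl z + x) = p0 (A (incl z + x)) -> x = h z,
      forall z z', sball H0 e0 z -> sball H0 e0 z' ->
        `|h z - h z'| <= k * `|z - z'| &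
      forall e, 0 < e -> exists2 d : R, 0 < d & forall z z', H0 z -> H0 z' ->
        `|z| < d -> `|z'| < d -> `|h z - h z'| <= e * `|z - z'|].
Proof.
have [K [c [c0 KP Kc KV KA0]]] := reduced_inverse.
have [Cp Cp0 CpP] := p0_bounded.
have [C C0 CP] := H0_incl_bounded adm.
have H0s : linear_subspace H0 by exact: kernel_subspace.
pose q x := x - p0 x; pose N := c * (1 + Cp).
have N0 : 0 < N by rewrite mulr_gt0// ltr_pwDl.
have qP (a : R) u v : q (a *: u + v) = a *: q u + q v.
  by rewrite /q p0P opprD addrACA scalerBr.
have P0q x : P0 (j (q x)) = 0.
  rewrite linearB j_p0; have [-> _ _] := projB adm sd (j x) (P0 (j x)).
  by rewrite (P0_H0 adm sd (P0_mem _)) subrr.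
have qid x : P0 (j x) = 0 -> q x = x.
  by move=> x0; rewrite /q x0 (incl_inv0 adm) subr0.
pose M x := K (q x).
have MP (a : R) u v : M (a *: u + v) = a *: M u + M v by rewrite /M qP KP.
have MB u v : M (u - v) = M u - M v.
  by rewrite -scaleN1r addrC MP scaleN1r addrC.
have M0 : M 0 = 0 by have := MB 0 0; rewrite !subrr.
have Mle x : `|M x| <= N * `|x|.
  rewrite (le_trans (Kc _))// -mulrA ler_wpM2l ?(ltW c0)//.
  by rewrite /q (le_trans (ler_normB _ _))// mulrDl mul1r lerD.
pose G z x := x - M (A (incl z + x)).
have H0r z : H0 z -> range j z by move=> z0; exact: (H0_range adm z0).
(* The increment of the argument of [A] splits into a kernel part, annihilated by A'(0), and x - x',
   which [M] recovers from its image under A'(0). Hence the increment of [G] is, up to sign, [M]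
   applied to the remainder in the strict differentiability of [A]. *)
have est e : 0 < e -> exists2 d, 0 < d & forall z z' x x', H0 z -> H0 z' ->
    P0 (j x) = 0 -> P0 (j x') = 0 -> `|incl z + x| < d -> `|incl z' + x'| < d ->
    `|G z x - G z' x'| <= e * (`|incl z - incl z'| + `|x - x'|).
  move=> e0; have eN : 0 < e / N by rewrite divr_gt0.
  have [d d0 dP] := A_strict0.2 _ eN; exists d => // z z' x x' z0 z'0 x0 x'0 wd w'd.
  set w := incl z + x in wd *; set w' := incl z' + x' in w'd *.
  have ww' : w - w' = (incl z - incl z') + (x - x') by rewrite /w /w' opprD addrACA.
  have jzz : 'D_(incl z - incl z') A 0 = 0.
    apply: j_zero; rewrite jA0 linearB !(incl_invKV adm) ?linearB; [|exact: H0r..].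
    by rewrite z0 z'0 subrr.
  have Mx : M ('D_(w - w') A 0) = x - x'.
    rewrite ww' -[incl z - _]scale1r A0P jzz scaler0 add0r /M.
    have -> : q ('D_(x - x') A 0) = 'D_(x - x') A 0.
      by apply: qid; rewrite jA0 (B0_orth adm sd).
    apply: KA0; rewrite linearB; have [-> _ _] := projB adm sd (j x) (j x').
    by rewrite x0 x'0 subrr.
  have -> : G z x - G z' x' = - M (A w - A w' - 'D_(w - w') A 0).
    rewrite MB Mx MB /G -/w -/w' !opprB.
    by rewrite [RHS](AC (2*2) ((1*4)*(3*2))).
  rewrite normrN (le_trans (Mle _))// -ler_pdivlMl// mulrA [_^-1 * _]mulrC.
  rewrite (le_trans (dP w w' I I _ _)) ?subr0//.
  by rewrite ler_wpM2l ?(ltW eN)// ww' ler_normD.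
have h2 : 0 < 2^-1 :> R by [].
have [d1 d10 d1P] := est _ h2.
(* With |incl z| <= r / 2 and |x| <= r the sum stays within 3 d1 / 8. The factor C + 1 in [e0]
   converts the H-norm of z into its X-norm. *)
pose r := d1 / 4; have r0 : 0 < r by rewrite divr_gt0.
have C1 : 0 < C + 1 by rewrite ltr_wpDl.
pose e0 := r / 2 / (C + 1); have e00 : 0 < e0 by rewrite !divr_gt0.
have inclz z : sball H0 e0 z -> `|incl z| <= r / 2.
  move=> [z0 /= ze]; rewrite (le_trans (CP _ z0))//.
  rewrite (@le_trans _ _ ((C + 1) * `|z|))//; first by rewrite ler_wpM2r// lerDl.
  by rewrite -ler_pdivlMl// mulrC ltW.
have small z x : sball H0 e0 z -> `|x| <= r -> `|incl z + x| < d1.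
  move=> /inclz z2 x2; rewrite (le_lt_trans (ler_normD _ _))//.
  by rewrite /r in z2 x2 *; lra.
have G00 : G 0 0 = 0 by rewrite /G (incl_inv0 adm) addr0 A_origin M0 subrr.
have z00 : sball H0 e0 0 by split; [exact: H0s.1|rewrite /= normr0].
have PG z x : P0 (j x) = 0 -> P0 (j (G z x)) = 0.
  move=> x0; rewrite /G linearB; have [-> _ _] := projB adm sd (j x) (j (M (A (incl z + x)))).
  by rewrite x0 (KV _ (P0q _)).1 subrr.
have fixG z x : G z x = x -> A (incl z + x) = p0 (A (incl z + x)).
  move=> Gx; have M00 : M (A (incl z + x)) = 0.
    by rewrite -[LHS](subKr x) -/(G z x) Gx subrr.
  apply/eqP; rewrite -subr_eq0; apply/eqP.
  rewrite -[LHS]/(q _) -(KV _ (P0q _)).2 -/(M _) M00.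
  by apply: j_zero; rewrite jA0 !linear0.
have Gfix z x : A (incl z + x) = p0 (A (incl z + x)) -> G z x = x.
  move=> Ax; rewrite /G /M (_ : q _ = 0); last by rewrite /q -Ax subrr.
  by have := M0; rewrite /M (_ : q 0 = 0) ?qid// ?linear0 ?(P0_H0 adm sd H0s.1)// => ->; rewrite subr0.
have j0 : P0 (j 0) = 0 by rewrite linear0 (P0_H0 adm sd H0s.1).
have /choice[h hP] : forall z, exists x, sball H0 e0 z -> [/\ P0 (j x) = 0, `|x| <= r &
    A (incl z + x) = p0 (A (incl z + x))].
  move=> z; have [zB|nz] := pselect (sball H0 e0 z); last by exists 0.
  have [|||||x [x0 xr] Gx] := @contraction_fixed_point R X
    [set x | P0 (j x) = 0 /\ `|x| <= r] (G z) 2^-1.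
  - rewrite (_ : [set x | _] =
      (j @^-1` orthogonal_complement ip H0) `&` [set x | `|x| <= r]); last first.
      by apply/seteqP; split => x [x0 xr]; split => //; apply/(H0_orthP adm sd).
    apply: closedI.
      apply: closed_comp; last exact: (orthogonal_complement_closed ipE).
      by move=> x _; exact: (j_continuous adm).
    apply: (@closed_comp _ _ (fun u : X => `|u|) [set x : R | x <= r]); last exact: closed_le.
    by move=> u _; exact: norm_continuous.
  - by exists 0; split => //=; rewrite normr0 ltW.
  (* G 0 0 = 0, so the norm of G z x is at most (r / 2 + r) / 2, less than r. *)
  - move=> x [x0 xr]; split; first exact: PG.
    rewrite -[G z x]subr0 -G00 (le_trans (d1P _ _ _ _ zB.1 H0s.1 x0 j0 _ _))//.
    + exact: small.
    + by rewrite (incl_inv0 adm) addr0 normr0.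
    + rewrite (incl_inv0 adm) !subr0; have := inclz _ zB; lra.
  - by rewrite invr_ge0 ler0n invf_lt1// ltr1n.
  - move=> x y [x0 xr] [y0 yr]; rewrite (le_trans (d1P _ _ _ _ zB.1 zB.1 x0 y0 _ _))//.
    + exact: small.
    + exact: small.
    + by rewrite subrr normr0 add0r.
  by exists x => _; split => //; exact: fixG.
(* The contraction factor 1/2 lets |h z - x'| be absorbed on the left. As x' is an arbitrary small
   solution over z', the estimate yields uniqueness, the Lipschitz bound and the size of h
   together. *)
have hlip z z' : sball H0 e0 z -> sball H0 e0 z' -> forall x', P0 (j x') = 0 -> `|x'| <= r ->
    A (incl z' + x') = p0 (A (incl z' + x')) -> `|h z - x'| <= `|incl z - incl z'|.
  move=> zB zB' x' x'0 x'r Ax'; have [hz0 hzr Ah] := hP z zB.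
  have := d1P _ _ _ _ zB.1 zB'.1 hz0 x'0 (small _ _ zB hzr) (small _ _ zB' x'r).
  by rewrite !Gfix//; lra.
have uniq z x : sball H0 e0 z -> P0 (j x) = 0 -> `|x| <= r ->
    A (incl z + x) = p0 (A (incl z + x)) -> x = h z.
  move=> zB x0 xr Ax; have := hlip z z zB zB x x0 xr Ax.
  by rewrite subrr normr0 normr_le0 subr_eq0 => /eqP.
have h0 : h 0 = 0.
  apply/esym/uniq; rewrite ?normr0 ?(ltW r0)//.
  by rewrite (incl_inv0 adm) addr0 A_origin j0 (incl_inv0 adm).
have hC z z' : sball H0 e0 z -> sball H0 e0 z' -> `|h z - h z'| <= C * `|z - z'|.
  move=> zB zB'; have [hz0 hzr Ah] := hP z' zB'.
  rewrite (le_trans (hlip _ _ zB zB' _ hz0 hzr Ah))//.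
  rewrite -(incl_invB adm (H0r _ zB.1) (H0r _ zB'.1)).
  by apply: CP; apply: linear_subspaceB zB.1 zB'.1.
exists e0, r, C, h; split; split => //.
- move=> z zB; have [hz0 hzr Ah] := hP z zB; split => //.
  (* Comparison with the solution 0 over 0 gives |h z| <= r / 2; the remaining margin r / 2 is what
     the continuation argument for uniqueness consumes. *)
  have := hlip z 0 zB z00 0 j0; rewrite normr0 => /(_ (ltW r0)).
  rewrite (incl_inv0 adm) addr0 A_origin j0 (incl_inv0 adm) !subr0 => /(_ erefl).
  by move/le_trans; apply; exact: inclz.
- move=> e e1.
  (* The bound 1/2 allows absorption at the price of a factor 2; the other bound then makes 2 C e2
     at most e. *)
  pose e2 := Num.min 2^-1 (e / (2 * (C + 1))).
  have e20 : 0 < e2 by rewrite lt_min h2 divr_gt0// mulr_gt0.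
  have [d2 d20 d2P] := est _ e20.
  pose d := Num.min e0 (d2 / (2 * (C + 1))).
  have dd : 0 < d by rewrite lt_min e00 divr_gt0// mulr_gt0.
  have sm z : H0 z -> `|z| < d -> sball H0 e0 z /\ `|incl z + h z| < d2.
    move=> z0; rewrite lt_min => /andP[ze zd]; have zB : sball H0 e0 z by [].
    split => //; rewrite (le_lt_trans (ler_normD _ _))//.
    have := hC z 0 zB z00; rewrite h0 !subr0; have := CP z z0.
    by move: zd; rewrite ltr_pdivlMr ?mulr_gt0//; have := normr_ge0 z; nra.
  exists d => // z z' z0 z'0 /(sm z z0)[zB zd] /(sm z' z'0)[zB' z'd].
  have [hz0 hzr Ah] := hP z zB; have [hz'0 hz'r Ah'] := hP z' zB'.
  have := d2P _ _ _ _ z0 z'0 hz0 hz'0 zd z'd; rewrite !Gfix//.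
  have zz : `|incl z - incl z'| <= C * `|z - z'|.
    rewrite -(incl_invB adm (H0r _ z0) (H0r _ z'0)).
    by apply: CP; apply: linear_subspaceB z0 z'0.
  have e21 : e2 <= 2^-1 by rewrite ge_min lexx.
  have e22 : 2 * (C + 1) * e2 <= e.
    by rewrite -ler_pdivlMl ?mulr_gt0// mulrC ge_min lexx orbT.
  have := normr_ge0 (h z - h z'); have := normr_ge0 (z - z').
  have := normr_ge0 (incl z - incl z').
  move: `|h z - h z'| `|z - z'| `|incl z - incl z'| zz => a b y zz y0 b0 a0 ae.
  have h1 : a <= 2 * (e2 * y) by nra.
  have h3 : e2 * y <= e2 * (C * b) by rewrite ler_wpM2l// ltW.
  have h4 : 2 * (C + 1) * e2 * b <= e * b by rewrite ler_wpM2r.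
  have h5 : 0 <= e2 * b by rewrite mulr_ge0// ltW.
  by rewrite (le_trans h1)//; nra.
Qed.

End ReductionMap.

(** * One-variable calculus along lines *)

Section LineDerivatives.
Context {R : realType}.

(** The functional [l] makes a vector-valued map scalar, so that the mean value theorem applies to
    [A] as well as to [L]. *)
Lemma is_derive_line (E F : normedModType R) (f : E -> F) (l : F -> R) x u (s : R) :
  (forall (a : R) v, l (a *: v) = a * l v) ->
  (forall v w, l (v - w) = l v - l w) -> continuous l ->
  derivable f (x + s *: u) u ->
  is_derive s 1 (fun t : R => l (f (x + t *: u))) (l ('D_u f (x + s *: u))).
Proof.
move=> lZ lB lc df.
have cl : h^-1 *: (l (f (x + (h *: 1 + s) *: u)) - l (f (x + s *: u)))
    @[h --> (0 : R)^'] --> l ('D_u f (x + s *: u)).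
  rewrite (_ : (fun h : R => _) =
    fun h => l (h^-1 *: (f (h *: u + (x + s *: u)) - f (x + s *: u)))); last first.
    apply/funext => h; rewrite lZ lB; congr (_ * (l (f _) - _)).
    by rewrite [h *: 1]mulr1 scalerDl addrCA.
  apply: continuous_cvg; first exact: lc.
  exact: df.
apply: DeriveDef; first by apply/cvg_ex; exists (l ('D_u f (x + s *: u))); exact: cl.
exact: (cvg_lim (@norm_hausdorff _ R) cl).
Qed.

Lemma mvt_unit (g dg : R -> R) :
  (forall t : R, 0 <= t <= 1 -> is_derive t 1 g (dg t)) ->
  exists2 t, 0 <= t <= 1 & g 1 - g 0 = dg t.
Proof.
move=> gd.
have [||t] := @MVT_segment R g dg 0 1 ler01.
- by move=> t; rewrite in_itv/= => /andP[t0 t1]; apply: gd; rewrite !ltW.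
- apply: derivable_within_continuous => t; rewrite in_itv/= => t01.
  exact: (@ex_derive _ _ _ _ _ _ _ (gd t t01)).
by rewrite in_itv/= subr0 mulr1 => t01 ->; exists t.
Qed.

(** Substitute for a second-order Taylor bound when only one derivative exists: the mean value
    theorem applied to g(t) - c t - k t^2 / 2. *)
Lemma mvt_affine_ge (g dg : R -> R) (c k : R) :
  (forall t : R, 0 <= t <= 1 -> is_derive t 1 g (dg t)) ->
  (forall t : R, 0 <= t <= 1 -> c + k * t <= dg t) -> c + k / 2 <= g 1 - g 0.
Proof.
move=> gd dgk.
pose f := (fun t : R => g t - (c * t + k / 2 * (t * t))).
have fd (t : R) : 0 <= t <= 1 -> is_derive t 1 f (dg t - (c + k * t)).
  move=> t01; have gt := gd t t01.
  have h1 : is_derive t 1 (fun t : R => c * t) c.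
    by have := @is_deriveZ _ _ _ id c t 1 1 (is_derive_id _ _); rewrite [_ *: _]mulr1.
  have h2 : is_derive t 1 (fun t : R => k / 2 * (t * t)) (k * t).
    have := @is_deriveZ _ _ _ _ (k / 2) t 1 _
      (@is_deriveM _ _ id id t 1 1 1 (is_derive_id _ _) (is_derive_id _ _)).
    by rewrite (_ : k / 2 *: _ = k * t)//= /GRing.scale/= !mulr1; field.
  exact: (is_deriveB gt (is_deriveD h1 h2)).
have [t t01] := mvt_unit fd.
have := dgk t t01; rewrite /f !mulr0 !mulr1 !addr0 subr0; lra.
Qed.

(** Only positive t are tested, so that the lemma serves at a maximum on the boundary of a ball,
    along inward directions. *)
Lemma derive_le0_of_max (E : normedModType R) (f : E -> R) x u (d : R) :
  derivable f x u -> 0 < d -> (forall t : R, 0 < t < d -> f (x + t *: u) <= f x) ->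
  'D_u f x <= 0.
Proof.
move=> df d0 fm; rewrite leNgt; apply/negP => D0.
have : h^-1 *: (f (h *: u + x) - f x) @[h --> (0 : R)^'] --> 'D_u f x by exact: df.
move=> /cvgrPdist_lt/(_ _ D0)[e /= e0 eP].
pose t := Num.min e d / 2.
have m0 : 0 < Num.min e d by rewrite lt_min e0.
have t0 : 0 < t by rewrite divr_gt0.
have tm : t < Num.min e d by rewrite ltr_pdivrMr// ltr_pMr// ltr1n.
have [te td] : t < e /\ t < d by move: tm; rewrite lt_min => /andP[].
have := eP t; rewrite /= sub0r normrN gtr0_norm// => /(_ te (lt0r_neq0 t0)).
have : t^-1 *: (f (t *: u + x) - f x) <= 0.
  rewrite pmulr_rle0 ?invr_gt0// subr_le0 addrC; apply: fm.
  by rewrite t0.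
move=> q0; rewrite ltr_norml => /andP[_]; rewrite ltrBlDr ltrDl => q1.
by have := lt_le_trans q1 q0; rewrite ltxx.
Qed.

End LineDerivatives.

Lemma near_norm_lt (R : realType) (E : normedModType R) (I : Type)
    (F : set_system I) {FF : Filter F} (w : I -> E) (w0 : E) (r : R) :
  w @ F --> w0 -> `|w0| < r -> \forall i \near F, `|w i| < r.
Proof.
move=> cw wr; have cn : `|w i| @[i --> F] --> `|w0| by exact: cvg_norm.
exact: (cvgr_lt _ cn).
Qed.

Lemma near_lt_of_cvg (R : realFieldType) (I : Type) (F : set_system I)
    {FF : Filter F} (f g : I -> R) (a b : R) :
  f @ F --> a -> g @ F --> b -> a < b -> \forall i \near F, f i < g i.
Proof.
move=> fa gb ab; have ba : g i - f i @[i --> F] --> b - a by exact: cvgB.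
have b0 : 0 < b - a by rewrite subr_gt0.
have h : \forall i \near F, 0 < g i - f i by exact: (cvgr_gt _ ba).
by apply: filterS h => i; rewrite subr_gt0.
Qed.

(** * Gradient estimates, extended from X to H by density *)

Section GradientEstimates.
Context {R : realType} {H X : completeNormedModType R}
  (ip : {dot H for idfun}) (j : {linear X -> H}) (V : set H)
  (L : H -> R) (A : X -> X) (B P Q : X -> {linear H -> H}) (Hp Hm : set H).
Hypothesis adm : admissible ip j V L A B P Q.
Hypothesis sd : spectral_decomposition ip (B 0) Hp Hm.
Local Notation H0 := (op_kernel (B 0)).
Local Notation ipE := (adm_hilbert_norm adm).
Local Notation P0 := (orthogonal_projection ip H0).
Local Notation Pp := (orthogonal_projection ip Hp).
Local Notation Pm := (orthogonal_projection ip Hm).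
Local Notation incl := (incl_inv j).
Let Hp_sub : linear_subspace Hp. Proof. by case: sd => -[]. Qed.
Let Hm_sub : linear_subspace Hm. Proof. by case: sd => -[]. Qed.

Lemma DL_cvg (I : Type) (F : set_system I) {FF : Filter F} (w u : I -> H) (w0 u0 : H) :
  V w0 -> w @ F --> (w0 : H) -> u @ F --> (u0 : H) ->
  'D_(u i) L (w i) @[i --> F] --> 'D_u0 L w0.
Proof.
move=> Vw0 cw cu; have [_ /subspace_continuousP cL] := adm_F1 adm.
have Vn : nbhs w0 V by apply: open_nbhs_nbhs; split => //; exact: (adm_V_open adm).
have := cL (w0, u0) (conj Vw0 Logic.I).
rewrite (within_interior (x := (w0, u0) : H * H)); last by exists (V, setT) => //=; split=> //; exact: filterT.
have cwu : (w i, u i) @[i --> F] --> ((w0, u0) : H * H) by exact: cvg_pair.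
by move=> /(cvg_comp _ _ cwu).
Qed.

Lemma approx_range (w : H) : exists x_ : nat -> X, j (x_ n) @[n --> \oo] --> w.
Proof.
have /choice[x_ xP] : forall n : nat, exists x, `|w - j x| < n.+1%:R^-1.
  move=> n; have n0 : 0 < n.+1%:R^-1 :> R by rewrite invr_gt0.
  have wB : open (ball w (n.+1%:R^-1 : R)) by exact: ball_open.
  have [y [yB [x _ xy]]] := adm_incl_dense adm (ex_intro _ w (ballxx w n0)) wB.
  exists x; have : ball_ Num.norm w (n.+1%:R^-1 : R) y by rewrite ball_normE; exact: yB.
  by rewrite -xy.
exists x_; apply/cvgrPdist_lt => e e0.
have := near_infty_natSinv_lt (PosNum e0); apply: filterS => n /=.
exact: lt_trans (xP n).
Qed.

(** The kernel and [Hm] lie in X, so subtracting these two components keeps an approximant in X and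
    leaves its projection to [Hp]. *)
Lemma approx_Hp (w : H) : Hp w -> exists x_ : nat -> X,
  (forall n, Hp (j (x_ n))) /\ j (x_ n) @[n --> \oo] --> w.
Proof.
move=> wp; have [x_ xw] := approx_range w.
pose y_ n := x_ n - incl (P0 (j (x_ n))) - incl (Pm (j (x_ n))).
have jy n : j (y_ n) = Pp (j (x_ n)).
  have [h0 hp hm hE] := proj_mem adm sd (j (x_ n)).
  rewrite /y_ 2!linearB (incl_invKV adm); last exact: (H0_range adm h0).
  rewrite (incl_invKV adm); last exact: (Hm_range adm sd hm).
  by rewrite [X in X - _ - _]hE addrAC addrK addrC addKr.
exists y_; split; first by move=> n; rewrite jy; have [] := proj_mem adm sd (j (x_ n)).
apply/cvgrPdist_lt => e e0; move/cvgrPdist_lt: xw => /(_ e e0).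
apply: filterS => n; apply: le_lt_trans; rewrite jy.
have Ew : Pp w = w.
  have [_ + _] := projE adm sd (kernel_subspace _).1 wp Hm_sub.1.
  by rewrite add0r addr0.
by rewrite -[in leLHS]Ew; have [_ <- _] := projB adm sd w (j (x_ n)); have [] := proj_le adm sd (w - j (x_ n)).
Qed.

Lemma DL_range x u : V (j x) -> 'D_u L (j x) = ip (j (A x)) u.
Proof.
move=> xV; have [u_ uu] := approx_range u.
have c1 : 'D_(j (u_ n)) L (j x) @[n --> \oo] --> 'D_u L (j x).
  by apply: DL_cvg => //; exact: cvg_cst.
have c2 : 'D_(j (u_ n)) L (j x) @[n --> \oo] --> ip (j (A x)) u.
  rewrite (_ : (fun n => _) = fun n => ip (j (A x)) (j (u_ n))).
    by apply: (ip_cvg ipE) => //; exact: cvg_cst.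
  by apply/funext => n; exact: (adm_F2_gradient adm).
exact: (cvg_unique (@norm_hausdorff _ R) c1 c2).
Qed.

Lemma V_near (I : Type) (F : set_system I) {FF : Filter F} (w : I -> H) (w0 : H) :
  V w0 -> w @ F --> w0 -> \forall i \near F, V (w i).
Proof.
move=> Vw0 cw; apply: cw.
by apply: open_nbhs_nbhs; split => //; exact: (adm_V_open adm).
Qed.

(** At points of X linearity comes from the gradient formula [DL_range]; the joint continuity of the
    derivative carries it to the rest of V. *)
Lemma DL_linear w (a : R) u v : V w -> 'D_(a *: u + v) L w = a * 'D_u L w + 'D_v L w.
Proof.
move=> wV; have [x_ xw] := approx_range w.
have c1 : 'D_(a *: u + v) L (j (x_ n)) @[n --> \oo] --> 'D_(a *: u + v) L w.
  by apply: DL_cvg => //; exact: cvg_cst.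
have c2 : a * 'D_u L (j (x_ n)) + 'D_v L (j (x_ n)) @[n --> \oo] -->
    a * 'D_u L w + 'D_v L w.
  apply: cvgD; last by apply: DL_cvg => //; exact: cvg_cst.
  by apply: cvgM; [exact: cvg_cst|apply: DL_cvg => //; exact: cvg_cst].
have VN : \forall n \near \oo, V (j (x_ n)) by exact: V_near xw.
have c3 : 'D_(a *: u + v) L (j (x_ n)) @[n --> \oo] --> a * 'D_u L w + 'D_v L w.
  apply: cvg_trans c2; apply: near_eq_cvg; near=> n.
  have Vn : V (j (x_ n)) by near: n.
  by rewrite !DL_range// !ip_lin.
exact: (cvg_unique (@norm_hausdorff _ R) c1 c3).
Unshelve. all: by end_near. Qed.

Lemma DLZ w (a : R) u : V w -> 'D_(a *: u) L w = a * 'D_u L w.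
Proof.
move=> wV; have D0 : 'D_0 L w = 0.
  by have := @DL_linear w 1 0 0 wV; rewrite scaler0 addr0 mul1r => /eqP;
     rewrite -subr_eq0 opprD addrA subrr add0r oppr_eq0 => /eqP.
by have := @DL_linear w a u 0 wV; rewrite D0 !addr0.
Qed.

Lemma DLD w u v : V w -> 'D_(u + v) L w = 'D_u L w + 'D_v L w.
Proof. by move=> wV; have := @DL_linear w 1 u v wV; rewrite scale1r mul1r. Qed.

Lemma DLN w u : V w -> 'D_(- u) L w = - 'D_u L w.
Proof. by move=> wV; rewrite -scaleN1r DLZ// mulN1r. Qed.

Lemma DLB w u v : V w -> 'D_(u - v) L w = 'D_u L w - 'D_v L w.
Proof. by move=> wV; rewrite DLD// DLN. Qed.

Lemma ball_segment (E : normedModType R) (r : R) (w u : E) (t : R) :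
  0 <= t <= 1 -> `|w| < r -> `|w + u| < r -> `|w + t *: u| < r.
Proof.
move=> /andP[t0 t1] wr wur.
have -> : w + t *: u = (1 - t) *: w + t *: (w + u).
  by rewrite scalerDr addrA -scalerDl subrK scale1r.
rewrite (le_lt_trans (ler_normD _ _))// !normrZ (ger0_norm t0) ger0_norm ?subr_ge0//.
have mr : Num.max `|w| `|w + u| < r by rewrite gt_max wr.
have m1 : `|w| <= Num.max `|w| `|w + u| by rewrite le_max lexx.
have m2 : `|w + u| <= Num.max `|w| `|w + u| by rewrite le_max lexx orbT.
by apply: le_lt_trans mr; nra.
Qed.

(** The intermediate point depends on v, since the mean value theorem is applied to the scalar
    function (A(x + t u), v). A ball inside V provides the convexity that V may lack. *)
Lemma A_mvt (r : R) x u v : (forall w, `|w| < r -> V w) ->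
  `|j x| < r -> `|j (x + u)| < r -> exists t : R, [/\ 0 <= t <= 1,
    `|j (x + t *: u)| < r & ip (j (A (x + u) - A x)) (j v) =
    ip (B (x + t *: u) (j u)) (j v)].
Proof.
move=> rV xr xur.
have seg (t : R) : 0 <= t <= 1 -> `|j (x + t *: u)| < r.
  by move=> t01; rewrite [j _]linearD [j (t *: u)]linearZ; apply: ball_segment => //; rewrite -linearD.
pose l y := ip (j y) (j v).
have lZ (a : R) y : l (a *: y) = a * l y by rewrite /l linearZ ipZl.
have lB y z : l (y - z) = l y - l z by rewrite /l linearB ipBl.
have lc : continuous l.
  by move=> y; apply: (ip_cvg ipE); [exact: (j_continuous adm)|exact: cvg_cst].
have [|t t01] := @mvt_unit R (fun t : R => l (A (x + t *: u)))
    (fun t => l ('D_u A (x + t *: u))).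
  move=> t t01; apply: is_derive_line => //.
  exact: ((adm_F2_dir adm).1 _ _ (rV _ (seg t t01))).
rewrite scale1r scale0r addr0 -lB => lA; exists t; split => //; first exact: seg.
by rewrite -/(l _) lA /l (jDA adm)//; exact: rV (seg t t01).
Qed.

Lemma L_derive_line w u (t : R) : V (w + t *: u) ->
  is_derive t 1 (fun s : R => L (w + s *: u)) ('D_u L (w + t *: u)).
Proof.
move=> Vw; apply: (@is_derive_line _ _ _ L id) => //; first by move=> y; exact: cvg_id.
exact: (adm_F1 adm).1.
Qed.

Lemma L_mvt (r : R) w u : (forall w, `|w| < r -> V w) -> `|w| < r -> `|w + u| < r ->
  exists2 t : R, 0 <= t <= 1 & L (w + u) - L w = 'D_u L (w + t *: u).
Proof.
move=> rV wr wur.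
have [|t t01] := @mvt_unit R (fun t : R => L (w + t *: u))
    (fun t => 'D_u L (w + t *: u)).
  by move=> t t01; apply: L_derive_line; apply: rV; exact: ball_segment.
by rewrite scale1r scale0r addr0 => Lt; exists t.
Qed.

(** Second-order information enters the fiberwise construction only through these two inequalities.
    Testing with x - y makes the cross terms of (B(x + y), x - y) cancel by self-adjointness,
    leaving (B x, x) - (B y, y). The Lipschitz bound is restricted to directions in [Hm], where B(w)
    is close to B(0) in norm. Both are proved at points of X and pass to the limit. *)
Lemma gradient_estimates : exists r a M : R, [/\ 0 < r, 0 < a, 0 < M,
  forall w, `|w| < r -> V w &
  (forall w x y, Hp x -> Hm y -> `|w| < r -> `|w + (x + y)| < r ->
    a * (`|x| ^+ 2 + `|y| ^+ 2) <= 'D_(x - y) L (w + (x + y)) - 'D_(x - y) L w) /\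
  (forall w w' y, Hm y -> `|w| < r -> `|w'| < r ->
    `|'D_y L w - 'D_y L w'| <= M * `|w - w'| * `|y|)].
Proof.
have [r1 r10 r1V] := V_ball adm.
have [a1 [r2 [a10 r20 a1P]]] := Hp_near_positive adm sd.
have [a2 a20 a2P] := Hm_negative adm sd.
have a22 : 0 < a2 / 2 by rewrite divr_gt0.
have [r3 r30 r3P] := B_near_Hm adm sd a22.
have [M M0 MP] := B0_bounded adm.
pose r := Num.min r1 (Num.min r2 r3).
(* Half of the negativity constant [a2] of B(0) is spent on the perturbation from B(0) to B(x). *)
pose a := Num.min a1 (a2 / 2).
pose M' := M + a2.
have rr w : `|w| < r -> [/\ V w, `|w| < r2 & `|w| < r3].
  by rewrite !lt_min => /and3P[wr1 -> ->]; split => //; exact: r1V.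
have rV w : `|w| < r -> V w by move=> /rr[].
have Bm x y : `|j x| < r -> Hm y -> ip (B x y) y <= - a * `|y| ^+ 2.
  move=> /rr[Vx x2 x3] ym.
  have := r3P x Vx x3 y ym => By.
  have := ip_le ipE (B x y - B 0 y) y; rewrite ipBl => h1.
  have h2 : `|B x y - B 0 y| * `|y| <= a2 / 2 * `|y| * `|y| by rewrite ler_wpM2r.
  have h3 := a2P y ym.
  have h4 : a * `|y| ^+ 2 <= a2 / 2 * `|y| ^+ 2.
    by rewrite ler_wpM2r ?sqr_ge0// ge_min lexx orbT.
  by move: h3 h4; rewrite expr2 mulrA; lra.
exists r, a, M'; split => //.
- by rewrite !lt_min r10 r20.
- by rewrite lt_min a10.
- by rewrite ltr_wpDl.
split.
- move=> w x y xp ym wr wxyr.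
  have [w_ ww] := approx_range w; have [x_ [xp_ xx]] := approx_Hp xp.
  have ye : j (incl y) = y by rewrite (incl_invKV adm)//; exact: (Hm_range adm sd ym).
  have cs : j (w_ n) + (j (x_ n) + y) @[n --> \oo] --> w + (x + y).
    by apply: cvgD => //; apply: cvgD => //; exact: cvg_cst.
  have cd : j (x_ n) - y @[n --> \oo] --> x - y.
    by apply: cvgB => //; exact: cvg_cst.
  apply: (@cvg_ler _ _ \oo _ (fun n => a * (`|j (x_ n)| ^+ 2 + `|y| ^+ 2))
    (fun n => 'D_(j (x_ n) - y) L (j (w_ n) + (j (x_ n) + y)) -
              'D_(j (x_ n) - y) L (j (w_ n)))).
  + apply: cvgM; first exact: cvg_cst.
    apply: cvgD; last exact: cvg_cst.
    by rewrite expr2; under eq_fun do rewrite expr2; apply: cvgM; exact: cvg_norm.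
  + by apply: cvgB; apply: DL_cvg => //; exact: rV.
  + have n1 : \forall n \near \oo, `|j (w_ n)| < r.
      exact: near_norm_lt ww wr.
    have n2 : \forall n \near \oo, `|j (w_ n) + (j (x_ n) + y)| < r.
      exact: near_norm_lt cs wxyr.
    apply: filterS2 n1 n2 => n wn sn.
    rewrite -ye -!linearB -!linearD in sn *.
    rewrite !DL_range; [|exact: rV..].
    have [t [t01 tr ->]] : exists t : R, [/\ 0 <= t <= 1,
        `|j (w_ n + t *: (x_ n + incl y))| < r &
        ip (j (A (w_ n + (x_ n + incl y)))) (j (x_ n - incl y)) -
        ip (j (A (w_ n))) (j (x_ n - incl y)) =
        ip (B (w_ n + t *: (x_ n + incl y)) (j (x_ n + incl y))) (j (x_ n - incl y))].
      by rewrite -ipBl -linearB; exact: A_mvt.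
    move: tr; move: (w_ n + t *: _) => th tr.
    rewrite linearD linearB ye; move: (xp_ n); move: (j (x_ n)) => xi xip.
    have [Vt t2 t3] := rr _ tr.
    have [_ Bs] := adm_F3_Ls adm Vt.
    rewrite [B th (_ + _)]linearD !ip_lin (Bs y xi) [ip y _]ipC.
    have := a1P th Vt t2 xi xip; have := Bm th y tr ym.
    have : a * `|xi| ^+ 2 <= a1 * `|xi| ^+ 2.
      by rewrite ler_wpM2r ?sqr_ge0// ge_min lexx.
    by lra.
- move=> w w' y ym wr w'r.
  have [w_ ww] := approx_range w; have [w'_ ww'] := approx_range w'.
  have ye : j (incl y) = y by rewrite (incl_invKV adm)//; exact: (Hm_range adm sd ym).
  apply: (@cvg_ler _ _ \oo _ (fun n => `|'D_y L (j (w_ n)) - 'D_y L (j (w'_ n))|)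
    (fun n => M' * `|j (w_ n) - j (w'_ n)| * `|y|)).
  + by apply: cvg_norm; apply: cvgB; (apply: DL_cvg => //; [exact: rV|exact: cvg_cst]).
  + apply: cvgM; last exact: cvg_cst.
    by apply: cvgM; [exact: cvg_cst|apply: cvg_norm; exact: cvgB].
  + have n1 : \forall n \near \oo, `|j (w_ n)| < r.
      exact: near_norm_lt ww wr.
    have n2 : \forall n \near \oo, `|j (w'_ n)| < r.
      exact: near_norm_lt ww' w'r.
    apply: filterS2 n1 n2 => n wn w'n.
    rewrite !DL_range; [|exact: rV..].
    have wE : w'_ n + (w_ n - w'_ n) = w_ n by rewrite addrC subrK.
    have [|t [t01 tr tE]] := @A_mvt r (w'_ n) (w_ n - w'_ n) (incl y) rV w'n.
      by rewrite wE.
    rewrite wE ye in tE; rewrite -ipBl -linearB tE.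
    have [Vt t2 t3] := rr _ tr; have [_ Bs] := adm_F3_Ls adm Vt.
    rewrite Bs (le_trans (cauchy_schwarz ipE _ _))// -linearB.
    rewrite mulrAC [leRHS]mulrC ler_wpM2l//.
    rewrite -[B _ y](subrK (B 0 y)) (le_trans (ler_normD _ _))//.
    have h1 := r3P _ Vt t3 y ym; have h2 := MP y; have h3 := normr_ge0 y.
    by rewrite /M'; nra.
Qed.

End GradientEstimates.

(** * Rescaling along rays into the square of the norm *)

Section RadialForm.
Context {R : realType} {T : topologicalType} {E : normedModType R}.
Implicit Types (D : set T) (S : set E) (N : T -> E -> R) (t : T) (u v : E).

(* Continuity is stated along arbitrary filters so that it composes. *)
Definition radial_form D S N (k r : R) : Prop :=
  [/\ S 0 /\ (forall (a : R) v, S v -> S (a *: v)),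
      forall t, D t -> N t 0 = 0,
      forall t v, D t -> S v -> `|v| < r -> k * `|v| ^+ 2 <= N t v,
      forall t v (c : R), D t -> S v -> 1 <= c -> `|c *: v| < r ->
        N t v + k * (c - 1) ^+ 2 * `|v| ^+ 2 <= N t (c *: v) &
      forall (I : Type) (F : set_system I) (t : I -> T) (v : I -> E) t0 v0,
        Filter F -> D t0 -> S v0 -> `|v0| < r ->
        (\forall i \near F, D (t i) /\ S (v i)) ->
        t @ F --> t0 -> v @ F --> v0 -> N (t i) (v i) @[i --> F] --> N t0 v0].

(** The scalar is confined to [0, l], which bounds the result by l |u| and leaves a compact interval
    for the intermediate value theorem; it defaults to 0 when no scalar fits. *)
Definition radial N (l : R) t (u : E) : E :=
  xget 0 [set c : R | 0 <= c <= l /\ N t (c *: u) = `|u| ^+ 2] *: u.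

(** The vector of norm sqrt(N t v) on the ray of v. At v = 0 the result is 0 whatever the quotient
    is. *)
Definition unradial N t (v : E) : E := (Num.sqrt (N t v) / `|v|) *: v.

Context {D : set T} {S : set E} {N : T -> E -> R} {k r l e : R}.
Hypothesis HN : radial_form D S N k r.
(** [kl] makes N(l u) at least |u|^2, so that a scalar exists in [0, l]. The radius condition uses l
    + 1 instead of l, leaving room to compare with slightly larger scalars in the continuity
    proof. *)
Hypotheses (k0 : 0 < k) (l0 : 0 < l) (kl : 1 <= k * l ^+ 2).
Hypotheses (e0 : 0 < e) (ler_e : (l + 1) * e <= r).

Let le_scaled (c : R) u : 0 <= c <= l + 1 -> `|u| < e -> `|c *: u| < r.
Proof.
move=> /andP[c0 cl] ue; rewrite normrZ ger0_norm//; apply: lt_le_trans ler_e.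
rewrite (@le_lt_trans _ _ ((l + 1) * `|u|))//; first by rewrite ler_wpM2r.
by rewrite ltr_pM2l// ltr_wpDl// ltW.
Qed.

Let SZ (a : R) v : S v -> S (a *: v). Proof. by case: HN => -[_ +] _ _ _ _; apply. Qed.
Let N0 t : D t -> N t 0 = 0. Proof. by case: HN => _ + _ _ _; apply. Qed.
Let N_ge t v : D t -> S v -> `|v| < r -> k * `|v| ^+ 2 <= N t v.
Proof. by case: HN => _ _ + _ _; apply. Qed.

(** Strict growth along rays makes the rescaling scalar unique. The case a = 0 stands apart because
    the growth condition is applied with the ratio b / a. *)
Let N_lt t v (a b : R) : D t -> S v -> v != 0 -> 0 <= a -> a < b -> `|b *: v| < r ->
  N t (a *: v) < N t (b *: v).
Proof.
move=> Dt Sv v0 a0 ab bv; have v0' : 0 < `|v| by rewrite normr_gt0.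
have b0 : 0 < b by exact: le_lt_trans ab.
have [->|aN0] := eqVneq a 0.
  rewrite scale0r N0//; apply: lt_le_trans (N_ge Dt (SZ _ Sv) bv).
  by rewrite mulr_gt0// exprn_gt0// normrZ mulr_gt0// gtr0_norm.
have a1 : 0 < a by rewrite lt_def aN0.
have bE : b *: v = (b / a) *: (a *: v) by rewrite scalerA divfK.
case: HN => _ _ _ /(_ t (a *: v) (b / a) Dt (SZ _ Sv)) + _.
rewrite -bE ler_pdivlMr// mul1r (ltW ab) => /(_ erefl bv).
apply: lt_le_trans; rewrite ltrDl mulr_gt0//; last by rewrite exprn_gt0// normrZ mulr_gt0// gtr0_norm.
by rewrite mulr_gt0// exprn_gt0// subr_gt0 ltr_pdivlMr// mul1r.
Qed.

Lemma radialP t u : D t -> S u -> `|u| < e ->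
  exists c : R, [/\ 0 <= c <= l, radial N l t u = c *: u & N t (c *: u) = `|u| ^+ 2].
Proof.
move=> Dt Su ue.
suff [c [cl Nc]] : exists c : R, 0 <= c <= l /\ N t (c *: u) = `|u| ^+ 2.
  pose W := [set c : R | 0 <= c <= l /\ N t (c *: u) = `|u| ^+ 2].
  have [gl gN] : W (xget 0 W) by apply: (@xgetPex _ 0 W); exists c.
  by exists (xget 0 W).
have cg : {within `[0, l], continuous (fun c : R => N t (c *: u))}.
  apply/subspace_continuousP => c; rewrite /= in_itv/= => /andP[c0 cl].
  case: HN => _ _ _ _; apply => //.
  - exact: SZ.
  - by apply: le_scaled => //; rewrite c0 (le_trans cl)// lerDl.
  - by apply: filterE => i; split => //; exact: SZ.
  - exact: cvg_cst.
  - apply: cvgZ; last exact: cvg_cst.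
    exact: cvg_within_filter cvg_id.
have [|c] := @IVT R _ 0 l (`|u| ^+ 2) (ltW l0) cg.
- rewrite scale0r N0// ge_min le_max sqr_ge0/=; apply/orP; right.
  apply: le_trans (N_ge Dt (SZ l Su) _); last first.
    by apply: le_scaled => //; rewrite (ltW l0) lerDl/=.
  rewrite normrZ gtr0_norm// exprMn mulrA -[leLHS]mul1r ler_wpM2r// sqr_ge0//.
- by rewrite in_itv/= => c0l cu; exists c.
Qed.

Lemma radial_mem t u : S u -> S (radial N l t u).
Proof. exact: SZ. Qed.

Lemma radial_norm t u : D t -> S u -> `|u| < e -> `|radial N l t u| < r.
Proof.
move=> Dt Su ue; have [c [/andP[c0 cl] -> _]] := radialP Dt Su ue.
by apply: le_scaled => //; rewrite c0 (le_trans cl)// lerDl.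
Qed.

Lemma radial_norm_le t u : D t -> S u -> `|u| < e -> `|radial N l t u| <= l * `|u|.
Proof.
move=> Dt Su ue; have [c [/andP[c0 cl] -> _]] := radialP Dt Su ue.
by rewrite normrZ ger0_norm// ler_wpM2r.
Qed.

Lemma radial_value t u : D t -> S u -> `|u| < e -> N t (radial N l t u) = `|u| ^+ 2.
Proof. by move=> Dt Su ue; have [c [_ -> ->]] := radialP Dt Su ue. Qed.

Lemma radial_eq0 t u : D t -> S u -> `|u| < e -> radial N l t u = 0 -> u = 0.
Proof.
move=> Dt Su ue u0; have := radial_value Dt Su ue; rewrite u0 N0// => /esym/eqP.
by rewrite sqrf_eq0 normr_eq0 => /eqP.
Qed.

Lemma radial0 t : radial N l t 0 = 0.
Proof. by rewrite /radial scaler0. Qed.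

Lemma unradial_mem t v : S v -> S (unradial N t v).
Proof. exact: SZ. Qed.

Lemma unradial0 t : unradial N t 0 = 0.
Proof. by rewrite /unradial scaler0. Qed.

Let N_ge0 t v : D t -> S v -> `|v| < r -> 0 <= N t v.
Proof.
by move=> Dt Sv vr; apply: le_trans (N_ge Dt Sv vr); rewrite mulr_ge0// ?sqr_ge0// ltW.
Qed.

Lemma unradial_norm t v : D t -> S v -> `|v| < r -> `|unradial N t v| ^+ 2 = N t v.
Proof.
move=> Dt Sv vr; have [->|v0] := eqVneq v 0.
  by rewrite unradial0 normr0 expr0n N0.
rewrite /unradial normrZ ger0_norm ?divr_ge0 ?sqrtr_ge0//.
by rewrite divfK ?normr_eq0// sqr_sqrtr// N_ge0.
Qed.

Lemma radialK t u : D t -> S u -> `|u| < e -> unradial N t (radial N l t u) = u.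
Proof.
move=> Dt Su ue; have [->|u0] := eqVneq u 0; first by rewrite radial0 unradial0.
have u0' : 0 < `|u| by rewrite normr_gt0.
have [c [/andP[c0 cl] cE Nc]] := radialP Dt Su ue.
have c1 : c != 0.
  apply/eqP => c00; move: Nc; rewrite c00 scale0r N0// => /esym/eqP.
  by rewrite sqrf_eq0 normr_eq0 (negbTE u0).
rewrite /unradial cE Nc sqrtr_sqr normr_id normrZ (ger0_norm c0) scalerA.
rewrite (_ : `|u| / (c * `|u|) * c = 1) ?scale1r//.
by field; rewrite c1 gt_eqF.
Qed.

(** Both v and the rescaled vector lie on one ray with the same value of N, so strict growth
    identifies them. *)
Lemma unradialK t v : D t -> S v -> `|v| < r -> N t v < e ^+ 2 ->
  `|unradial N t v| < e /\ radial N l t (unradial N t v) = v.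
Proof.
move=> Dt Sv vr Nv; have un := unradial_norm Dt Sv vr.
have ue : `|unradial N t v| < e.
  by rewrite -(@ltr_pXn2r _ 2) ?nnegrE ?(ltW e0)// un.
split => //; have [->|v0] := eqVneq v 0; first by rewrite unradial0 radial0.
have [c [/andP[c0 cl] -> Nc]] := radialP Dt (unradial_mem t Sv) ue.
have br : `|c *: unradial N t v| < r.
  by apply: le_scaled => //; rewrite c0 (le_trans cl)// lerDl.
rewrite un in Nc; rewrite /unradial scalerA in Nc br *.
move: (c * _) (mulr_ge0 c0 (divr_ge0 (sqrtr_ge0 (N t v)) (normr_ge0 v))) Nc br => b b0 Nb br.
have [b1|b1|->] := ltgtP b 1; last by rewrite scale1r.
- by have := N_lt Dt Sv v0 b0 b1; rewrite scale1r Nb ltxx => /(_ vr).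
- by have := N_lt Dt Sv v0 ler01 b1 br; rewrite scale1r Nb ltxx.
Qed.

Lemma unradial_cvg (I : Type) (F : set_system I) {FF : Filter F} (t : I -> T)
    (v : I -> E) t0 v0 : D t0 -> S v0 -> `|v0| < r ->
  (\forall i \near F, D (t i) /\ S (v i)) ->
  t @ F --> t0 -> v @ F --> v0 ->
  unradial N (t i) (v i) @[i --> F] --> unradial N t0 v0.
Proof.
move=> Dt0 Sv0 v0r DS ct cv.
have cN : N (t i) (v i) @[i --> F] --> N t0 v0 by case: HN => _ _ _ _; apply.
have csN : Num.sqrt (N (t i) (v i)) @[i --> F] --> Num.sqrt (N t0 v0).
  by apply: continuous_cvg => //; exact: sqrt_continuous.
have [v00|v0N] := eqVneq v0 0.
  rewrite v00 unradial0; apply/cvgr0Pnorm_lt => e1 e10.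
  move: csN; rewrite v00 N0// sqrtr0 => /cvgr0Pnorm_lt/(_ _ e10) csN.
  have vr : \forall i \near F, `|v i| < r by exact: near_norm_lt cv v0r.
  apply: filterS3 DS csN vr => i [Di Si] si vi; apply: le_lt_trans si.
  rewrite ger0_norm ?sqrtr_ge0// -(unradial_norm Di Si vi).
  by rewrite sqrtr_sqr normr_id.
rewrite /unradial; apply: cvgZ => //; apply: cvgM => //.
by apply: cvgV; [rewrite normr_eq0|exact: cvg_norm].
Qed.

(** Just below and just above the limit scalar, N minus the squared norm has strict and opposite
    signs. By continuity these signs persist along the filter, and strict growth traps the nearby
    scalars in between. At u0 = 0 the bound by l |u| suffices. *)
Lemma radial_cvg (I : Type) (F : set_system I) {FF : Filter F} (t : I -> T)
    (u : I -> E) t0 u0 : D t0 -> S u0 -> `|u0| < e ->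
  (\forall i \near F, D (t i) /\ S (u i)) ->
  t @ F --> t0 -> u @ F --> u0 ->
  radial N l (t i) (u i) @[i --> F] --> radial N l t0 u0.
Proof.
move=> Dt0 Su0 u0e DS ct cu.
have ue : \forall i \near F, `|u i| < e by exact: near_norm_lt cu u0e.
have [u00|u0N] := eqVneq u0 0.
  rewrite u00 radial0; apply/cvgr0Pnorm_lt => e1 e10.
  have e1l : 0 < e1 / l by rewrite divr_gt0.
  move: cu; rewrite u00 => /cvgr0Pnorm_lt/(_ _ e1l) cu.
  apply: filterS3 DS cu ue => i [Di Si] ui uie.
  by rewrite (le_lt_trans (radial_norm_le Di Si uie))// mulrC -ltr_pdivlMr.
have [c0 [/andP[c00 c0l] cE Nc0]] := radialP Dt0 Su0 u0e.
have c0N : c0 != 0.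
  apply/eqP => c0z; move: Nc0; rewrite c0z scale0r N0// => /esym/eqP.
  by rewrite sqrf_eq0 normr_eq0 (negbTE u0N).
have c0p : 0 < c0 by rewrite lt_def c0N.
have csq : `|u i| ^+ 2 @[i --> F] --> `|u0| ^+ 2.
  by rewrite expr2; under eq_fun do rewrite expr2; apply: cvgM; exact: cvg_norm.
have cNb (b : R) : 0 <= b <= l + 1 -> N (t i) (b *: u i) @[i --> F] --> N t0 (b *: u0).
  move=> b0l; case: HN => _ _ _ _; apply => //.
  - exact: SZ.
  - exact: le_scaled.
  - by apply: filterS DS => i [Di Si]; split => //; exact: SZ.
  - by apply: cvgZ => //; exact: cvg_cst.
have /choice[c cP] : forall i, exists c : R, D (t i) -> S (u i) -> `|u i| < e ->
    [/\ 0 <= c <= l, radial N l (t i) (u i) = c *: u i & N (t i) (c *: u i) = `|u i| ^+ 2].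
  move=> i; have [Di|nD] := pselect (D (t i)); last by exists 0 => /nD.
  have [Si|nS] := pselect (S (u i)); last by exists 0 => _ /nS.
  have [ui|nu] := pselect (`|u i| < e); last by exists 0 => _ _ /nu.
  by have [b bP] := radialP Di Si ui; exists b.
have cc : c i @[i --> F] --> c0.
  apply/cvgrPdist_lt => e2 e20.
  (* The bounds c0 and 1 keep c0 - d nonnegative and c0 + d at most l + 1, inside the domain of
     N. *)
  pose d := Num.min (e2 / 2) (Num.min c0 1).
  have d0 : 0 < d by rewrite !lt_min divr_gt0// c0p ltr01.
  have [de2 dc0 d1] : [/\ d < e2, d <= c0 & d <= 1].
    split; last 2 first.
    - by rewrite !ge_min lexx orbT.
    - by rewrite !ge_min lexx !orbT.
    - by rewrite (@le_lt_trans _ _ (e2 / 2)) ?ge_min ?lexx// ltr_pdivrMr// ltr_pMr// ltr1n.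
  have b1 : 0 <= c0 - d <= l + 1.
    by rewrite subr_ge0 dc0 lerBlDr (le_trans c0l)// -addrA lerDl addr_ge0// ltW.
  have b2 : 0 <= c0 + d <= l + 1 by rewrite addr_ge0 ?(ltW d0)//= lerD.
  have h1 : N t0 ((c0 - d) *: u0) < `|u0| ^+ 2.
    rewrite -Nc0; apply: N_lt => //; first by case/andP: b1.
      by rewrite gtrBl.
    by apply: le_scaled => //; rewrite c00 (le_trans c0l)// lerDl.
  have h2 : `|u0| ^+ 2 < N t0 ((c0 + d) *: u0).
    by rewrite -Nc0; apply: N_lt => //; [rewrite ltrDl|exact: le_scaled].
  have n1 : \forall i \near F, N (t i) ((c0 - d) *: u i) < `|u i| ^+ 2.
    exact: near_lt_of_cvg (cNb _ b1) csq h1.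
  have n2 : \forall i \near F, `|u i| ^+ 2 < N (t i) ((c0 + d) *: u i).
    exact: near_lt_of_cvg csq (cNb _ b2) h2.
  have n3 : \forall i \near F, N (t i) ((c0 - d) *: u i) < `|u i| ^+ 2 /\
      `|u i| ^+ 2 < N (t i) ((c0 + d) *: u i) by exact: filterI.
  apply: filterS3 DS ue n3 => i [Di Si] ui [ni1 ni2].
  have [/andP[ci0 cil] _ Nci] := cP i Di Si ui.
  have uiN : u i != 0.
    by apply/eqP => ui0; move: ni1; rewrite ui0 scaler0 N0// normr0 expr0n ltxx.
  have q1 : c0 - d < c i.
    rewrite ltNge; apply/negP; rewrite le_eqVlt => /orP[/eqP ce|ce].
      by move: ni1; rewrite -ce Nci ltxx.
    have := N_lt Di Si uiN ci0 ce (le_scaled b1 ui).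
    by rewrite Nci => /(lt_trans ni1); rewrite ltxx.
  have q2 : c i < c0 + d.
    rewrite ltNge; apply/negP; rewrite le_eqVlt => /orP[/eqP ce|ce].
      by move: ni2; rewrite ce Nci ltxx.
    have cil1 : 0 <= c i <= l + 1 by rewrite ci0 (le_trans cil)// lerDl.
    have := N_lt Di Si uiN (andP b2).1 ce (le_scaled cil1 ui).
    by rewrite Nci => /lt_trans/(_ ni2); rewrite ltxx.
  by rewrite ltr_norml; lra.
rewrite cE.
have ccu : c i *: u i @[i --> F] --> c0 *: u0 by exact: cvgZ.
apply: cvg_trans ccu; apply: near_eq_cvg.
by apply: filterS2 DS ue => i [Di Si] ui; have [_ ->] := cP i Di Si ui.
Qed.

End RadialForm.

(** * The fiberwise Morse lemma *)

Section FiberwiseMorse.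
Context {R : realType} {H X : completeNormedModType R}
  (ip : {dot H for idfun}) (j : {linear X -> H}) (V : set H)
  (L : H -> R) (A : X -> X) (B P Q : X -> {linear H -> H}) (Hp Hm : set H).
Hypothesis adm : admissible ip j V L A B P Q.
Hypothesis sd : spectral_decomposition ip (B 0) Hp Hm.
Local Notation H0 := (op_kernel (B 0)).
Local Notation ipE := (adm_hilbert_norm adm).
Local Notation P0 := (orthogonal_projection ip H0).
Local Notation Pp := (orthogonal_projection ip Hp).
Local Notation Pm := (orthogonal_projection ip Hm).
Let Hp_sub : linear_subspace Hp. Proof. by case: sd => -[]. Qed.
Let Hm_sub : linear_subspace Hm. Proof. by case: sd => -[]. Qed.

Context (r a M : R).
Hypotheses (r0 : 0 < r) (a0 : 0 < a) (M0 : 0 < M).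
Hypothesis rV : forall w, `|w| < r -> V w.
Hypothesis DL_mono : forall w x y, Hp x -> Hm y -> `|w| < r -> `|w + (x + y)| < r ->
  a * (`|x| ^+ 2 + `|y| ^+ 2) <= 'D_(x - y) L (w + (x + y)) - 'D_(x - y) L w.
Hypothesis DL_lip : forall w w' y, Hm y -> `|w| < r -> `|w'| < r ->
  `|'D_y L w - 'D_y L w'| <= M * `|w - w'| * `|y|.

(** Directional derivatives alone do not give continuity; here it follows from the mean value
    theorem and the joint continuity of the derivative, which tends to its value in the direction
    0. *)
Lemma L_cvg (I : Type) (F : set_system I) {FF : Filter F} (w : I -> H) (w0 : H) :
  `|w0| < r -> w @ F --> w0 -> L (w i) @[i --> F] --> L w0.
Proof.
move=> w0r cw.
have /choice[t tP] : forall i, exists t : R, 0 <= t <= 1 /\ (`|w i| < r ->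
    L (w i) - L w0 = 'D_(w i - w0) L (w0 + t *: (w i - w0))).
  move=> i; have [wr|nwr] := ltP `|w i| r; last by exists 0; rewrite lexx ler01; split.
  have [|t t01 tE] := L_mvt adm rV w0r (u := w i - w0); first by rewrite addrC subrK.
  by exists t; split => // _; rewrite -tE [w0 + _]addrC subrK.
have cd : w i - w0 @[i --> F] --> (0 : H).
  by rewrite -(subrr w0); apply: cvgB => //; exact: cvg_cst.
have ct : w0 + t i *: (w i - w0) @[i --> F] --> w0.
  suff ct0 : t i *: (w i - w0) @[i --> F] --> (0 : H).
    have := cvgD (cvg_cst w0) ct0; rewrite addr0; exact.
  apply/cvgr0Pnorm_lt => e e0; move/cvgr0Pnorm_lt: cd => /(_ e e0).
  apply: filterS => i; apply: le_lt_trans; rewrite normrZ.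
  have [/andP[t0 t1] _] := tP i.
  by rewrite (ger0_norm t0) ler_piMl.
have cD : 'D_(w i - w0) L (w0 + t i *: (w i - w0)) @[i --> F] --> 'D_0 L w0.
  exact: (DL_cvg adm (rV w0r) ct cd).
have D0 : 'D_0 L w0 = 0.
  by have := DLZ adm 0 0 (rV w0r); rewrite scale0r mul0r.
rewrite D0 in cD.
have wr : \forall i \near F, `|w i| < r by exact: near_norm_lt cw w0r.
have cL : L (w i) - L w0 @[i --> F] --> (0 : R).
  apply: cvg_trans cD; apply: near_eq_cvg.
  by apply: filterS wr => i wir; have [_ /(_ wir)] := tP i.
have -> : (fun i => L (w i)) = fun i => (L (w i) - L w0) + L w0.
  by apply/funext => i; rewrite subrK.
by rewrite -[X in _ --> X]add0r; apply: cvgD => //; exact: cvg_cst.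
Qed.

Let seg (w u : H) (t : R) : 0 <= t <= 1 -> `|w| < r -> `|w + u| < r -> `|w + t *: u| < r.
Proof. exact: ball_segment. Qed.

(** Strong convexity along [Hp]: monotonicity applied to t x and divided by t bounds the slope at
    time t below by an affine function of t. *)
Lemma L_ge_Hp w x : Hp x -> `|w| < r -> `|w + x| < r ->
  L w + 'D_x L w + a / 2 * `|x| ^+ 2 <= L (w + x).
Proof.
move=> xp wr wxr.
suff : 'D_x L w + a * `|x| ^+ 2 / 2 <= L (w + 1 *: x) - L (w + 0 *: x).
  by rewrite scale1r scale0r addr0; lra.
apply: (@mvt_affine_ge R (fun t : R => L (w + t *: x))
    (fun t => 'D_x L (w + t *: x)) ('D_x L w) (a * `|x| ^+ 2)).
- by move=> t t01; apply: (L_derive_line adm); apply/rV/seg.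
- move=> t t01; have /andP[t0 _] := t01.
  have [->|tN0] := eqVneq t 0; first by rewrite mulr0 addr0 scale0r addr0.
  have tp : 0 < t by rewrite lt_def tN0.
  have tr := seg t01 wr wxr.
  have := DL_mono (w := w) (linear_subspaceZ t Hp_sub xp) Hm_sub.1 wr.
  rewrite subr0 addr0 => /(_ tr); rewrite normr0 expr0n addr0.
  rewrite !(DLZ adm)//; [|exact: rV..].
  rewrite normrZ (ger0_norm t0) exprMn => h.
  rewrite -(@ler_pM2l _ t)//; move: h; rewrite expr2; lra.
Qed.

Lemma L_le_Hm w y : Hm y -> `|w| < r -> `|w + y| < r ->
  L (w + y) <= L w + 'D_y L w - a / 2 * `|y| ^+ 2.
Proof.
move=> ym wr wyr.
suff : - 'D_y L w + a * `|y| ^+ 2 / 2 <= - L (w + 1 *: y) - - L (w + 0 *: y).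
  by rewrite scale1r scale0r addr0; lra.
apply: (@mvt_affine_ge R (fun t : R => - L (w + t *: y))
    (fun t => - 'D_y L (w + t *: y)) (- 'D_y L w) (a * `|y| ^+ 2)).
- move=> t t01.
  have h : is_derive t 1 (fun t : R => L (w + t *: y)) ('D_y L (w + t *: y)).
    by apply: (L_derive_line adm); apply/rV/seg.
  exact: is_deriveN h.
- move=> t t01; have /andP[t0 _] := t01.
  have [->|tN0] := eqVneq t 0; first by rewrite mulr0 addr0 scale0r addr0.
  have tp : 0 < t by rewrite lt_def tN0.
  have tr := seg t01 wr wyr.
  have := DL_mono (w := w) Hp_sub.1 (linear_subspaceZ t Hm_sub ym) wr.
  rewrite sub0r add0r => /(_ tr); rewrite normr0 expr0n add0r.
  rewrite !(DLN adm) ?(DLZ adm); [|exact: rV..].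
  rewrite normrZ (ger0_norm t0) exprMn => h.
  rewrite -(@ler_pM2l _ t)//; move: h; rewrite expr2; lra.
Qed.

Lemma Hm_compact_ball (s : R) : 0 < s -> compact (Hm `&` [set u | `|u| <= s]).
Proof.
move=> s0.
have -> : Hm `&` [set u | `|u| <= s] = ( *:%R s) @` (Hm `&` [set u | `|u| <= 1]).
  apply/seteqP; split => [u [um /= us]|_ [u [um /= u1] <-]].
    exists (s^-1 *: u); last by rewrite scalerA divff ?scale1r// gt_eqF.
    split; first exact: linear_subspaceZ.
    by rewrite /= normrZ gtr0_norm ?invr_gt0// ler_pdivrMl// mulr1.
  split; first exact: linear_subspaceZ.
  by rewrite /= normrZ gtr0_norm// -[leRHS]mulr1 ler_pM2l.
apply: continuous_compact; last exact: (Hm_compact adm sd).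
by apply: continuous_subspaceT => u; apply: cvgZ; [exact: cvg_cst|exact: cvg_id].
Qed.

(** [zeta z] stands for z + h(z). This part uses only its size, its Lipschitz bound, its kernel
    component and the vanishing there of derivatives orthogonal to the kernel. *)
Context (zeta : H -> H) (e0 K : R).
Local Notation D1 := (sball H0 e0).
Hypothesis zeta_small : forall z, D1 z -> `|zeta z| < r / 4.
Hypothesis zeta_lip : forall z z', D1 z -> D1 z' -> `|zeta z - zeta z'| <= K * `|z - z'|.
Hypothesis zeta_crit : forall z u, D1 z -> P0 u = 0 -> 'D_u L (zeta z) = 0.

(** [kap] bounds the slope of the vertex. The radius r is shared out as r / 4 for [zeta z], r / 4
    for x, r / 8 for the vertex (hence the second bound in [rx]) and r / 8 for the displacement from
    it. *)
Let kap := M / a.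
Let rx := Num.min (r / 4) (r / 8 / kap).
Let ry := r / 8.
Let kap0 : 0 < kap. Proof. exact: divr_gt0. Qed.

Lemma fiber_radius_gt0 : 0 < rx /\ 0 < ry.
Proof. by rewrite lt_min !divr_gt0. Qed.

Let rxP (x : H) : `|x| < rx -> `|x| < r / 4 /\ kap * `|x| < r / 8.
Proof. by rewrite lt_min => /andP[-> xk]; split=> //; rewrite mulrC -ltr_pdivlMr. Qed.

Let norm3 z (x y : H) : D1 z -> `|x| < rx -> `|y| <= r / 4 -> `|zeta z + x + y| < r.
Proof.
move=> /zeta_small zs /rxP[xs _] ys.
rewrite (le_lt_trans (ler_normD _ _))// (le_lt_trans (lerD (ler_normD _ _) ys))//.
by have := r0; lra.
Qed.

Let norm2 z (x : H) : D1 z -> `|x| < rx -> `|zeta z + x| < r.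
Proof.
by move=> zD xr; rewrite -[_ + x]addr0 norm3// normr0 divr_ge0// ltW.
Qed.

Let norm1 z : D1 z -> `|zeta z| < r.
Proof. by move=> /zeta_small zs; apply: (lt_trans zs); have := r0; lra. Qed.

(** The maximum over the compact ball of radius r / 4 of [Hm] might lie on its boundary, but the
    inward direction -y may be tested even there. With monotonicity, and with the Lipschitz bound
    from [zeta z], where the derivative vanishes, this gives a |y|^2 <= M |x| |y|. Hence y is
    interior and critical in all directions of [Hm]. *)
Lemma vertex_exists z x : D1 z -> Hp x -> `|x| < rx ->
  exists y, [/\ Hm y, `|y| <= kap * `|x| &
    forall v, Hm v -> 'D_v L (zeta z + x + y) = 0].
Proof.
move=> zD xp xr; have [xr4 xk] := rxP xr.
have r4 : 0 < r / 4 by rewrite divr_gt0.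
have Kc := Hm_compact_ball r4.
have Kn : (Hm `&` [set u | `|u| <= r / 4]) !=set0.
  by exists 0; split; [exact: Hm_sub.1|rewrite /= normr0 ltW].
have [|y] := @compact_EVT_max H R (fun y => L (zeta z + x + y)) _ Kn Kc.
  apply/subspace_continuousP => y [_ /= yr].
  apply: L_cvg; first exact: norm3.
  apply: cvgD; first exact: cvg_cst.
  exact: cvg_within_filter cvg_id.
rewrite inE => -[ym /= yr] ymax.
have yV : V (zeta z + x + y) by apply/rV/norm3.
have dir v (d : R) : Hm v -> 0 < d ->
    (forall t : R, 0 < t < d -> `|y + t *: v| <= r / 4) ->
    'D_v L (zeta z + x + y) <= 0.
  move=> vm d0 vd; apply: (derive_le0_of_max _ d0); first exact: (adm_F1 adm).1.
  move=> t td; rewrite -addrA; apply: ymax; rewrite inE; split; last exact: vd.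
  by apply: linear_subspaceD => //; exact: linear_subspaceZ.
have y1 : `|y| <= kap * `|x|.
  have := dir (- y) 1 (linear_subspaceN Hm_sub ym) ltr01 => /(_ _) dy.
  have {}dy : 'D_(- y) L (zeta z + x + y) <= 0.
    apply: dy => t /andP[t0 t1]; rewrite scalerN -scaleN1r -[y in y + _]scale1r.
    rewrite scalerA -scalerDl normrZ ger0_norm; last by rewrite mulN1r subr_ge0 ltW.
    by rewrite (le_trans _ yr)// ler_piMl// mulN1r gerBl ltW.
  have := DL_mono (w := zeta z + x) Hp_sub.1 ym (norm2 zD xr).
  rewrite !add0r normr0 expr0n add0r => /(_ (norm3 zD xr yr)).
  rewrite [X in _ <= _ - X](DLN adm); last exact/rV/norm2.
  have := DL_lip ym (norm2 zD xr) (norm1 zD).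
  have xE : zeta z + x - zeta z = x by rewrite addrC addKr.
  rewrite (zeta_crit zD (P0_m adm sd ym)) subr0 xE => /(le_trans (ler_norm _)) h1 h2.
  have [->|yN0] := eqVneq y 0; first by rewrite normr0 mulr_ge0// ltW.
  have yp : 0 < `|y| by rewrite normr_gt0.
  have h3 : a * `|y| * `|y| <= M * `|x| * `|y| by rewrite expr2 mulrA in h2; lra.
  by move: h3; rewrite ler_pM2r// /kap mulrAC ler_pdivlMr// mulrC.
exists y; split => // v vm.
have yi : `|y| < r / 4 by apply: (le_lt_trans y1); have := r0; lra.
have v1 : 0 < `|v| + 1 by rewrite ltr_wpDl.
have inner u : Hm u -> `|u| <= `|v| -> 'D_u L (zeta z + x + y) <= 0.
  move=> um uv; apply: (dir u ((r / 4 - `|y|) / (`|v| + 1))) => //.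
    by rewrite divr_gt0// subr_gt0.
  move=> t /andP[t0 td]; rewrite (le_trans (ler_normD _ _))// -lerBrDl.
  rewrite normrZ gtr0_norm//; move: td; rewrite ltr_pdivlMr// => /ltW; apply: le_trans.
  by rewrite ler_pM2l// (le_trans uv)// lerDl.
apply/eqP; rewrite eq_le inner//=.
have := inner (- v) (linear_subspaceN Hm_sub vm); rewrite normrN => /(_ (lexx _)).
by rewrite (DLN adm)// oppr_le0.
Qed.

Definition vertex z x : H :=
  xget 0 [set y | [/\ Hm y, `|y| <= M / a * `|x| &
    forall v, Hm v -> 'D_v L (zeta z + x + y) = 0]].

Lemma vertexP z x : D1 z -> Hp x -> `|x| < rx ->
  [/\ Hm (vertex z x), `|vertex z x| <= kap * `|x| &
    forall v, Hm v -> 'D_v L (zeta z + x + vertex z x) = 0].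
Proof.
move=> zD xp xr; have [y yP] := vertex_exists zD xp xr.
exact: (@xgetPex _ 0 [set y | [/\ Hm y, `|y| <= M / a * `|x| &
    forall v, Hm v -> 'D_v L (zeta z + x + y) = 0]] (ex_intro _ y yP)).
Qed.

Lemma vertex_small z x : D1 z -> Hp x -> `|x| < rx -> `|vertex z x| < r / 8.
Proof.
move=> zD xp xr; have [_ vr _] := vertexP zD xp xr.
by apply: (le_lt_trans vr); have [] := rxP xr.
Qed.

Lemma vertex0 z : D1 z -> vertex z 0 = 0.
Proof.
move=> zD; have [||_ +  _] := vertexP (x := 0) zD.
- exact: Hp_sub.1.
- by rewrite normr0; have [] := fiber_radius_gt0.
- by rewrite normr0 mulr0 normr_le0 => /eqP.
Qed.

Lemma fiber_norm z x v : D1 z -> Hp x -> `|x| < rx -> `|v| < ry ->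
  `|zeta z + x + vertex z x + v| < r.
Proof.
move=> zD xp xr vr; rewrite -addrA norm3// (le_trans (ler_normD _ _))//.
have := vertex_small zD xp xr; move: vr; rewrite /ry; lra.
Qed.

Let vertex_norm z x : D1 z -> Hp x -> `|x| < rx -> `|zeta z + x + vertex z x| < r.
Proof.
move=> zD xp xr; apply: norm3 => //.
by have := vertex_small zD xp xr; have := r0; lra.
Qed.

Lemma vertex_max z x y : D1 z -> Hp x -> `|x| < rx -> Hm y -> `|y| <= r / 4 ->
  L (zeta z + x + y) <= L (zeta z + x + vertex z x) - a / 2 * `|y - vertex z x| ^+ 2.
Proof.
move=> zD xp xr ym yr; have [vm _ vc] := vertexP zD xp xr.
have dm : Hm (y - vertex z x) by exact: linear_subspaceB.
have E : zeta z + x + vertex z x + (y - vertex z x) = zeta z + x + y.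
  by rewrite -addrA [vertex z x + _]addrC subrK.
have := L_le_Hm dm (vertex_norm zD xp xr); rewrite E vc// addr0.
by apply; exact: norm3.
Qed.

(** In place of the implicit function theorem: at the auxiliary point [zeta z + x + vertex z' x'],
    monotonicity towards the first vertex and the Lipschitz bound from the second enclose the
    derivative in the direction of their difference d, between a |d|^2 and a multiple of |d|. *)
Lemma vertex_lip z z' x x' : D1 z -> D1 z' -> Hp x -> Hp x' -> `|x| < rx -> `|x'| < rx ->
  `|vertex z x - vertex z' x'| <= kap * (`|zeta z - zeta z'| + `|x - x'|).
Proof.
move=> zD zD' xp xp' xr xr'.
have [vm _ vc] := vertexP zD xp xr; have [vm' _ vc'] := vertexP zD' xp' xr'.
set d := vertex z x - vertex z' x'.
have dm : Hm d by exact: linear_subspaceB.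
have n1 : `|zeta z + x + vertex z' x'| < r.
  by apply: norm3 => //; have := vertex_small zD' xp' xr'; have := r0; lra.
have E : zeta z + x + vertex z' x' + d = zeta z + x + vertex z x.
  by rewrite /d -addrA [_ + (_ - _)]addrC subrK.
have := DL_mono (w := zeta z + x + vertex z' x') Hp_sub.1 dm n1.
rewrite !add0r normr0 expr0n add0r E => /(_ (vertex_norm zD xp xr)).
rewrite !(DLN adm) ?vc//; [|exact: rV|exact/rV/vertex_norm].
rewrite oppr0 sub0r opprK => h1.
have := DL_lip dm n1 (vertex_norm zD' xp' xr').
rewrite vc'// subr0 => /(le_trans (ler_norm _)) h2.
have h3 : `|zeta z + x + vertex z' x' - (zeta z' + x' + vertex z' x')| <=
    `|zeta z - zeta z'| + `|x - x'|.
  rewrite [_ + vertex _ _]addrC [X in _ - X]addrC opprD addrACA subrr add0r.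
  by rewrite opprD addrACA ler_normD.
have [d0|dN0] := eqVneq d 0.
  by rewrite d0 normr0 mulr_ge0 ?(ltW kap0)// addr_ge0.
have dp : 0 < `|d| by rewrite normr_gt0.
have h4 : a * `|d| <= M * (`|zeta z - zeta z'| + `|x - x'|).
  rewrite -(ler_pM2r dp) -mulrA -expr2 (le_trans h1)// (le_trans h2)// ler_pM2r//.
  by rewrite ler_pM2l.
by rewrite /kap mulrAC ler_pdivlMr// mulrC.
Qed.

Let zeta_cvg (I : Type) (F : set_system I) {FF : Filter F} (z : I -> H) z0 :
  D1 z0 -> (\forall i \near F, D1 (z i)) -> z @ F --> z0 ->
  zeta (z i) @[i --> F] --> zeta z0.
Proof.
move=> z0D zD cz; apply/cvgrPdist_lt => e ep.
have K0 : 0 < `|K| + 1 by rewrite ltr_wpDl.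
have eK : 0 < e / (`|K| + 1) by rewrite divr_gt0.
move/cvgrPdist_lt: cz => /(_ _ eK) cz; apply: filterS2 zD cz => i zi zd.
rewrite (le_lt_trans (zeta_lip z0D zi))//.
rewrite (@le_lt_trans _ _ ((`|K| + 1) * `|z0 - z i|))//.
  by rewrite ler_wpM2r// (le_trans (ler_norm _))// lerDl.
by rewrite mulrC -ltr_pdivlMr.
Qed.

Lemma vertex_cvg (I : Type) (F : set_system I) {FF : Filter F} (z x : I -> H) z0 x0 :
  D1 z0 -> Hp x0 -> `|x0| < rx ->
  (\forall i \near F, D1 (z i) /\ Hp (x i)) -> z @ F --> z0 -> x @ F --> x0 ->
  vertex (z i) (x i) @[i --> F] --> vertex z0 x0.
Proof.
move=> z0D x0p x0r zx cz cx.
have xr : \forall i \near F, `|x i| < rx by exact: near_norm_lt cx x0r.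
have cze : zeta (z i) @[i --> F] --> zeta z0.
  by apply: zeta_cvg => //; apply: filterS zx => i [].
apply/cvgrPdist_lt => e ep.
have e2 : 0 < e / kap / 2 by rewrite !divr_gt0.
move/cvgrPdist_lt: cze => /(_ _ e2) cze; move/cvgrPdist_lt: cx => /(_ _ e2) cx.
have cc : \forall i \near F, `|zeta z0 - zeta (z i)| < e / kap / 2 /\
  `|x0 - x i| < e / kap / 2 by exact: filterI.
apply: filterS3 zx xr cc => i [zi xi] xir [c1 c2].
rewrite (le_lt_trans (vertex_lip z0D zi x0p xi x0r xir))//.
by rewrite mulrC -ltr_pdivlMr// [ltRHS]splitr ltrD.
Qed.

Definition ridge z x : R := L (zeta z + x + vertex z x) - L (zeta z).

(** The vertex is never differentiated. The lower bound compares the maximum with the competitor y =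
    0 and uses convexity in x; growth from x to c x keeps the old vertex as competitor for c x and
    uses convexity from there, with a slope of the right sign. *)
Lemma ridge_radial : radial_form D1 Hp ridge (a / 2) rx.
Proof.
have vok z x : D1 z -> Hp x -> `|x| < rx -> `|vertex z x| <= r / 4.
  by move=> zD xp xr; have := vertex_small zD xp xr; have := r0; lra.
split.
- by split; [exact: Hp_sub.1|move=> c v; exact: linear_subspaceZ].
- by move=> z zD; rewrite /ridge vertex0// !addr0 subrr.
- move=> z x zD xp xr.
  have := L_ge_Hp xp (norm1 zD) (norm2 zD xr).
  rewrite (zeta_crit zD (P0_p adm sd xp)) addr0 => h1.
  have := vertex_max zD xp xr Hm_sub.1; rewrite normr0 addr0 => /(_ _) h2.
  have {h2} h2 : L (zeta z + x) <= L (zeta z + x + vertex z x) -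
      a / 2 * `|0 - vertex z x| ^+ 2 by apply: h2; rewrite divr_ge0// ltW.
  have h3 : 0 <= a / 2 * `|0 - vertex z x| ^+ 2.
    by rewrite mulr_ge0 ?sqr_ge0// divr_ge0// ltW.
  by rewrite /ridge; lra.
- move=> z x c zD xp c1 cxr.
  have c0 : 0 < c by exact: lt_le_trans c1.
  have xr : `|x| < rx.
    by apply: le_lt_trans cxr; rewrite normrZ gtr0_norm// ler_peMl.
  have cxp : Hp (c *: x) by exact: linear_subspaceZ.
  have [vm _ vc] := vertexP zD xp xr.
  have h1 := vertex_max zD cxp cxr vm (vok z x zD xp xr).
  have h1' : 0 <= a / 2 * `|vertex z x - vertex z (c *: x)| ^+ 2.
    by rewrite mulr_ge0 ?sqr_ge0// divr_ge0// ltW.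
  pose w1 := zeta z + x + vertex z x.
  have w1r : `|w1| < r by exact: vertex_norm.
  have E : w1 + (c - 1) *: x = zeta z + c *: x + vertex z x.
    by rewrite scalerBl scale1r /w1 addrAC addrA -[_ + x + c *: x - x]addrA
       -[_ + x + (_ - _)]addrA [x + _]addrC subrK.
  have cx' : Hp ((c - 1) *: x) by exact: linear_subspaceZ.
  have := L_ge_Hp cx' w1r; rewrite E => /(_ (norm3 zD cxr (vok z x zD xp xr))).
  rewrite (DLZ adm)//; last exact: rV.
  (* Monotonicity from [zeta z] in the direction x - v: the derivative vanishes at [zeta z] because
     x - v is orthogonal to the kernel, and the derivative along v vanishes at [w1] by
     criticality. *)
  have h2 : 0 <= 'D_x L w1.
    have := DL_mono xp vm (norm1 zD); rewrite addrA => /(_ w1r).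
    have vx : P0 (x - vertex z x) = 0.
      have [-> _ _] := projB adm sd x (vertex z x).
      by rewrite (P0_p adm sd xp) (P0_m adm sd vm) subrr.
    rewrite (zeta_crit zD vx) subr0 (DLB adm); last exact: rV.
    by rewrite (vc _ vm) subr0; apply: le_trans; rewrite mulr_ge0 ?(ltW a0)// addr_ge0// sqr_ge0.
  have h3 : 0 <= (c - 1) * 'D_x L w1 by rewrite mulr_ge0// subr_ge0.
  rewrite normrZ exprMn real_normK ?num_real//.
  by rewrite /ridge -/w1; lra.
- move=> I F z x z0 x0 FF z0D x0p x0r zx cz cx.
  have cze : zeta (z i) @[i --> F] --> zeta z0.
    by apply: zeta_cvg => //; apply: filterS zx => i [].
  apply: cvgB; apply: L_cvg => //; [exact: vertex_norm| |exact: norm1].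
  by apply: cvgD; [exact: cvgD|exact: vertex_cvg].
Qed.

Definition descent (p : H * H) v : R :=
  L (zeta p.1 + p.2 + vertex p.1 p.2) - L (zeta p.1 + p.2 + vertex p.1 p.2 + v).

Local Notation D2 := [set p : H * H | [/\ D1 p.1, Hp p.2 & `|p.2| < rx]].

Lemma descent_radial : radial_form D2 Hm descent (a / 2) ry.
Proof.
split.
- by split; [exact: Hm_sub.1|move=> c v; exact: linear_subspaceZ].
- by move=> p _; rewrite /descent addr0 subrr.
- move=> [z x] v [/= zD xp xr] vm vr; have [_ _ vc] := vertexP zD xp xr.
  have := L_le_Hm vm (vertex_norm zD xp xr) (fiber_norm zD xp xr vr).
  by rewrite vc// /descent/=; lra.
- move=> [z x] v c [/= zD xp xr] vm c1 cvr.
  have c0 : 0 < c by exact: lt_le_trans c1.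
  have vr : `|v| < ry.
    by apply: le_lt_trans cvr; rewrite normrZ gtr0_norm// ler_peMl.
  have [_ _ vc] := vertexP zD xp xr.
  pose w := zeta z + x + vertex z x.
  have wr : `|w| < r by exact: vertex_norm.
  have wvr : `|w + v| < r by exact: fiber_norm.
  have E : w + v + (c - 1) *: v = w + c *: v.
    by rewrite scalerBl scale1r -addrA [v + _]addrC subrK.
  have vm' : Hm ((c - 1) *: v) by exact: linear_subspaceZ.
  have := L_le_Hm vm' wvr; rewrite E => /(_ (fiber_norm zD xp xr cvr)).
  rewrite (DLZ adm)//; last exact: rV.
  have h2 : 'D_v L (w + v) <= 0.
    have := DL_mono (w := w) Hp_sub.1 vm wr; rewrite sub0r add0r => /(_ wvr).
    rewrite normr0 expr0n add0r !(DLN adm) ?vc//; [|exact: rV..].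
    by rewrite oppr0 subr0; have := mulr_ge0 (ltW a0) (sqr_ge0 `|v|); lra.
  have h3 : 0 <= (c - 1) * - 'D_v L (w + v).
    by rewrite mulr_ge0 ?subr_ge0// oppr_ge0.
  rewrite normrZ exprMn real_normK ?num_real//.
  by rewrite /descent/= -/w; lra.
- move=> I F p v p0 v0 FF [z0D x0p x0r] v0m v0r pv cp cv.
  have cz : (p i).1 @[i --> F] --> p0.1 by apply: cvg_comp cp _; exact: cvg_fst.
  have cx : (p i).2 @[i --> F] --> p0.2 by apply: cvg_comp cp _; exact: cvg_snd.
  have zx : \forall i \near F, D1 (p i).1 /\ Hp (p i).2.
    by apply: filterS pv => i [[]].
  have cze : zeta (p i).1 @[i --> F] --> zeta p0.1.
    by apply: zeta_cvg => //; apply: filterS zx => i [].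
  have cw : zeta (p i).1 + (p i).2 + vertex (p i).1 (p i).2 @[i --> F] -->
      zeta p0.1 + p0.2 + vertex p0.1 p0.2.
    by apply: cvgD; [exact: cvgD|exact: vertex_cvg].
  apply: cvgB; apply: L_cvg => //; [exact: vertex_norm|exact: fiber_norm|].
  exact: cvgD.
Qed.

Hypothesis zeta_P0 : forall z, D1 z -> P0 (zeta z) = z.
Hypothesis zeta0 : zeta 0 = 0.
(** A convenient l with (a / 2) l^2 >= 1, since that product equals a / 2 + 2 + 2 / a. *)
Let l : R := 1 + 2 / a.
Context (eps : R).
Hypotheses (eps0 : 0 < eps) (eps_e0 : eps <= e0) (eps_rx : (l + 1) * eps <= rx)
  (eps_ry : (l + 1) * eps <= ry).

Local Notation B0 := (sball H0 eps).
Local Notation Bp := (sball Hp eps).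
Local Notation Bm := (sball Hm eps).
Local Notation Bpm := [set u | exists up um, [/\ Bp up, Bm um & u = up + um]].

Let l0 : 0 < l. Proof. by rewrite ltr_wpDr// divr_ge0// ltW. Qed.
Let a20 : 0 < a / 2. Proof. by rewrite divr_gt0. Qed.
Let al : 1 <= a / 2 * l ^+ 2.
Proof.
have -> : a / 2 * l ^+ 2 = a / 2 + 2 + 2 / a by rewrite /l; field; rewrite gt_eqF.
by have := a20; have : 0 < 2 / a by [rewrite divr_gt0]; lra.
Qed.
Let B0D z : B0 z -> D1 z.
Proof. by move=> [z0 /= ze]; split => //=; exact: lt_le_trans eps_e0. Qed.

Lemma sum_proj x y : Hp x -> Hm y -> [/\ P0 (x + y) = 0, Pp (x + y) = x & Pm (x + y) = y].
Proof.
move=> xp ym; have := projE adm sd (kernel_subspace _).1 xp ym.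
by rewrite add0r.
Qed.

Lemma proj_cvg (I : Type) (F : set_system I) {FF : Filter F} (w : I -> H) (w0 : H) :
  w @ F --> w0 -> [/\ P0 (w i) @[i --> F] --> P0 w0, Pp (w i) @[i --> F] --> Pp w0 &
    Pm (w i) @[i --> F] --> Pm w0].
Proof.
move=> /cvgrPdist_lt cw; split; apply/cvgrPdist_lt => e ep; move: (cw e ep);
  apply: filterS => i; apply: le_lt_trans.
- by have [<- _ _] := projB adm sd w0 (w i); have [] := proj_le adm sd (w0 - w i).
- by have [_ <- _] := projB adm sd w0 (w i); have [] := proj_le adm sd (w0 - w i).
- by have [_ _ <-] := projB adm sd w0 (w i); have [] := proj_le adm sd (w0 - w i).
Qed.

(** The map phi_z. The second rescaling has the already rescaled x as parameter, so the inverse can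
    recover x before treating y. *)
Definition fiber_map z u : H :=
  let x := radial ridge l z (Pp u) in
  x + vertex z x + radial descent l (z, x) (Pm u).

Local Notation Phi := (fun p : H * H => zeta p.1 + fiber_map p.1 p.2).

Let Bpm_proj u : Bpm u -> [/\ Hp (Pp u), `|Pp u| < eps, Hm (Pm u), `|Pm u| < eps &
  u = Pp u + Pm u].
Proof.
move=> [up [um [[upp upe] [umm ume] ->]]].
by have [_ -> ->] := sum_proj upp umm.
Qed.

Let x_dom z u : B0 z -> Bpm u ->
  [/\ D1 z, Hp (radial ridge l z (Pp u)) & `|radial ridge l z (Pp u)| < rx].
Proof.
move=> /B0D zD /Bpm_proj[up ue _ _ _]; split => //.
  exact: (radial_mem ridge_radial).
exact: (radial_norm ridge_radial l0 al eps_rx).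
Qed.

Let y_dom z u : B0 z -> Bpm u ->
  Hm (radial descent l (z, radial ridge l z (Pp u)) (Pm u)) /\
  `|radial descent l (z, radial ridge l z (Pp u)) (Pm u)| < ry.
Proof.
move=> zB uB; have xD := x_dom zB uB; have [_ _ um ue _] := Bpm_proj uB; split.
  exact: (radial_mem descent_radial).
exact: (radial_norm descent_radial l0 al eps_ry).
Qed.

Lemma fiber_map_proj z u : B0 z -> Bpm u -> let x := radial ridge l z (Pp u) in
  [/\ P0 (fiber_map z u) = 0, Pp (fiber_map z u) = x &
    Pm (fiber_map z u) = vertex z x + radial descent l (z, x) (Pm u)].
Proof.
move=> zB uB /=; have [zD xp xr] := x_dom zB uB; have [ym _] := y_dom zB uB.
have [vm _ _] := vertexP zD xp xr.
by rewrite /fiber_map -addrA; apply: sum_proj => //; exact: linear_subspaceD.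
Qed.

Lemma fiber_map_value z u : B0 z -> Bpm u ->
  L (zeta z + fiber_map z u) = `|Pp u| ^+ 2 - `|Pm u| ^+ 2 + L (zeta z).
Proof.
move=> zB uB; have xD := x_dom zB uB; have [zD xp xr] := xD.
have [up ue um umE _] := Bpm_proj uB.
have := radial_value ridge_radial l0 al eps_rx zD up ue.
have := radial_value descent_radial l0 al eps_ry (t := (z, radial ridge l z (Pp u))) xD um umE.
by rewrite /ridge /descent /fiber_map/= !addrA => h1 h2; lra.
Qed.

Lemma fiber_map0 z : B0 z -> fiber_map z 0 = 0.
Proof.
move=> /B0D zD.
have [_ E1 E2] := sum_proj Hp_sub.1 Hm_sub.1; rewrite addr0 in E1 E2.
by rewrite /fiber_map E1 E2 !radial0 vertex0// !addr0.
Qed.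

Lemma fiber_map_Hm z u : B0 z -> Bpm u -> Hm (fiber_map z u) <-> Pp u = 0.
Proof.
move=> zB uB; have [zD xp xr] := x_dom zB uB; have [ym _] := y_dom zB uB.
have [_ E _] := fiber_map_proj zB uB; have [vm _ _] := vertexP zD xp xr.
have [up ue _ _ _] := Bpm_proj uB; split => [fm|u0].
  apply: (radial_eq0 ridge_radial l0 al eps_rx zD up ue).
  rewrite -E; have [_ + _] := sum_proj Hp_sub.1 fm.
  by rewrite add0r.
rewrite /fiber_map; apply: linear_subspaceD => //; apply: linear_subspaceD => //.
by rewrite u0 radial0; exact: Hm_sub.1.
Qed.

(** P0 recovers z because both h(z) and the fiber part are orthogonal to the kernel; the other
    projections of w - zeta(z) then give x and y. *)
Definition unfiber w : H * H :=
  let z := P0 w in let x := Pp (w - zeta z) in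
  (z, unradial ridge z x + unradial descent (z, x) (Pm (w - zeta z) - vertex z x)).

(** Strict inequalities between continuous functions of w, instead of a direct image: openness
    follows without any invariance of domain. *)
Definition fiber_image : set H := [set w |
  let z := P0 w in let x := Pp (w - zeta z) in let y := Pm (w - zeta z) - vertex z x in
  [/\ `|z| < eps, `|x| < rx /\ ridge z x < eps ^+ 2 &
    `|y| < ry /\ descent (z, x) y < eps ^+ 2]].

Let P0_mem w : H0 (P0 w). Proof. by have [] := proj_mem adm sd w. Qed.
Let Pp_mem w : Hp (Pp w). Proof. by have [] := proj_mem adm sd w. Qed.
Let Pm_mem w : Hm (Pm w). Proof. by have [] := proj_mem adm sd w. Qed.

Lemma unfiberK z u : B0 z -> Bpm u ->
  fiber_image (zeta z + fiber_map z u) /\ unfiber (zeta z + fiber_map z u) = (z, u).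
Proof.
move=> zB uB; have xD := x_dom zB uB; have [zD xp xr] := xD.
have [ym yr] := y_dom zB uB; have [up ue um ume uE] := Bpm_proj uB.
have [E0 Ep Em] := fiber_map_proj zB uB.
have zE : P0 (zeta z + fiber_map z u) = z.
  by rewrite (P0D adm sd) E0 zeta_P0// addr0.
have sq s : `|s : H| < eps -> `|s| ^+ 2 < eps ^+ 2.
  by move=> se; rewrite ltr_pXn2r ?nnegrE// ltW.
have addK (v w : H) : v + w - v = w by rewrite addrC addKr.
rewrite /fiber_image /unfiber/= zE addK Ep Em addK; split.
  split; first exact: zB.2.
    by split => //; rewrite (radial_value ridge_radial l0 al eps_rx)// sq.
  split => //; rewrite (radial_value descent_radial l0 al eps_ry)//.
  exact: sq.
rewrite (radialK ridge_radial l0 al eps_rx)//.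
by rewrite (radialK descent_radial l0 al eps_ry)// -uE.
Qed.

Lemma fiberK w : fiber_image w ->
  [/\ B0 (unfiber w).1, Bpm (unfiber w).2 & Phi (unfiber w) = w].
Proof.
rewrite /fiber_image /unfiber/=.
set z := P0 w; set x := Pp _; set y := Pm _ - _.
move=> [ze [xr xe] [yr ye]].
have zB : B0 z by split => //; exact: P0_mem.
have zD := B0D zB.
have xp : Hp x by exact: Pp_mem.
have [vm _ _] := vertexP zD xp xr.
have ym : Hm y by apply: linear_subspaceB.
have xD : D2 (z, x) by [].
have [ue uK] := unradialK ridge_radial a20 l0 al eps0 eps_rx zD xp xr xe.
have [ve vK] := unradialK descent_radial a20 l0 al eps0 eps_ry xD ym yr ye.
have um : Hp (unradial ridge z x) by exact: (unradial_mem ridge_radial).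
have vm' : Hm (unradial descent (z, x) y) by exact: (unradial_mem descent_radial).
split => //; first by exists (unradial ridge z x), (unradial descent (z, x) y).
have [_ Ep Em] := sum_proj um vm'.
rewrite /fiber_map Ep Em uK vK /y -[x + _ + _]addrA [vertex z x + _]addrC subrK.
have [_ _ _] := proj_mem adm sd (w - zeta z).
have [-> _ _] := projB adm sd w (zeta z).
by rewrite zeta_P0// subrr add0r => <-; rewrite addrC subrK.
Qed.

Lemma fiber_map_cvg (I : Type) (F : set_system I) {FF : Filter F} (z u : I -> H)
    (z0 u0 : H) : B0 z0 -> Bpm u0 -> (\forall i \near F, B0 (z i) /\ Bpm (u i)) ->
  z @ F --> z0 -> u @ F --> u0 ->
  zeta (z i) + fiber_map (z i) (u i) @[i --> F] --> zeta z0 + fiber_map z0 u0.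
Proof.
move=> z0B u0B zuB cz cu; have [_ cup cum] := proj_cvg cu.
have xD0 := x_dom z0B u0B; have [z0D x0p x0r] := xD0.
have [up0 ue0 um0 ume0 _] := Bpm_proj u0B.
have cx : radial ridge l (z i) (Pp (u i)) @[i --> F] --> radial ridge l z0 (Pp u0).
  apply: (radial_cvg ridge_radial a20 l0 al eps_rx) => //.
  by apply: filterS zuB => i [zB uB]; split; [exact: B0D|have [] := Bpm_proj uB].
have cv : vertex (z i) (radial ridge l (z i) (Pp (u i))) @[i --> F] -->
    vertex z0 (radial ridge l z0 (Pp u0)).
  apply: vertex_cvg => //.
  by apply: filterS zuB => i [zB uB]; have [] := x_dom zB uB.
apply: cvgD.
  by apply: zeta_cvg => //; apply: filterS zuB => i [/B0D].
apply: cvgD; first exact: cvgD.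
apply: (radial_cvg descent_radial a20 l0 al eps_ry) => //.
  by apply: filterS zuB => i [zB uB]; split; [exact: x_dom|have [] := Bpm_proj uB].
exact: cvg_pair.
Qed.

Let unfiber_parts_cvg (I : Type) (F : set_system I) {FF : Filter F} (w : I -> H)
    (w0 : H) : fiber_image w0 -> (\forall i \near F, `|P0 (w i)| < eps) -> w @ F --> w0 ->
  [/\ P0 (w i) @[i --> F] --> P0 w0,
    Pp (w i - zeta (P0 (w i))) @[i --> F] --> Pp (w0 - zeta (P0 w0)) &
    Pm (w i - zeta (P0 (w i))) - vertex (P0 (w i)) (Pp (w i - zeta (P0 (w i)))) @[i --> F]
    --> Pm (w0 - zeta (P0 w0)) - vertex (P0 w0) (Pp (w0 - zeta (P0 w0)))].
Proof.
move=> [ze [xr xe] [yr ye]] zne cw; have [cz _ _] := proj_cvg cw.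
have zn : \forall i \near F, D1 (P0 (w i)) by apply: filterS zne => i zi; exact: B0D.
have z0D : D1 (P0 w0) by exact: B0D.
have cv : w i - zeta (P0 (w i)) @[i --> F] --> w0 - zeta (P0 w0).
  by apply: cvgB => //; exact: zeta_cvg.
have [_ cx cy] := proj_cvg cv; split => //; apply: cvgB => //.
by apply: vertex_cvg => //; apply: filterS zn => i.
Qed.

Lemma fiber_image_open : open fiber_image.
Proof.
rewrite openE => w wW; have [ze [xr xe] [yr ye]] := wW.
have cw : id @ nbhs w --> w by exact: cvg_id.
have [cz0 _ _] := proj_cvg cw.
have zn : \forall i \near w, `|P0 i| < eps by exact: near_norm_lt cz0 ze.
have [cz cx cy] := unfiber_parts_cvg wW zn cw.
have z0D : D1 (P0 w) by exact: B0D.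
have n1 : \forall i \near w, `|Pp (i - zeta (P0 i))| < rx by exact: near_norm_lt cx xr.
have n2 : \forall i \near w, `|Pm (i - zeta (P0 i)) - vertex (P0 i) (Pp (i - zeta (P0 i)))| < ry.
  exact: near_norm_lt cy yr.
have dn : \forall i \near w, D1 (P0 i) /\ Hp (Pp (i - zeta (P0 i))).
  by apply: filterS zn => i zi; split => //; exact: B0D.
have cr : ridge (P0 i) (Pp (i - zeta (P0 i))) @[i --> w] --> ridge (P0 w) (Pp (w - zeta (P0 w))).
  by have [_ _ _ _] := ridge_radial; apply.
have vn : \forall i \near w,
    D2 (P0 i, Pp (i - zeta (P0 i))) /\
    Hm (Pm (i - zeta (P0 i)) - vertex (P0 i) (Pp (i - zeta (P0 i)))).
  apply: filterS2 dn n1 => i [zi pi] xi; split => //.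
  by have [vm _ _] := vertexP zi pi xi; exact: linear_subspaceB.
have cd : descent (P0 i, Pp (i - zeta (P0 i)))
    (Pm (i - zeta (P0 i)) - vertex (P0 i) (Pp (i - zeta (P0 i)))) @[i --> w] -->
    descent (P0 w, Pp (w - zeta (P0 w)))
    (Pm (w - zeta (P0 w)) - vertex (P0 w) (Pp (w - zeta (P0 w)))).
  have [vm _ _] := vertexP z0D (Pp_mem (w - zeta (P0 w))) xr.
  have d2w : D2 (P0 w, Pp (w - zeta (P0 w))) by split => //; exact: Pp_mem.
  have ymw := linear_subspaceB Hm_sub (Pm_mem (w - zeta (P0 w))) vm.
  have [_ _ _ _ dc] := descent_radial.
  exact: (dc _ (nbhs w) _ _ _ _ _ d2w ymw yr vn (cvg_pair cz cx) cy).
have n3 : \forall i \near w, ridge (P0 i) (Pp (i - zeta (P0 i))) < eps ^+ 2.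
  exact: (near_lt_of_cvg (g := fun=> eps ^+ 2) cr (cvg_cst _) xe).
have n4 : \forall i \near w, descent (P0 i, Pp (i - zeta (P0 i)))
    (Pm (i - zeta (P0 i)) - vertex (P0 i) (Pp (i - zeta (P0 i)))) < eps ^+ 2.
  exact: (near_lt_of_cvg (g := fun=> eps ^+ 2) cd (cvg_cst _) ye).
suff : \forall i \near w, fiber_image i by [].
by near=> i; split; [near: i|split; near: i|split; near: i].
Unshelve. all: by end_near. Qed.

Lemma unfiber_cvg (I : Type) (F : set_system I) {FF : Filter F} (w : I -> H) (w0 : H) :
  fiber_image w0 -> (\forall i \near F, fiber_image (w i)) -> w @ F --> w0 ->
  unfiber (w i) @[i --> F] --> unfiber w0.
Proof.
move=> w0W wW cw; have [ze [xr xe] [yr ye]] := w0W.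
have zn : \forall i \near F, `|P0 (w i)| < eps by apply: filterS wW => i [].
have [cz cx cy] := unfiber_parts_cvg w0W zn cw.
have z0D : D1 (P0 w0) by exact: B0D.
have dn : \forall i \near F, D1 (P0 (w i)) /\ Hp (Pp (w i - zeta (P0 (w i)))).
  by apply: filterS zn => i zi; split => //; exact: B0D.
have n1 : \forall i \near F, `|Pp (w i - zeta (P0 (w i)))| < rx by exact: near_norm_lt cx xr.
apply: cvg_pair => //; apply: cvgD; first exact: (unradial_cvg ridge_radial a20).
have [vm _ _] := vertexP z0D (Pp_mem (w0 - zeta (P0 w0))) xr.
have d2w : D2 (P0 w0, Pp (w0 - zeta (P0 w0))) by split => //; exact: Pp_mem.
have ymw := linear_subspaceB Hm_sub (Pm_mem (w0 - zeta (P0 w0))) vm.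
have vn : \forall i \near F, D2 (P0 (w i), Pp (w i - zeta (P0 (w i)))) /\
    Hm (Pm (w i - zeta (P0 (w i))) - vertex (P0 (w i)) (Pp (w i - zeta (P0 (w i))))).
  apply: filterS2 dn n1 => i [zi pi] xi.
  have [vm' _ _] := vertexP zi pi xi.
  split; first by split.
  exact: linear_subspaceB Hm_sub (Pm_mem _) vm'.
exact: (unradial_cvg descent_radial a20 d2w ymw yr vn (cvg_pair cz cx) cy).
Qed.

Lemma fiber_homeomorphism : homeomorphism_on (B0 `*` Bpm) fiber_image Phi.
Proof.
exists unfiber; split.
- apply/seteqP; split => [_ [[z u] [zB uB] <-]|w wW]; first exact: (unfiberK zB uB).1.
  by have [zB uB E] := fiberK wW; exists (unfiber w).
- by move=> [z u] [/= zB uB]; exact: (unfiberK zB uB).2.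
- apply/subspace_continuousP => -[z u] [/= zB uB].
  apply: fiber_map_cvg => //; first by rewrite near_withinE; exact: filterE.
  + exact: cvg_within_filter cvg_fst.
  + exact: cvg_within_filter cvg_snd.
- apply/subspace_continuousP => w wW; apply: unfiber_cvg => //.
    by rewrite near_withinE; exact: filterE.
  exact: cvg_within_filter cvg_id.
Qed.

Lemma fiber_image_sub : fiber_image `<=` V.
Proof.
move=> w wW; have [zB uB <-] := fiberK wW.
have [zD xp xr] := x_dom zB uB; have [ym yr] := y_dom zB uB.
by apply: rV; rewrite /fiber_map !addrA; exact: fiber_norm.
Qed.

Lemma fiber_image0 : fiber_image 0.
Proof.
have z0 : B0 0 by split; [exact: (kernel_subspace _).1|rewrite /= normr0].
have u0 : Bpm 0.
  exists 0, 0; rewrite addr0; split => //; split; rewrite /= ?normr0//.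
    exact: Hp_sub.1.
  exact: Hm_sub.1.
have E : zeta 0 + fiber_map 0 0 = 0.
  by rewrite zeta0 add0r; exact: fiber_map0.
have W0 : fiber_image (zeta 0 + fiber_map 0 0) := (unfiberK z0 u0).1.
by rewrite E in W0.
Qed.

Lemma fiber_splitting : exists (W : set H) (phi : H -> H -> H),
  [/\ open W, W 0, W `<=` V,
    homeomorphism_on (B0 `*` Bpm) W (fun p : H * H => zeta p.1 + phi p.1 p.2) &
  [/\ forall z u, B0 z -> Bpm u -> P0 (phi z u) = 0,
    forall z up um, B0 z -> Bp up -> Bm um ->
      L (zeta z + phi z (up + um)) = `|up| ^+ 2 - `|um| ^+ 2 + L (zeta z),
    forall z up um, B0 z -> Bp up -> range j up -> Bm um -> range j (phi z (up + um)),
    forall z, B0 z -> phi z 0 = 0 &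
    forall z up um, B0 z -> Bp up -> Bm um -> Hm (phi z (up + um)) <-> up = 0]].
Proof.
have sumB up um : Bp up -> Bm um -> Bpm (up + um) by move=> uB mB; exists up, um.
exists fiber_image, fiber_map; split.
- exact: fiber_image_open.
- exact: fiber_image0.
- exact: fiber_image_sub.
- exact: fiber_homeomorphism.
split.
- by move=> z u zB uB; have [] := fiber_map_proj zB uB.
- move=> z up um zB pB mB; rewrite (fiber_map_value zB (sumB _ _ pB mB)).
  by have [_ -> ->] := sum_proj pB.1 mB.1.
(* The rescaling multiplies [up] by a scalar and so stays in X; the remaining terms lie in [Hm],
   which is contained in X. *)
- move=> z up um zB pB [x _ xE] mB; have uB := sumB _ _ pB mB.
  have [ym _] := y_dom zB uB; have [zD xp xr] := x_dom zB uB.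
  have [vm _ _] := vertexP zD xp xr.
  have [y _ yE] := Hm_range adm sd (linear_subspaceD Hm_sub vm ym).
  rewrite /fiber_map; have [_ Ep _] := sum_proj pB.1 mB.1.
  have [c [_ cE _]] := radialP ridge_radial l0 al eps_rx zD pB.1 pB.2.
  exists (c *: x + y) => //.
  by rewrite -addrA linearP xE yE Ep cE.
- exact: fiber_map0.
- move=> z up um zB pB mB; rewrite (fiber_map_Hm zB (sumB _ _ pB mB)).
  by have [_ -> _] := sum_proj pB.1 mB.1.
Qed.

End FiberwiseMorse.

(** * Uniqueness of h and the reduced functional *)

Section ReducedFunctional.
Context {R : realType} {H X : completeNormedModType R}
  (ip : {dot H for idfun}) (j : {linear X -> H}) (V : set H)
  (L : H -> R) (A : X -> X) (B P Q : X -> {linear H -> H}) (Hp Hm : set H).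
Hypothesis adm : admissible ip j V L A B P Q.
Hypothesis sd : spectral_decomposition ip (B 0) Hp Hm.
Local Notation H0 := (op_kernel (B 0)).
Local Notation ipE := (adm_hilbert_norm adm).
Local Notation P0 := (orthogonal_projection ip H0).
Local Notation incl := (incl_inv j).
Let H0_sub : linear_subspace H0. Proof. exact: kernel_subspace. Qed.
Let P0_mem w : H0 (P0 w). Proof. by have [] := proj_mem adm sd w. Qed.

Lemma A_locally_lipschitz : exists d k : R, [/\ 0 < d, 0 <= k &
  forall x y, `|x| < d -> `|y| < d -> `|A x - A y| <= k * `|x - y|].
Proof.
have [[_ [k kP]] sA] := A_strict0 adm.
have [d d0 dP] := sA 1 ltr01; exists d, (`|k| + 1); split => //.
move=> x y xd yd; rewrite -[A x - A y](subrK ('D_(x - y) A 0)).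
have h1 := dP x y I I; rewrite !subr0 in h1.
rewrite (le_trans (ler_normD _ _))// mulrDl addrC lerD//; last exact: h1.
by rewrite (le_trans (kP _ I))// ler_wpM2r// ler_norm.
Qed.

(** Solutions are unique only within the ball of radius r of X, while the competitor h' is merely
    Lipschitz, with an unknown constant. Moving from 0 to z along the segment in short steps, each
    agreement h' = h, of norm at most r / 2, keeps the next value of h' within r. *)
Lemma reduction_unique (e0 eps r : R) (h h' : H -> X) : 0 < r -> eps <= e0 ->
  (forall z, sball H0 e0 z -> `|h z| <= r / 2) ->
  (forall z x, sball H0 e0 z -> P0 (j x) = 0 -> `|x| <= r ->
    A (incl z + x) = incl (P0 (j (A (incl z + x)))) -> x = h z) ->
  reduction_map ip j V A H0 eps h' -> forall z, sball H0 eps z -> h' z = h z.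
Proof.
move=> r0 ee hr hu [h'1 h'lip h'0 h'A] z zB.
have [k hk] : exists k : R, forall z z', sball H0 eps z -> sball H0 eps z' ->
    `|h' z - h' z'| <= k * `|z - z'|.
  have [k [_ /(_ (k + 1))]] := h'lip; rewrite ltrDl => /(_ ltr01) hk.
  by exists (k + 1) => z1 z2 z1B z2B; exact: (hk (z1, z2)).
pose c := `|k| * `|z|.
(* n exceeds c / (r / 2), so a step of length |z| / n moves h' by at most r / 2. *)
pose n := (Num.truncn (c / (r / 2))).+1.
have n0 : 0 < n%:R :> R by rewrite ltr0n.
have cn : c / n%:R <= r / 2.
  rewrite ler_pdivrMr// -ler_pdivrMl ?divr_gt0// mulrC ltW//.
  exact: truncnS_gt.
have sB i : (i <= n)%N -> sball H0 eps ((i%:R / n%:R) *: z).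
  move=> ilen; split; first exact: linear_subspaceZ zB.1.
  rewrite /= normrZ ger0_norm ?divr_ge0//; apply: le_lt_trans zB.2.
  by rewrite ler_piMl// ler_pdivrMr// mul1r ler_nat.
have sB0 z1 : sball H0 eps z1 -> sball H0 e0 z1.
  by move=> [z10 /= z1e]; split => //=; exact: lt_le_trans ee.
suff /(_ n (leqnn _)) : forall i, (i <= n)%N ->
    h' ((i%:R / n%:R) *: z) = h ((i%:R / n%:R) *: z).
  by rewrite divff ?gt_eqF// scale1r.
have zero_eq : h' 0 = h 0.
  have B0 : sball H0 eps 0 by split; [exact: H0_sub.1|rewrite /= normr0 (le_lt_trans _ zB.2)].
  apply: hu; first exact: sB0.
  - by rewrite h'0 linear0 (P0_H0 adm sd H0_sub.1).
  - by rewrite h'0 normr0 ltW.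
  - by rewrite h'0 (incl_inv0 adm) addr0 (A_origin adm) linear0 (P0_H0 adm sd H0_sub.1) (incl_inv0 adm).
elim=> [_|i IH iln]; first by rewrite mul0r scale0r.
have [w1 _] := h'1 _ (sB _ iln).
apply: hu; first exact/sB0/sB.
- exact/(H0_orthP adm sd).
- have iB := sB _ (ltnW iln).
  rewrite -[h' _](subrK (h' ((i%:R / n%:R) *: z))) (le_trans (ler_normD _ _))//.
  rewrite [r]splitr lerD//; last by rewrite IH ?(ltnW iln)// hr//; exact: sB0.
  rewrite (le_trans (hk _ _ (sB _ iln) iB))// -scalerBl normrZ -mulrBl -natrB//.
  rewrite subSnn mul1r normfV [`|n%:R|]ger0_norm//.
  rewrite (le_trans _ cn)// /c mulrCA [leLHS]mulrC ler_wpM2r ?invr_ge0//.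
  by rewrite ler_wpM2r// ler_norm.
- apply: (adm_incl_inj adm); rewrite (incl_invKV adm); last first.
    exact: (H0_range adm (P0_mem _)).
  by apply/eqP; rewrite -subr_eq0; apply/eqP; exact: (h'A _ (sB _ iln)).
Qed.

Lemma incl_cvg S (C : R) (I : Type) (F : set_system I) {FF : Filter F} (u : I -> H) (u0 : H) :
  linear_subspace S -> S `<=` range j -> (forall v, S v -> `|incl v| <= C * `|v|) ->
  S u0 -> (\forall i \near F, S (u i)) -> u @ F --> u0 -> incl (u i) @[i --> F] --> incl u0.
Proof.
move=> SL Sr SC Su0 Su cu; apply/cvgrPdist_lt => e ep.
have C0 : 0 < `|C| + 1 by rewrite ltr_wpDl.
have eC : 0 < e / (`|C| + 1) by rewrite divr_gt0.
move/cvgrPdist_lt: cu => /(_ _ eC) cu; apply: filterS2 Su cu => i Si ui.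
rewrite -(incl_invB adm (Sr _ Su0) (Sr _ Si)).
rewrite (le_lt_trans (SC _ (linear_subspaceB SL Su0 Si)))//.
rewrite (@le_lt_trans _ _ ((`|C| + 1) * `|u0 - u i|))//.
  by rewrite ler_wpM2r// (le_trans (ler_norm _))// lerDl.
by rewrite mulrC -ltr_pdivlMr.
Qed.

Context (e0 r k C kA dA : R) (h : H -> X).
Local Notation D1 := (sball H0 e0).
Local Notation zx := (fun z => incl z + h z).
Local Notation Lo := (fun z => L (z + j (h z))).
Hypotheses (e00 : 0 < e0) (k0 : 0 <= k) (C0 : 0 <= C) (kA0 : 0 <= kA).
Hypothesis rV : forall w, `|w| < r -> V w.
Hypothesis h0 : h 0 = 0.
Hypothesis hP : forall z, D1 z -> P0 (j (h z)) = 0 /\ A (zx z) = incl (P0 (j (A (zx z)))).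
Hypothesis hlip : forall z z', D1 z -> D1 z' -> `|h z - h z'| <= k * `|z - z'|.
Hypothesis H0C : forall u, H0 u -> `|incl u| <= C * `|u|.
Hypothesis A_lip : forall x y, `|x| < dA -> `|y| < dA -> `|A x - A y| <= kA * `|x - y|.
Hypothesis zx_small : forall z, D1 z -> `|zx z| < dA.
Hypothesis zeta_small : forall z, D1 z -> `|z + j (h z)| < r.

Lemma j_zx z : H0 z -> j (zx z) = z + j (h z).
Proof. by move=> z0; rewrite linearD (incl_invKV adm)//; exact: (H0_range adm z0). Qed.

Lemma zx_lip z z' : D1 z -> D1 z' -> `|zx z - zx z'| <= (C + k) * `|z - z'|.
Proof.
move=> zD zD'; rewrite opprD addrACA (le_trans (ler_normD _ _))// mulrDl lerD ?hlip//.
rewrite -(incl_invB adm (H0_range adm zD.1) (H0_range adm zD'.1)).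
by apply: H0C; apply: linear_subspaceB zD.1 zD'.1.
Qed.

Lemma jA_zx_H0 z : D1 z -> H0 (j (A (zx z))).
Proof.
move=> zD; have [_ ->] := hP zD.
by rewrite (incl_invKV adm (H0_range adm (P0_mem _))); exact: P0_mem.
Qed.

Lemma zx_V z : D1 z -> V (j (zx z)).
Proof. by move=> zD; rewrite (j_zx zD.1); exact/rV/zeta_small. Qed.

Lemma zeta_critical z u : D1 z -> P0 u = 0 -> 'D_u L (z + j (h z)) = 0.
Proof.
move=> zD u0; rewrite -(j_zx zD.1) (DL_range adm _ (zx_V zD)) ipC.
by have /(H0_orthP adm sd) := u0; apply; exact: jA_zx_H0.
Qed.

Definition reduced_gradient z u : R := ip (j (A (zx z))) u.

Lemma reduced_gradient_lip z z' u : D1 z -> D1 z' ->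
  `|reduced_gradient z u - reduced_gradient z' u| <= kA * (C + k) * `|z - z'| * `|u|.
Proof.
move=> zD zD'; rewrite /reduced_gradient -ipBl -linearB.
rewrite (le_trans (cauchy_schwarz ipE _ _))// ler_wpM2r//.
rewrite (le_trans (adm_incl_norm adm _))// (le_trans (A_lip (zx_small zD) (zx_small zD')))//.
by rewrite -mulrA ler_wpM2l// zx_lip.
Qed.

Lemma reduced_expansion z z' : D1 z -> D1 z' ->
  `|Lo z' - Lo z - reduced_gradient z (z' - z)| <= kA * (C + k) ^+ 2 * `|z' - z| ^+ 2.
Proof.
move=> zD zD'; set w := zx z; set d := zx z' - w.
have jw : j w = z + j (h z) by exact: j_zx zD.1.
have jw' : j w + j d = z' + j (h z').
  by rewrite -linearD /d addrC subrK; exact: j_zx zD'.1.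
have wr : `|j w| < r by rewrite jw; exact: zeta_small.
have w'r : `|j w + j d| < r by rewrite jw'; exact: zeta_small.
have [t t01 Lt] := L_mvt adm rV wr w'r.
have [t0 t1] := andP t01.
rewrite -jw' -jw Lt -linearZ -linearD (DL_range adm); last first.
  by rewrite linearD linearZ; apply/rV/ball_segment.
have -> : reduced_gradient z (z' - z) = ip (j (A w)) (j d).
  have [hz _] := hP zD; have [hz' _] := hP zD'.
  have jd : j d = (z' - z) + (j (h z') - j (h z)).
    by rewrite /d linearB (j_zx zD'.1) jw opprD addrACA.
  suff hh : ip (j (A w)) (j (h z') - j (h z)) = 0 by rewrite jd ipDr hh addr0.
  have : P0 (j (h z') - j (h z)) = 0.
    by have [-> _ _] := projB adm sd (j (h z')) (j (h z)); rewrite hz hz' subrr.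
  by move/(H0_orthP adm sd) => ho; rewrite ipC; apply: ho; exact: jA_zx_H0.
rewrite -ipBl -linearB (le_trans (cauchy_schwarz ipE _ _))//.
have wd : `|w| < dA by exact: zx_small.
have wtd : `|w + t *: d| < dA.
  by apply: ball_segment => //; rewrite /d addrC subrK; exact: zx_small.
have h1 : `|j (A (w + t *: d) - A w)| <= kA * `|d|.
  rewrite (le_trans (adm_incl_norm adm _))// (le_trans (A_lip wtd wd))//.
  rewrite ler_wpM2l// addrC addKr normrZ (ger0_norm t0) ler_piMl//.
have h2 : `|j d| <= `|d| := adm_incl_norm adm d.
have h3 : `|d| <= (C + k) * `|z' - z| by exact: zx_lip.
have h4 : `|d| ^+ 2 <= ((C + k) * `|z' - z|) ^+ 2.
  by rewrite ler_pXn2r ?nnegrE// mulr_ge0// addr_ge0.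
rewrite (@le_trans _ _ (kA * `|d| ^+ 2))//.
  by rewrite expr2 mulrA ler_pM.
by rewrite -mulrA ler_wpM2l// -exprMn.
Qed.

Context (eps : R).
Hypotheses (eps0 : 0 < eps) (eps_e0 : eps <= e0).
Local Notation Beps := (sball H0 eps).
Let BD z : Beps z -> D1 z.
Proof. by move=> [z0 /= ze]; split => //=; exact: lt_le_trans eps_e0. Qed.
Let B00 : Beps 0. Proof. by split; [exact: H0_sub.1|rewrite /= normr0]. Qed.

Lemma reduced_gradient_bounded_linear z : bounded_linear_on H0 (reduced_gradient z).
Proof.
split; first by move=> a u v _ _; rewrite /reduced_gradient !ip_lin.
by exists `|j (A (zx z))| => u _; exact: (cauchy_schwarz ipE).
Qed.

Let sball_shift z : Beps z -> exists2 d : R, 0 < d &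
  forall u, H0 u -> `|u| < d -> Beps (z + u).
Proof.
move=> zB; exists (eps - `|z|); first by rewrite subr_gt0; exact: zB.2.
move=> u u0 ud; split; first exact: linear_subspaceD zB.1 u0.
by rewrite /= (le_lt_trans (ler_normD _ _))// -ltrBrDl.
Qed.

Lemma reduced_frechet z : Beps z -> frechet_derivative H0 Lo z (reduced_gradient z).
Proof.
move=> zB; split; first exact: reduced_gradient_bounded_linear.
move=> e ep; have [d1 d10 d1P] := sball_shift zB.
pose c := kA * (C + k) ^+ 2 + 1.
have c0 : 0 < c by rewrite ltr_wpDl// mulr_ge0// sqr_ge0.
exists (Num.min d1 (e / c)); first by rewrite lt_min d10 divr_gt0.
move=> u u0; rewrite lt_min => /andP[ud1 uc].
have := reduced_expansion (BD zB) (BD (d1P u u0 ud1)).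
rewrite [z + u - z]addrC addKr => /le_trans; apply.
rewrite [`|u| ^+ 2]expr2 mulrA ler_wpM2r//; move: uc; rewrite ltr_pdivlMr// => /ltW; apply: le_trans.
by rewrite mulrC ler_wpM2l// /c lerDl.
Qed.

Lemma reduced_C2m0 : is_C2m0 H0 Beps Lo reduced_gradient.
Proof.
have kC0 : 0 <= kA * (C + k) by rewrite mulr_ge0// addr_ge0.
split; first exact: reduced_frechet.
- move=> z zB e ep; pose c := kA * (C + k) + 1.
  have c0 : 0 < c by rewrite ltr_wpDl.
  exists (e / c); first by rewrite divr_gt0.
  move=> y yB yz u _; rewrite (le_trans (reduced_gradient_lip u (BD yB) (BD zB)))//.
  rewrite ler_wpM2r//; move: yz; rewrite ltr_pdivlMr// => /ltW; apply: le_trans.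
  by rewrite mulrC ler_wpM2l// /c lerDl.
- move=> z zB; exists 1, (kA * (C + k)); split => // y y' yB y'B _ _ u _.
  exact: reduced_gradient_lip (BD yB) (BD y'B).
Qed.

(** For u in the kernel, (A'(0) w, u) = (w, B(0) u) = 0. The linear part of the increment of A is
    thus invisible to u, and only the strict differentiability remainder is left. *)
Lemma reduced_gradient_strict :
  strict_derivative_op H0 reduced_gradient 0 (fun _ _ => 0).
Proof.
split.
  split; first by move=> a x y _ _ u _; rewrite scaler0 addr0.
  split; last by exists 0 => x _ u _; rewrite mul0r normr0 mul0r.
  move=> x _; split; first by move=> a u v _ _; rewrite scaler0 addr0.
  by exists 0 => u _; rewrite normr0 mul0r.
move=> e ep; pose c := C + k + 1.
have c0 : 0 < c by rewrite ltr_wpDl// addr_ge0.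
have ec : 0 < e / c by rewrite divr_gt0.
have [d d0 dP] := (A_strict0 adm).2 _ ec.
exists (Num.min e0 (d / c)); first by rewrite lt_min e00 divr_gt0.
have D00 : D1 0 by split; [exact: H0_sub.1|rewrite /= normr0].
have sm x : H0 x -> `|x - 0| < Num.min e0 (d / c) -> D1 x /\ `|zx x - 0| < d.
  move=> x0; rewrite subr0 lt_min => /andP[xe xd]; have xD : D1 x by [].
  split => //; have := zx_lip xD D00; rewrite /= h0 (incl_inv0 adm) addr0 !subr0 => h1.
  rewrite (le_lt_trans h1)//; move: xd; rewrite ltr_pdivlMr// mulrC.
  by apply: le_lt_trans; rewrite ler_wpM2r// /c lerDl.
move=> x y x0 y0 /(sm x x0)[xD xd] /(sm y y0)[yD yd] u u0.
have A0u : ip (j ('D_(zx x - zx y) A 0)) u = 0.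
  by rewrite (jA0 adm) (B0_selfadjoint adm) u0 ip0r.
rewrite subr0 /reduced_gradient -ipBl -linearB.
rewrite -[ip _ u]subr0 -A0u -ipBl -linearB (le_trans (cauchy_schwarz ipE _ _))//.
rewrite ler_wpM2r// (le_trans (adm_incl_norm adm _))//.
rewrite (le_trans (dP _ _ I I xd yd))// (le_trans (ler_wpM2l (ltW ec) (zx_lip xD yD)))//.
rewrite mulrA ler_wpM2r// -mulrA ger_pMr// mulrC ler_pdivrMr// mul1r.
by rewrite /c lerDl.
Qed.

Lemma reduced_derive z u : Beps z -> H0 u ->
  derivable Lo z u /\ 'D_u Lo z = reduced_gradient z u.
Proof.
move=> zB u0; have [[gl _] fd] := reduced_frechet zB.
have g0 : reduced_gradient z 0 = 0 by rewrite /reduced_gradient ip0r.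
have c : t^-1 *: (Lo (t *: u + z) - Lo z) @[t --> (0 : R)^'] --> reduced_gradient z u.
  apply/cvgrPdist_le => e ep.
  have eu : 0 < e / (`|u| + 1) by rewrite divr_gt0// ltr_wpDl.
  have [d d0 dP] := fd _ eu.
  have du : 0 < d / (`|u| + 1) by rewrite divr_gt0// ltr_wpDl.
  near=> t.
  have t0 : t != 0 by near: t; exact: nbhs_dnbhs_neq.
  have td : `|t| < d / (`|u| + 1) by near: t; exact: dnbhs0_lt.
  have tu : `|t *: u| < d.
    rewrite normrZ (@le_lt_trans _ _ (`|t| * (`|u| + 1)))//.
      by rewrite ler_wpM2l// lerDl.
    by rewrite -ltr_pdivlMr ?ltr_wpDl.
  have := dP (t *: u) (linear_subspaceZ t H0_sub u0) tu.
  have -> : reduced_gradient z (t *: u) = t * reduced_gradient z u.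
    by rewrite /reduced_gradient ipZr.
  rewrite [z + _]addrC => le1.
  have -> : reduced_gradient z u - t^-1 *: (Lo (t *: u + z) - Lo z) =
      - (t^-1 *: (Lo (t *: u + z) - Lo z - t * reduced_gradient z u)).
    have E : t^-1 *: (t * reduced_gradient z u) = reduced_gradient z u.
      by rewrite /GRing.scale/= mulrA mulVf// mul1r.
    by rewrite [in RHS]scalerBr E opprB.
  rewrite normrN normrZ normfV ler_pdivrMl ?normr_gt0//.
  rewrite (le_trans le1)// normrZ mulrCA ler_wpM2l//.
  by rewrite -mulrA ger_pMr// mulrC ler_pdivrMr ?ltr_wpDl// mul1r lerDl.
split; first by apply/cvg_ex; exists (reduced_gradient z u); exact: c.
exact: (cvg_lim (@norm_hausdorff _ R) c).
Unshelve. all: by end_near. Qed.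

(** At a critical z of the reduced functional, A(z + h(z)) lies in the kernel and is tested against
    itself, hence vanishes, so z + h(z) is critical for L on X. It is close to 0 in X, so it equals
    0, and its kernel component z is 0. *)
Lemma reduced_isolated : isolated (critical_points setT (j @^-1` V) (L \o j)) 0 ->
  isolated (critical_points H0 Beps Lo) 0.
Proof.
move=> [_ [U U0 UE]]; split.
  rewrite inE; split => // u u0; have [d1 d2] := reduced_derive B00 u0; split => //.
  by rewrite d2 /reduced_gradient h0 (incl_inv0 adm) addr0 (A_origin adm) linear0 ip0l.
have /nbhs_ballP[d /= d0 dU] := U0.
pose c := C + k + 1.
have c0 : 0 < c by rewrite ltr_wpDl// addr_ge0.
have dc : 0 < d / c by rewrite divr_gt0.
exists (ball 0 (d / c)); first exact: nbhsx_ballx.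
apply/seteqP; split => [z [zb [zB zc]]|z ->]; last first.
  split; first exact: ballxx.
  split => // u u0; have [d1 d2] := reduced_derive B00 u0; split => //.
  by rewrite d2 /reduced_gradient h0 (incl_inv0 adm) addr0 (A_origin adm) linear0 ip0l.
have {}zb : `|z| < d / c by move: zb; rewrite -ball_normE /= sub0r normrN.
have zD := BD zB.
have Az : A (zx z) = 0.
  apply: (j_zero adm); apply/eqP; rewrite -normr_eq0 -sqrf_eq0 ipE; apply/eqP.
  have Az0 := jA_zx_H0 zD.
  by have [_ <-] := zc _ Az0; have [_ ->] := reduced_derive zB Az0.
have zx0 : zx z = 0.
  have : (U `&` critical_points setT (j @^-1` V) (L \o j)) (zx z).
    split.
      apply: dU; rewrite -ball_normE /= sub0r normrN.
      have := zx_lip zD (BD B00); rewrite h0 (incl_inv0 adm) addr0 !subr0.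
      move/le_lt_trans; apply; move: zb; rewrite ltr_pdivlMr// mulrC.
      by apply: le_lt_trans; rewrite ler_wpM2r// /c lerDl.
    split; first exact: zx_V.
    move=> u _.
    have E : (fun t : R => t^-1 *: ((L \o j) (t *: u + zx z) - (L \o j) (zx z))) =
        (fun t : R => t^-1 *: (L (t *: j u + j (zx z)) - L (j (zx z)))).
      by apply/funext => t /=; rewrite [j (_ + _)]linearD [j (t *: u)]linearZ.
    have dL := (adm_F1 adm).1 (j (zx z)) (j u) (zx_V zD).
    have vL := DL_range adm (j u) (zx_V zD); rewrite Az linear0 ip0l in vL.
    split; first by rewrite /derivable /= E; exact: dL.
    by rewrite /derive /= E; exact: vL.
  by rewrite UE.
have : j (zx z) = 0 by rewrite zx0 linear0.
rewrite (j_zx zD.1) => jz.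
have [hz _] := hP zD.
have := P0D adm sd z (j (h z)); rewrite jz hz addr0 (P0_H0 adm sd zD.1).
by rewrite (P0_H0 adm sd H0_sub.1).
Qed.

Lemma reduction_map_holds : reduction_map ip j V A H0 eps h.
Proof.
split => //.
- move=> z zB; have [hz _] := hP (BD zB).
  split; first exact/(H0_orthP adm sd).
  exact/rV/zeta_small/BD.
- exists k; split; first exact: num_real.
  move=> x kx [z z'] [/= zB z'B]; rewrite (le_trans (hlip (BD zB) (BD z'B)))//.
  by rewrite ler_wpM2r// ltW.
- move=> z zB /=; have := jA_zx_H0 (BD zB) => Az.
  by rewrite (P0_H0 adm sd Az) subrr.
Qed.

End ReducedFunctional.

(** * Topologies induced by X, and assembly of the theorem *)

Lemma homeomorphism_onS (S T : topologicalType) (D D' : set S) (W : set T) (f : S -> T) :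
  homeomorphism_on D W f -> D' `<=` D -> homeomorphism_on D' (f @` D') f.
Proof.
move=> [g [fD gf fc gc]] D'D; exists g; split => //.
- by move=> x /D'D; exact: gf.
- exact: continuous_subspaceW fc.
- apply: continuous_subspaceW gc => y [x D'x <-].
  by rewrite -fD; exists x => //; exact: D'D.
Qed.

(** In X the map is the sum of the identity in z, of h, which is Lipschitz into X, and of phi, whose
    values lie in [Hm], where convergence in H implies convergence in X. The inverse takes values in
    the kernel and [Hm], where the same comparison of norms applies. *)
Lemma homeomorphism_on_X (R : realType) (H X : completeNormedModType R)
    (ip : {dot H for idfun}) (j : {linear X -> H}) (V : set H)
    (L : H -> R) (A : X -> X) (B P Q : X -> {linear H -> H}) (Hp Hm : set H)
    (eps k : R) (h : H -> X) (phi : H -> H -> H) :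
  let B0 := sball (op_kernel (B 0)) eps in
  let Bm := sball Hm eps in
  let Phi := fun p : H * H => p.1 + j (h p.1) + phi p.1 p.2 in
  admissible ip j V L A B P Q -> spectral_decomposition ip (B 0) Hp Hm ->
  (forall z z', B0 z -> B0 z' -> `|h z - h z'| <= k * `|z - z'|) ->
  (forall z u, B0 z -> Bm u -> Hm (phi z u)) ->
  homeomorphism_on (B0 `*` Bm) (Phi @` (B0 `*` Bm)) Phi ->
  homeomorphism_on [set p : X * X | B0 (j p.1) /\ Bm (j p.2)]
    [set x : X | (Phi @` (B0 `*` Bm)) (j x)]
    (fun p : X * X => incl_inv j (Phi (j p.1, j p.2))).
Proof.
move=> B0 Bm Phi adm sd hlip phim [g [_ gf fc gc]].
have Hm_sub : linear_subspace Hm by case: sd => -[].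
have H0_sub : linear_subspace (op_kernel (B 0)) by exact: kernel_subspace.
have B0r z : B0 z -> range j z by move=> [z0 _]; exact: (H0_range adm z0).
have Bmr u : Bm u -> range j u by move=> [um _]; exact: (Hm_range adm sd um).
have PhiE z u : B0 z -> Bm u ->
    exists x, [/\ j x = Phi (z, u), x = incl_inv j z + h z + incl_inv j (phi z u) &
      incl_inv j (Phi (z, u)) = x].
  move=> zB uB; pose x := incl_inv j z + h z + incl_inv j (phi z u).
  have jx : j x = Phi (z, u).
    rewrite /x 2!linearD (incl_invKV adm (B0r _ zB)).
    by rewrite (incl_invKV adm (Hm_range adm sd (phim _ _ zB uB))).
  by exists x; rewrite -jx (incl_invK adm).
have [C0 _ C0P] := H0_incl_bounded adm.
have [C1 _ C1P] := Hm_incl_bounded adm sd.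
move/subspace_continuousP: fc => fc; move/subspace_continuousP: gc => gc.
exists (fun x => (incl_inv j (g (j x)).1, incl_inv j (g (j x)).2)); split.
- apply/seteqP; split => [_ [[x y] /= [xB yB] <-]|x [[z u] [/= zB uB] zuE]].
    exists (j x, j y) => //; have [w [jw _ ->]] := PhiE _ _ xB yB.
    by rewrite jw.
  exists (incl_inv j z, incl_inv j u) => /=.
    by rewrite (incl_invKV adm (B0r _ zB)) (incl_invKV adm (Bmr _ uB)).
  rewrite (incl_invKV adm (B0r _ zB)) (incl_invKV adm (Bmr _ uB)) zuE.
  exact: (incl_invK adm).
- move=> [x y] /= [xB yB]; have [w [jw _ ->]] := PhiE _ _ xB yB.
  by rewrite jw gf//= !(incl_invK adm).
- apply/subspace_continuousP => -[x0 y0] [/= x0B y0B].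
  pose F := within [set p : X * X | B0 (j p.1) /\ Bm (j p.2)] (nbhs (x0, y0)).
  have FF : Filter F by exact: within_filter.
  have FD : \forall p \near F, B0 (j p.1) /\ Bm (j p.2).
    by rewrite near_withinE; exact: filterE.
  have c1 : p.1 @[p --> F] --> x0 by exact: cvg_within_filter cvg_fst.
  have c2 : p.2 @[p --> F] --> y0 by exact: cvg_within_filter cvg_snd.
  have jc x : j y @[y --> x] --> j x by exact: (j_continuous adm).
  have jc1 : j p.1 @[p --> F] --> j x0 by exact: cvg_comp c1 (jc x0).
  have jc2 : j p.2 @[p --> F] --> j y0 by exact: cvg_comp c2 (jc y0).
  have hc : h (j p.1) @[p --> F] --> h (j x0).
    apply/cvgrPdist_lt => e e0; have k0 : 0 < `|k| + 1 by rewrite ltr_wpDl.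
    have ek : 0 < e / (`|k| + 1) by rewrite divr_gt0.
    move/cvgrPdist_lt: jc1 => /(_ _ ek) jc1'; apply: filterS2 FD jc1' => p [pB _] pe.
    rewrite (le_lt_trans (hlip _ _ x0B pB))//.
    rewrite (@le_lt_trans _ _ ((`|k| + 1) * `|j x0 - j p.1|))//.
      by rewrite ler_wpM2r// (le_trans (ler_norm _))// lerDl.
    by rewrite mulrC -ltr_pdivlMr.
  have Phic : Phi (j p.1, j p.2) @[p --> F] --> Phi (j x0, j y0).
    have := fc (j x0, j y0) (conj x0B y0B) => fc0.
    apply: (cvg_comp (fun p : X * X => (j p.1, j p.2)) Phi _ fc0) => U UP.
    have : \forall p \near F, (B0 `*` Bm) (j p.1, j p.2) -> U (j p.1, j p.2).
      have cp : (j p.1, j p.2) @[p --> F] --> (j x0, j y0) by exact: cvg_pair.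
      exact: (cp _ UP).
    by apply: filterS2 FD => p [pB1 pB2]; apply.
  have jhc : j p.1 + j (h (j p.1)) @[p --> F] --> j x0 + j (h (j x0)).
    by apply: cvgD => //; exact: cvg_comp hc (jc _).
  have phic : phi (j p.1) (j p.2) @[p --> F] --> phi (j x0) (j y0).
    have addK (v w : H) : v + w - v = w by rewrite addrC addKr.
    rewrite -(addK (j x0 + j (h (j x0))) (phi (j x0) (j y0))).
    rewrite (_ : (fun p : X * X => phi _ _) =
      fun p : X * X => Phi (j p.1, j p.2) - (j p.1 + j (h (j p.1)))); last first.
      by apply/funext => p; rewrite /Phi addK.
    exact: cvgB.
  have ic : incl_inv j (phi (j p.1) (j p.2)) @[p --> F] --> incl_inv j (phi (j x0) (j y0)).
    apply: (incl_cvg adm Hm_sub (Hm_range adm sd) C1P) => //; first exact: phim.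
    by apply: filterS FD => p [p1 p2]; exact: phim.
  have Ec : p.1 + h (j p.1) + incl_inv j (phi (j p.1) (j p.2)) @[p --> F] -->
      x0 + h (j x0) + incl_inv j (phi (j x0) (j y0)).
    by apply: cvgD => //; exact: cvgD.
  suff : incl_inv j (Phi (j p.1, j p.2)) @[p --> F] --> incl_inv j (Phi (j x0, j y0)) by [].
  have -> : incl_inv j (Phi (j x0, j y0)) = x0 + h (j x0) + incl_inv j (phi (j x0) (j y0)).
    by have [w [_ wE ->]] := PhiE _ _ x0B y0B; rewrite wE (incl_invK adm).
  apply: cvg_trans Ec; apply: near_eq_cvg; apply: filterS FD => p [p1 p2].
  by have [w [_ wE hE]] := PhiE _ _ p1 p2; rewrite [RHS]hE wE (incl_invK adm).
- apply/subspace_continuousP => x0 x0W.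
  pose W := [set x : X | (Phi @` (B0 `*` Bm)) (j x)].
  pose F := within W (nbhs x0); have FF : Filter F by exact: within_filter.
  have FD : \forall x \near F, W x by rewrite near_withinE; exact: filterE.
  have jc : j x @[x --> F] --> j x0.
    by apply: cvg_within_filter; exact: (j_continuous adm).
  have gB x : W x -> B0 (g (j x)).1 /\ Bm (g (j x)).2.
    by move=> [[z u] zuB <-]; rewrite gf.
  have gjc : g (j x) @[x --> F] --> g (j x0).
    apply: (cvg_comp (fun x => j x) g _ (gc (j x0) x0W)) => U UP.
    have : \forall x \near F, (Phi @` (B0 `*` Bm)) (j x) -> U (j x) by exact: (jc _ UP).
    by apply: filterS2 FD => x Wx; apply.
  have g1 : (g (j x)).1 @[x --> F] --> (g (j x0)).1 by exact: cvg_comp gjc cvg_fst.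
  have g2 : (g (j x)).2 @[x --> F] --> (g (j x0)).2 by exact: cvg_comp gjc cvg_snd.
  apply: cvg_pair.
    apply: (incl_cvg adm H0_sub (H0_range adm) C0P) => //; first by have [[]] := gB _ x0W.
    by apply: filterS FD => x /gB[[]].
  apply: (incl_cvg adm Hm_sub (Hm_range adm sd) C1P) => //; first by have [_ []] := gB _ x0W.
  by apply: filterS FD => x /gB[_ []].
Qed.

Theorem theorem2p1 (R : realType) (H X : completeNormedModType R)
    (ip : {dot H for idfun}) (j : {linear X -> H}) (V : set H)
    (L : H -> R) (A : X -> X) (B P Q : X -> {linear H -> H})
    (Hp Hm : set H) :
  admissible ip j V L A B P Q ->
  spectral_decomposition ip (B 0) Hp Hm ->
  let H0 := op_kernel (B 0) in
  let Hpm := orthogonal_complement ip H0 in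
  let Xpm := j @^-1` Hpm in
  let P0 := orthogonal_projection ip H0 in
  (exists2 z, H0 z & z != 0) ->
  exists (eps : R) (h : H -> X) (W : set H) (phi : H -> H -> H),
    let B0 := sball H0 eps in
    let Bp := sball Hp eps in
    let Bm := sball Hm eps in
    let Bpm := [set u | exists up um, [/\ Bp up, Bm um & u = up + um]] in
    let Phi := fun p : H * H => p.1 + j (h p.1) + phi p.1 p.2 in
    let A0 := fun u : X => 'D_u A 0 in
    let A0pm := fun u : X => A0 u - incl_inv j (P0 (j (A0 u))) in
    let Lo := fun z : H => L (z + j (h z)) in
    0 < eps /\
    reduction_map ip j V A H0 eps h /\
    (forall h', reduction_map ip j V A H0 eps h' ->
       forall z, B0 z -> h' z = h z) /\
    open W /\ W 0 /\ W `<=` V /\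
    homeomorphism_on (B0 `*` Bpm) W Phi /\
    Phi (0, 0) = 0 /\
    (forall z u, B0 z -> Bpm u -> Hpm (phi z u)) /\
    (forall z up um, B0 z -> Bp up -> Bm um ->
       L (Phi (z, up + um)) = `|up| ^+ 2 - `|um| ^+ 2 + L (z + j (h z))) /\
    (forall z up um, B0 z -> Bp up -> range j up -> Bm um ->
       range j (Phi (z, up + um))) /\
    (forall z, B0 z -> Phi (z, 0) = z + j (h z)) /\
    (forall z up um, B0 z -> Bp up -> Bm um ->
       Hm (phi z (up + um)) <-> up = 0) /\
    (B0 `<=` range j /\ Bm `<=` range j /\
     Phi @` (B0 `*` Bm) `<=` range j) /\
    homeomorphism_on (B0 `*` Bm) (Phi @` (B0 `*` Bm)) Phi /\
    homeomorphism_on [set p : X * X | B0 (j p.1) /\ Bm (j p.2)]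
      [set x : X | (Phi @` (B0 `*` Bm)) (j x)]
      (fun p : X * X => incl_inv j (Phi (j p.1, j p.2))) /\
    (exists2 A0pm_inv : X -> X, inverse_on Xpm A0pm A0pm_inv &
       strict_derivative H0 h 0
         (fun z => - A0pm_inv (A0pm (incl_inv j z)))) /\
    (exists dLo : H -> H -> R,
       [/\ is_C2m0 H0 B0 Lo dLo,
           forall z0 z, B0 z0 -> H0 z ->
             dLo z0 z = ip (j (A (incl_inv j z0 + h z0))) z
         & strict_derivative_op H0 dLo 0 (fun _ _ => 0)]) /\
    (isolated (critical_points setT (j @^-1` V) (L \o j)) 0 ->
     isolated (critical_points H0 B0 Lo) 0).
Proof.
move=> adm sd H0 Hpm Xpm P0 _.
have ipE := adm_hilbert_norm adm.
have H0_sub : linear_subspace H0 by exact: kernel_subspace.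
have [Hp_sub Hm_sub] : linear_subspace Hp /\ linear_subspace Hm by case: sd.
have [e1 [rh [k [h [[e10 rh0 k0 h0] [hP huniq hlip hstrict]]]]]] :=
  reduction_exists adm sd.
have [r [a [M [r0 a0 M0 rV [mono lip]]]]] := gradient_estimates adm sd.
have [dA [kA [dA0 kA0 A_lip]]] := A_locally_lipschitz adm.
have [C C0 CP] := H0_incl_bounded adm.
(* The three bounds: the domain of h, |z + h(z)| < r / 4 in H for the fiberwise construction, and z
   + h(z) in the X-ball where A is Lipschitz. *)
pose e0 := Num.min e1 (Num.min (r / 4 / (k + 1)) (dA / (C + k + 1))).
have k10 : 0 < k + 1 by rewrite ltr_wpDl.
have Ck0 : 0 < C + k + 1 by rewrite ltr_wpDl// addr_ge0.
have e00 : 0 < e0 by rewrite !lt_min e10 !divr_gt0.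
have D1 z : sball H0 e0 z -> [/\ sball H0 e1 z, `|z| < r / 4 / (k + 1) &
    `|z| < dA / (C + k + 1)].
  by move=> [z0]; rewrite /= !lt_min => /and3P[].
have B10 : sball H0 e1 0 by split; [exact: H0_sub.1|rewrite /= normr0].
have hle z : sball H0 e1 z -> `|h z| <= k * `|z|.
  by move=> zB; have := hlip z 0 zB B10; rewrite h0 !subr0.
have hP' z : sball H0 e0 z -> P0 (j (h z)) = 0 /\
    A (incl_inv j z + h z) = incl_inv j (P0 (j (A (incl_inv j z + h z)))).
  by move=> /D1[zB _ _]; have [] := hP z zB.
have hlip' z z' : sball H0 e0 z -> sball H0 e0 z' -> `|h z - h z'| <= k * `|z - z'|.
  by move=> /D1[zB _ _] /D1[zB' _ _]; exact: hlip.
have zx_small z : sball H0 e0 z -> `|incl_inv j z + h z| < dA.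
  move=> zD; have [zB _ zd] := D1 z zD; rewrite (le_lt_trans (ler_normD _ _))//.
  rewrite (le_lt_trans (lerD (CP _ zB.1) (hle _ zB)))// -mulrDl.
  move: zd; rewrite ltr_pdivlMr// mulrC; apply: le_lt_trans.
  by rewrite ler_wpM2r// lerDl.
pose zeta z := z + j (h z).
have zeta_small4 z : sball H0 e0 z -> `|zeta z| < r / 4.
  move=> zD; have [zB zr _] := D1 z zD; rewrite (le_lt_trans (ler_normD _ _))//.
  have h1 := le_trans (adm_incl_norm adm (h z)) (hle _ zB).
  rewrite (le_lt_trans (lerD (lexx _) h1))//.
  by move: zr; rewrite ltr_pdivlMr// mulrC mulrDl mul1r addrC.
have zeta_small z : sball H0 e0 z -> `|zeta z| < r.
  by move=> /zeta_small4 zr; apply: (lt_trans zr); move: r0; lra.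
have zeta_lip z z' : sball H0 e0 z -> sball H0 e0 z' ->
    `|zeta z - zeta z'| <= (k + 1) * `|z - z'|.
  move=> zD zD'; rewrite /zeta opprD addrACA (le_trans (ler_normD _ _))//.
  rewrite mulrDl mul1r [leRHS]addrC lerD// -linearB.
  exact: (le_trans (adm_incl_norm adm _) (hlip' _ _ zD zD')).
have zeta_crit z u : sball H0 e0 z -> P0 u = 0 -> 'D_u L (zeta z) = 0.
  exact: (zeta_critical adm sd rV hP' zeta_small).
have zeta_P0 z : sball H0 e0 z -> P0 (zeta z) = z.
  move=> zD; have [hz _] := hP' z zD; rewrite /P0 in hz.
  by rewrite /zeta /P0 (P0D adm sd) hz addr0 (P0_H0 adm sd zD.1).
have zeta0 : zeta 0 = 0 by rewrite /zeta h0 linear0 addr0.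
(* [rx] and [l1] spell out the radius and the number l + 1 of the fiberwise construction, so that
   the bounds on [eps] take the form required there. *)
pose rx := Num.min (r / 4) (r / 8 / (M / a)).
pose l1 := 1 + 2 / a + 1.
have l10 : 0 < l1 by rewrite !ltr_wpDr// divr_ge0// ltW.
pose eps := Num.min e0 (Num.min (rx / l1) (r / 8 / l1)).
have rx0 : 0 < rx by rewrite lt_min !divr_gt0.
have eps0 : 0 < eps by rewrite lt_min e00 lt_min !divr_gt0.
have eps_e0 : eps <= e0 by rewrite ge_min lexx.
have eps_rx : l1 * eps <= rx.
  by rewrite -ler_pdivlMl// mulrC !ge_min lexx !orbT.
have eps_ry : l1 * eps <= r / 8.
  by rewrite -ler_pdivlMl// [_^-1 * _]mulrC !ge_min lexx !orbT.
have [W [phi [Wo W0 WV homeo [phi0 phiL phiX phi00 phim]]]] :=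
  fiber_splitting adm sd r0 a0 M0 rV mono lip zeta_small4 zeta_lip zeta_crit
    zeta_P0 zeta0 eps0 eps_e0 eps_rx eps_ry.
exists eps, h, W, phi.
move=> B0 Bp Bm Bpm Phi A0 A0pm Lo.
have BD z : B0 z -> sball H0 e0 z.
  by move=> [z0 /= ze]; split => //=; exact: lt_le_trans eps_e0.
have B00 : B0 0 by split; [exact: H0_sub.1|rewrite /= normr0].
have Bp0 : Bp 0 by split; [exact: Hp_sub.1|rewrite /= normr0].
have Bm0 : Bm 0 by split; [exact: Hm_sub.1|rewrite /= normr0].
have Bm_pm : B0 `*` Bm `<=` B0 `*` Bpm.
  by move=> [z u] [zB uB]; split => //; exists 0, u; rewrite add0r.
have phi_Hm z u : B0 z -> Bm u -> Hm (phi z u).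
  by move=> zB uB; rewrite -[u]add0r; apply/phim.
have homeo_m : homeomorphism_on (B0 `*` Bm) (Phi @` (B0 `*` Bm)) Phi.
  exact: homeomorphism_onS homeo Bm_pm.
(* A'(0) takes values in the range of B(0), orthogonal to the kernel, so I - P^0 changes nothing. *)
have A0pmE u : A0pm u = A0 u.
  by rewrite /A0pm /A0 (jA0 adm) /P0 (B0_orth adm sd) (incl_inv0 adm) subr0.
have B0r z : B0 z -> range j z by move=> [z0 _]; exact: (H0_range adm z0).
split=> //; split.
  exact: (reduction_map_holds adm sd rV h0 hP' hlip' zeta_small eps_e0).
split.
  move=> h' h'P z zB.
  apply: (reduction_unique adm sd rh0 eps_e0 _ _ h'P zB).
    by move=> y /D1[yB _ _]; have [] := hP y yB.
  by move=> y x /D1[yB _ _]; exact: huniq.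
split=> //; split=> //; split=> //; split; first exact: homeo.
split.
  by rewrite /Phi /= h0 linear0 phi00// !addr0.
split.
  by move=> z u zB uB; apply/(H0_orthP adm sd); exact: phi0.
split; first exact: phiL.
split.
  move=> z up um zB pB [x _ xE] mB.
  have [y _ yE] := phiX z up um zB pB (ex_intro2 _ _ x I xE) mB.
  have [w _ wE] := B0r _ zB.
  by exists (w + h z + y) => //; rewrite 2!linearD wE yE.
split; first by move=> z zB; rewrite /Phi /= phi00// addr0.
split; first exact: phim.
split.
  split => //; split; first by move=> u [um _]; exact: (Hm_range adm sd um).
  move=> _ [[z u] [/= zB uB] <-].
  have [w _ wE] := B0r _ zB.
  have [y _ yE] := Hm_range adm sd (phi_Hm z u zB uB).
  by exists (w + h z + y) => //; rewrite 2!linearD wE yE.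
split=> //; split.
  apply: (@homeomorphism_on_X _ _ _ ip j V L A B P Q Hp Hm eps k h phi) => //.
  by move=> z z' zB zB'; apply: hlip'; exact: BD.
split.
  have [K [c [c0 KP Kc KV KA0]]] := reduced_inverse adm sd.
  exists K.
    have XpmP u : Xpm u <-> P0 (j u) = 0 by exact: (H0_orthP adm sd).
    split.
    - move=> _ [u _ <-]; rewrite A0pmE; apply/XpmP.
      by rewrite /A0 (jA0 adm); exact: (B0_orth adm sd).
    - by move=> _ [u /XpmP u0 <-]; apply/XpmP; have [] := KV u u0.
    - by split; [move=> b u v _ _; exact: KP|exists c => u _; exact: Kc].
    - by move=> u /XpmP u0; rewrite A0pmE; exact: KA0.
    - by move=> u /XpmP u0; rewrite A0pmE; have [] := KV u u0.
  have K0 : K 0 = 0.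
    by have := Kc 0; rewrite normr0 mulr0 normr_le0 => /eqP.
  (* A'(0) vanishes on the kernel, so the formula for h'(0) evaluates to 0, in agreement with the
     estimate [hstrict]. *)
  have d0 z : H0 z -> - K (A0pm (incl_inv j z)) = 0.
    move=> z0; rewrite A0pmE (_ : A0 (incl_inv j z) = 0) ?K0 ?oppr0//.
    apply: (j_zero adm); rewrite /A0 (jA0 adm) (incl_invKV adm)//.
    exact: (H0_range adm z0).
  split.
    split; first by move=> b u v u0 v0; rewrite !d0// ?scaler0 ?addr0//; exact: H0_sub.2.
    by exists 0 => u u0; rewrite d0// normr0 mul0r.
  move=> e ep; have [d dp dP] := hstrict e ep; exists d => // x y x0 y0.
  rewrite !subr0 => xd yd; rewrite d0 ?subr0; first exact: dP.
  exact: linear_subspaceB.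
split.
  exists (reduced_gradient ip j A h); split => //.
    exact: (reduced_C2m0 adm sd k0 C0 kA0 rV hP' hlip' CP A_lip zx_small zeta_small eps_e0).
  exact: (reduced_gradient_strict adm e00 k0 C0 h0 hlip' CP).
exact: (reduced_isolated adm sd k0 C0 kA0 rV h0 hP' hlip' CP A_lip zx_small zeta_small eps0 eps_e0).
Qed.
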